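(* Let $-\pi<a<b<\pi$, $E=[-\pi,a]\cup[b,\pi]$, $I=[a,b]$. Let $\Lambda\subset\mathbb{C}$, let $F$ be a generating function for $\Lambda$ in $PW_E$, and let $\mathrm{T}$ be the set of the other zeros of $F$ (the zeros of $F$ not in $\Lambda$). Suppose that $\Lambda$ is a complete interpolating sequence for $PW_E$. Then $$\inf_{t\in \mathrm{T}}\left|\frac{F^+(t)}{F'(t)}\right|\,\|\kappa^{\pi}_{t}\|_2\,\|\kappa^{I}_{\bar t}\|_2>0 .$$
   Context: For a compact set $S\subset\mathbb{R}$, the Paley-Wiener space $PW_S$ is the space of entire functions $f(z)=\int_S \varphi(t)e^{izt}\,dt$ with $\varphi\in L^2(S)$, with inner product $(f,g)=\frac1{2\pi}\int_{\mathbb{R}} f(x)\overline{g(x)}\,dx$. It is a reproducing kernel Hilbert space with reproducing kernel $\kappa^S_\lambda(z)=\int_S e^{i(z-\bar\lambda)t}\,dt$. We write $PW_c$ for $PW_{[-c,c]}$ and $\kappa^{c}_\lambda$ for $\kappa^{[-c,c]}_\lambda$. A set $\Lambda\subset\mathbb{C}$ is a complete interpolating sequence for $PW_S$ if for every $\{a_\lambda\}\in\ell^2(\Lambda)$ there is a unique $f\in PW_S$ with $f(\lambda)/\|\kappa^S_\lambda\|=a_\lambda$ for all $\lambda\in\Lambda$; equivalently, the normalized kernels $\{\kappa^S_\lambda/\|\kappa^S_\lambda\|\}_{\lambda\in\Lambda}$ form a Riesz basis of $PW_S$. Put $E^-=[-\pi,a]$, $E^+=[b,\pi]$. A generating function for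 $\Lambda$ in $PW_E$ is an entire function $F\not\equiv 0$ in $PW_E+z\,PW_E=\{f+zg: f,g\in PW_E\}$ with $F(\lambda)=0$ for all $\lambda\in\Lambda$. Such $F$ decomposes uniquely as $F=F^-+F^+$ with $F^\pm\in PW_{E^\pm}+z\,PW_{E^\pm}$. Standing assumption: all zeros of $F$ are simple. The infimum over the empty set is $+\infty$. *)

(* Defs.v *)
From HB Require Import structures.
From mathcomp Require Import all_boot all_order all_algebra complex.
From mathcomp Require Import all_classical all_reals all_analysis.

Set Implicit Arguments.
Unset Strict Implicit.
Unset Printing Implicit Defensive.

Import Order.TTheory GRing.Theory Num.Theory.
Import numFieldNormedType.Exports.

Local Open Scope classical_set_scope.
Local Open Scope complex_scope.
Local Open Scope ring_scope.

(* [R[i]^o] is [R[i]] as a normed module over itself, so that the derivative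
   below is taken along complex increments. *)
Definition entire (R : realType) (F : R[i] -> R[i]) : Prop :=
  forall z : R[i], derivable (F : R[i]^o -> R[i]^o) z 1.

Definition cderive (R : realType) (F : R[i] -> R[i]) : R[i] -> R[i] :=
  derive1 (F : R[i]^o -> R[i]^o).

Definition cexp (R : realType) (z : R[i]) : R[i] :=
  (expR (complex.Re z) * cos (complex.Im z))
  +i* (expR (complex.Re z) * sin (complex.Im z)).

(* [Rintegral] is 0 on functions whose integral is not finite; every integrand
   below is Lebesgue integrable for the arguments of interest: on a compact set
   S, elements of L^2(S) are integrable, and on the real line only products of
   two elements of L^2 are integrated. *)
Definition Cintegral (R : realType) (S : set R) (g : R -> R[i]) : R[i] :=
  (\int[@lebesgue_measure R]_(t in S) complex.Re (g t))
  +i* (\int[@lebesgue_measure R]_(t in S) complex.Im (g t)).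

Definition L2 (R : realType) (S : set R) (phi : R -> R[i]) : Prop :=
  [/\ measurable_fun S (fun t => complex.Re (phi t)),
      measurable_fun S (fun t => complex.Im (phi t)) &
      (\int[@lebesgue_measure R]_(t in S)
         (Normc.normc (phi t) ^+ 2)%R%:E < +oo)%E].

Definition PW (R : realType) (S : set R) : set (R[i] -> R[i]) :=
  [set f | exists2 phi : R -> R[i], L2 S phi &
     forall z : R[i],
       f z = Cintegral S (fun t => phi t * cexp ((0 +i* 1) * z * t%:C))].

Definition PWdot (R : realType) (f g : R[i] -> R[i]) : R[i] :=
  ((2 * pi)^-1)%:C *
  Cintegral [set: R] (fun x => f x%:C * (g x%:C)^*%C).

Definition PWnorm (R : realType) (f : R[i] -> R[i]) : R :=
  Num.sqrt (complex.Re (PWdot f f)).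

Definition kappa (R : realType) (S : set R) (l : R[i]) : R[i] -> R[i] :=
  fun z => Cintegral S (fun t => cexp ((0 +i* 1) * (z - l^*%C) * t%:C)).

(* An element of l^2(L) is given by a function on the whole plane, of which only
   the values on L matter. *)
Definition complete_interpolating (R : realType) (S : set R) (L : set R[i]) :
    Prop :=
  forall a : R[i] -> R[i],
    (\esum_(l in L) (Normc.normc (a l) ^+ 2)%R%:E < +oo)%E ->
    exists! f : R[i] -> R[i],
      PW S f /\ forall l, L l -> f l / (PWnorm (kappa S l))%:C = a l.

Definition PW_zPW (R : realType) (S : set R) : set (R[i] -> R[i]) :=
  [set F | exists f g : R[i] -> R[i],
     [/\ PW S f, PW S g & forall z, F z = f z + z * g z]].

Definition generating_function (R : realType) (S : set R) (L : set R[i])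
    (F : R[i] -> R[i]) : Prop :=
  [/\ entire F, exists z, F z != 0, PW_zPW S F & forall l, L l -> F l = 0].

Definition simple_zeros (R : realType) (F : R[i] -> R[i]) : Prop :=
  forall z, F z = 0 -> cderive F z != 0.

(* Main.v *)
Require Import Defs.
From mathcomp Require Import all_boot all_order all_algebra complex.
From mathcomp Require Import all_classical all_reals all_analysis.
From mathcomp Require Import measurable_realfun ring lra.
Import Order.TTheory GRing.Theory Num.Theory.
Import numFieldNormedType.Exports.
Local Open Scope classical_set_scope.
Local Open Scope complex_scope.
Local Open Scope ring_scope.

(** Let t be a zero of F outside Lambda. Dividing F^- and F^+ by z - t gives
    F(z) / (z - t) = h(z) + i F^+(t) kappa^I_(conj t)(z) with h in PW_E. At the points
    of Lambda the left-hand side vanishes, so h interpolates there the values of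
    - i F^+(t) kappa^I_(conj t). Complete interpolation makes the solution operator
    bounded (uniform boundedness principle and projection onto the closed span of the
    kernels) and forces Lambda to be separated, so that
    sum_l |kappa^I_(conj t)(l)|^2 / ||kappa^E_l||^2 <= C ||kappa^I_(conj t)||^2,
    because ||kappa^E_l||^2 is at least of order e^(2 pi |Im l|) / (1 + |Im l|).
    Evaluating h near t gives |F'(t)| <= K |F^+(t)| ||kappa^pi_t|| ||kappa^I_(conj t)||
    with K independent of t. All norms of kernels are estimated directly from explicit
    formulas; Plancherel's theorem is not used. *)

Set Implicit Arguments.
Unset Strict Implicit.
Unset Printing Implicit Defensive.

(** Without Plancherel, the squared norm of evaluation on densities ([energy]) and the norm of the
    kernel on the line ([PWnorm (kappa S l)]) are separate quantities. The argument is arranged so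
    that the first is only bounded from above and the second only from below, each by endpoint
    exponentials divided by 1 + |Im l|, and these denominators cancel at the end. The lower bounds
    need |kappa|^2 to be integrable on the line, since [Rintegral] is 0 on divergent integrals. The
    sum over Lambda is controlled because I lies strictly inside [-pi, pi]: its kernel grows at most
    like e^(m |Im l|) with m = max(|a|, |b|) < pi, and the surplus e^((pi - m) |Im l|) in
    ||kappa^E_l|| absorbs every power of 1 + |Im l|. The term F^+(t) kappa^I near t is not covered
    by the bound on h; it is absorbed because ||kappa^pi_t|| ||kappa^I_(conj t)|| is bounded below,
    again by strict inclusion. *)

(** * Uniform boundedness for functionals on square-summable families *)

Section UniformBoundedness.
Variable R : realType.

(** Evaluate at the minimiser [- b / c]; for [c = 0] a nonzero slope would make the affine function
    reach -1. This gives the Cauchy-Schwarz inequalities and also the near-orthogonality in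
    [projection]. *)
Lemma discriminant_le (a b c : R) : 0 <= c ->
  (forall t, 0 <= a + 2 * t * b + t ^+ 2 * c) -> b ^+ 2 <= a * c.
Proof.
move=> c0 h; have [c_gt0|] := ltP 0 c.
  have := h (- b / c); have -> : a + 2 * (- b / c) * b + (- b / c) ^+ 2 * c
    = (a * c - b ^+ 2) / c by field; rewrite gt_eqF.
  by rewrite pmulr_lge0 ?invr_gt0// subr_ge0.
move=> c_le0; have {c0 c_le0}c0 : c = 0 by apply/eqP; rewrite eq_le c_le0.
move: h; rewrite c0 mulr0 => h; have [->|b0] := eqVneq b 0.
  by rewrite expr0n.
have := h (- (a + 1) / (2 * b)).
have -> : a + 2 * (- (a + 1) / (2 * b)) * b + (- (a + 1) / (2 * b)) ^+ 2 * 0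
  = -1 by field.
by rewrite ler0N1.
Qed.

Lemma Cauchy_Schwarz_sum (I : Type) (s : seq I) (f g : I -> R) :
  (\sum_(i <- s) f i * g i) ^+ 2 <=
  (\sum_(i <- s) f i ^+ 2) * \sum_(i <- s) g i ^+ 2.
Proof.
apply: discriminant_le => [|t]; first by apply: sumr_ge0 => i _; exact: sqr_ge0.
rewrite !mulr_sumr -!big_split/=; apply: sumr_ge0 => i _.
have -> : f i ^+ 2 + 2 * t * (f i * g i) + t ^+ 2 * g i ^+ 2 =
  (f i + t * g i) ^+ 2 by ring.
exact: sqr_ge0.
Qed.

Lemma cvgn_sum (I : Type) (s : seq I) (u : I -> nat -> R) (l : I -> R) :
  (forall i, u i @ \oo --> l i) ->
  (fun n => \sum_(i <- s) u i n) @ \oo --> \sum_(i <- s) l i.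
Proof.
move=> ul; apply: (@cvg_big _ _ +%R 0 xpredT _ _ \oo _ u) => //.
exact: add_continuous.
Qed.

Lemma cvgn_le (u : nat -> R) (l B : R) :
  u @ \oo --> l -> (\forall n \near \oo, u n <= B) -> l <= B.
Proof.
move=> ul uB; rewrite -(cvg_lim _ ul)//; apply: limr_le => //.
by apply/cvg_ex; exists l.
Qed.

(* The elementary proof of the uniform boundedness principle (A. Sokal): one of
   x + h and x - h is at least as far from the kernel of a functional as h. *)
Lemma gliding_hump (I : eqType) (c : nat -> I -> R) (S : nat -> seq I) :
  (forall k s, uniq s -> \sum_(i <- s) c k i ^+ 2 <= 1) ->
  (forall k, uniq (S k)) ->
  (forall k, \sum_(i <- S k) c k i ^+ 2 = 1) ->
  exists2 a : I -> R,
    forall s, uniq s -> \sum_(i <- s) a i ^+ 2 <= 9 / 4 &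
    forall k, 3^-1 ^+ k / 2 <= `|\sum_(i <- S k) c k i * a i|.
Proof.
move=> c1 uS cS.
pose l k (x : I -> R) := \sum_(i <- S k) c k i * x i.
pose sg k (x : I -> R) : R :=
  if 3^-1 ^+ k <= `|l k x + 3^-1 ^+ k| then 1 else -1.
pose A := fix A n : I -> R := if n is k.+1 then
  (fun i => A k i + sg k (A k) * 3^-1 ^+ k * c k i) else (fun=> 0).
have sgE k x : `|sg k x| = 1 by rewrite /sg; case: ifP; rewrite ?normrN normr1.
have sg2 k x : sg k x ^+ 2 = 1 by rewrite -real_normK ?num_real// sgE expr1n.
have t0 k : 0 < (3^-1 : R) ^+ k by rewrite exprn_gt0// invr_gt0.
have lD k n : l k (A n.+1) = l k (A n) + sg n (A n) * 3^-1 ^+ n *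
    \sum_(i <- S k) c k i * c n i.
  rewrite /l mulr_sumr -big_split/=; apply: eq_bigr => i _; ring.
have lk k : 3^-1 ^+ k <= `|l k (A k.+1)|.
  rewrite (lD k k).
  have -> : \sum_(i <- S k) c k i * c k i = 1.
    by rewrite -[RHS](cS k); apply: eq_bigr => i _; rewrite expr2.
  rewrite mulr1 /sg; case: ifPn => [|]; first by rewrite mul1r.
  move: (t0 k); set t := _ ^+ k; set u := l k _ => tp.
  rewrite -ltNge ltr_norml => /andP[h1 h2].
  by rewrite ler0_norm; lra.
(* The extra term 3^-n * 3/2 is the sum of 3^-j over j >= n, that is, all that the remaining steps
   can still take away; at n = k + 1 the left side is exactly 3^-k. *)
have lkj k n : (k < n)%N ->
    3^-1 ^+ k / 2 + 3^-1 ^+ n * (3 / 2) <= `|l k (A n)|.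
  elim: n => // n IH; rewrite ltnS leq_eqVlt => /predU1P[<-|/IH {}IH].
    apply: le_trans (lk k).
    by rewrite exprS; move: (t0 k); lra.
  have cc : `|\sum_(i <- S k) c k i * c n i| <= 1.
    rewrite -(ler_pXn2r (ltn0Sn 1)) ?nnegrE// expr1n.
    rewrite real_normK ?num_real//; apply: le_trans (Cauchy_Schwarz_sum _ _ _) _.
    by rewrite cS mul1r c1.
  rewrite (lD k n); set u := _ * _ * _.
  have hu : `|u| <= 3^-1 ^+ n.
    by rewrite /u !normrM sgE mul1r gtr0_norm// ler_piMr// ltW.
  have := lerB_dist (l k (A n)) (- u); rewrite opprK normrN.
  by rewrite exprS; move: IH hu; lra.
have ci k i : `|c k i| <= 1.
  rewrite -(ler_pXn2r (ltn0Sn 1)) ?nnegrE// expr1n real_normK ?num_real//.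
  by have := c1 k [:: i] isT; rewrite big_seq1.
(* The radius (1 - 3^-n) * 3/2 is the sum of the step lengths 3^-j for j < n; its limit 3/2 gives
   the bound 9/4. *)
have A2 n s : uniq s ->
    \sum_(i <- s) A n i ^+ 2 <= ((1 - 3^-1 ^+ n) * (3 / 2)) ^+ 2.
  move=> us; elim: n => [|n IH].
    by rewrite big1 ?sqr_ge0// => i _; rewrite expr2 mul0r.
  have -> : \sum_(i <- s) A n.+1 i ^+ 2 = \sum_(i <- s) A n i ^+ 2
    + 2 * (sg n (A n) * 3^-1 ^+ n) * (\sum_(i <- s) A n i * c n i)
    + (sg n (A n) * 3^-1 ^+ n) ^+ 2 * (\sum_(i <- s) c n i ^+ 2).
    rewrite !mulr_sumr -!big_split/=; apply: eq_bigr => i _; ring.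
  set r := (1 - (3^-1 : R) ^+ n) * (3 / 2).
  have r0 : 0 <= r by rewrite mulr_ge0// subr_ge0 exprn_ile1// invf_le1 ?ler1n.
  have -> : (1 - (3^-1 : R) ^+ n.+1) * (3 / 2) = r + 3^-1 ^+ n.
    by rewrite /r exprS; field.
  set t := (3^-1 : R) ^+ n; have tp : 0 < t := t0 n.
  have cc : `|\sum_(i <- s) A n i * c n i| <= r.
    rewrite -(ler_pXn2r (ltn0Sn 1)) ?nnegrE// real_normK ?num_real//.
    apply: le_trans (Cauchy_Schwarz_sum _ _ _) _.
    apply: le_trans IH; rewrite ler_piMr ?c1//.
    by apply: sumr_ge0 => i _; exact: sqr_ge0.
  have h1 : 2 * (sg n (A n) * t) * (\sum_(i <- s) A n i * c n i) <= 2 * t * r.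
    apply: le_trans (ler_norm _) _; rewrite !normrM sgE mul1r (gtr0_norm tp).
    by rewrite ger0_norm// ler_wpM2l// mulr_ge0// ltW.
  rewrite exprMn sg2 mul1r sqrrD.
  have := c1 n s us; move: IH h1 (sqr_ge0 t); rewrite -/r.
  set x := \sum_(i <- s) _; set y := \sum_(i <- s) _; set z := \sum_(i <- s) _.
  nra.
have Acvg i : cvgn (fun n => A n i).
  have -> : (fun n => A n i) = series (fun k => sg k (A k) * 3^-1 ^+ k * c k i).
    apply/funext => n; rewrite /series/=.
    elim: n => [|n IH]; first by rewrite big_geq.
    by rewrite big_nat_recr//= -IH.
  apply: normed_cvg.
  apply: (@series_le_cvg _ _ (geometric (1 : R) 3^-1)) => [n|n|n|].
  - by rewrite /=.
  - by rewrite /geometric/= mul1r ltW.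
  - rewrite /geometric/= mul1r !normrM sgE mul1r gtr0_norm//.
    by rewrite ler_piMr// ltW.
  - by apply: is_cvg_geometric_series; rewrite ger0_norm ?invr_ge0// invf_lt1 ?ltr1n.
pose a i := lim ((fun n => A n i) @ \oo).
have Aa i : (fun n => A n i) @ \oo --> a i by exact: Acvg.
exists a => [s us|k].
  apply: (@cvgn_le (fun n => \sum_(i <- s) A n i ^+ 2)).
    apply: cvgn_sum => i; under eq_fun do rewrite expr2; rewrite expr2.
    exact: cvgM.
  apply: nearW => n; apply: le_trans (A2 n s us) _.
  have : (3^-1 : R) ^+ n <= 1 by rewrite exprn_ile1// invf_le1 ?ler1n.
  move: (t0 n); set t := _ ^+ _ => p q; nra.
rewrite -lerN2; apply: (@cvgn_le (fun n => - `|l k (A n)|)).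
  apply: cvgN; apply: cvg_norm; apply: cvgn_sum => i.
  by apply: cvgM; [exact: cvg_cst|].
near=> n; rewrite lerN2; apply: le_trans (lkj k n _).
  by rewrite lerDl mulr_ge0// ltW.
near: n; exact: nbhs_infty_gt.
Unshelve. all: by end_near. Qed.

End UniformBoundedness.

(** * Semi-inner products: Riesz lower bound, projection and bounded solution of moment problems *)

Section HilbertSpace.
Variable R : realType.

(** Replaces passages to the limit below: inequalities between inner products are proved with an
    error of order 2^-n. *)
Lemma le0_geometric (x M : R) : (forall n, x <= M * 2^-1 ^+ n) -> x <= 0.
Proof.
move=> h; have : (fun n => M * 2^-1 ^+ n) @ \oo --> M * 0.
  apply: cvgM; first exact: cvg_cst.
  by apply: cvg_expr; rewrite ger0_norm// invf_lt1// ltr1n.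
rewrite mulr0 => Mc; rewrite -oppr_ge0 -[0]oppr0 lerN2.
apply: (@cvgn_le R (fun n => x - M * 2^-1 ^+ n)); last first.
  by apply: nearW => n; rewrite subr_le0.
by rewrite -[X in _ --> X]subr0; apply: cvgB => //; exact: cvg_cst.
Qed.

Section UniqSums.
Variable I : eqType.

(** Square-summability over an arbitrary index type is phrased as a common bound on sums over
    duplicate-free sequences; this section compares such sums. *)
Lemma big_uniq_support (W : nmodType) (f : I -> W) (s s' : seq I) :
  (forall i, i \notin s -> f i = 0) -> uniq s -> uniq s' ->
  \sum_(i <- s') f i = \sum_(i <- s | i \in s') f i.
Proof.
move=> f0 us us'; rewrite (bigID (mem s))/= [X in _ + X]big1// addr0.
rewrite -[LHS]big_filter -[RHS]big_filter; apply: perm_big.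
apply: uniq_perm; rewrite ?filter_uniq// => i.
by rewrite !mem_filter andbC.
Qed.

Lemma ler_sum_support (f : I -> R) (s s' : seq I) : (forall i, 0 <= f i) ->
  (forall i, i \notin s -> f i = 0) -> uniq s -> uniq s' ->
  \sum_(i <- s') f i <= \sum_(i <- s) f i.
Proof.
move=> fp f0 us us'; rewrite (big_uniq_support f0 us us').
by rewrite [leRHS](bigID (mem s'))/= lerDl sumr_ge0.
Qed.

Lemma ler_sum_subset (f : I -> R) (s s' : seq I) : (forall i, 0 <= f i) ->
  uniq s -> uniq s' -> {subset s <= s'} ->
  \sum_(i <- s) f i <= \sum_(i <- s') f i.
Proof.
move=> f0 us us' ss'; rewrite [leRHS](bigID (mem s))/=.
apply: ler_wpDr; first by apply: sumr_ge0 => i _; exact: f0.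
rewrite -[leRHS]big_filter le_eqVlt; apply/orP; left; apply/eqP.
apply: perm_big; apply: uniq_perm => //; first exact: filter_uniq.
by move=> i; rewrite mem_filter; case: (boolP (i \in s)) => // /ss' ->.
Qed.

End UniqSums.

Section InnerProduct.
(** Modelled on square-integrable functions before any quotient by null sets: linearity is assumed
    only on the domain [D], and [ip] is merely positive semidefinite. *)
Variables (V : lmodType R) (D : V -> Prop) (ip : V -> V -> R).
Hypothesis D0 : D 0.
Hypothesis DP : forall c u v, D u -> D v -> D (c *: u + v).
Hypothesis ipC : forall u v, ip u v = ip v u.
Hypothesis ipP : forall c u v w, D u -> D v -> D w ->
  ip (c *: u + v) w = c * ip u w + ip v w.
Hypothesis ip_ge0 : forall u, 0 <= ip u u.

Let DZ c u : D u -> D (c *: u).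
Proof. by move=> Du; rewrite -[_ *: _]addr0; exact: DP. Qed.

Let DD u v : D u -> D v -> D (u + v).
Proof. by move=> Du Dv; rewrite -[u]scale1r; exact: DP. Qed.

Let DB u v : D u -> D v -> D (u - v).
Proof. by move=> Du Dv; rewrite addrC -scaleN1r; exact: DP. Qed.

Let ip0 w : D w -> ip 0 w = 0.
Proof.
move=> Dw; have := @ipP 1 0 0 w D0 D0 Dw.
by rewrite scale1r addr0 mul1r => /eqP; rewrite -subr_eq0 opprD addNKr oppr_eq0 => /eqP.
Qed.

Let ipZ c u w : D u -> D w -> ip (c *: u) w = c * ip u w.
Proof. by move=> Du Dw; rewrite -[c *: u]addr0 ipP// ip0// addr0. Qed.

Let ipD u v w : D u -> D v -> D w -> ip (u + v) w = ip u w + ip v w.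
Proof. by move=> Du Dv Dw; rewrite -[u in LHS]scale1r ipP// mul1r. Qed.

Let ipB u v w : D u -> D v -> D w -> ip (u - v) w = ip u w - ip v w.
Proof. by move=> Du Dv Dw; rewrite addrC -scaleN1r ipP// mulN1r addrC. Qed.

Let ip_sqP c u v : D u -> D v ->
  ip (c *: u + v) (c *: u + v) = c ^+ 2 * ip u u + 2 * c * ip u v + ip v v.
Proof.
move=> Du Dv; rewrite ipP//; last exact: DP.
rewrite (ipC u) (ipC v) !ipP// (ipC v u); ring.
Qed.

Let ip_sqB u v : D u -> D v -> ip (u - v) (u - v) = ip u u - 2 * ip u v + ip v v.
Proof.
move=> Du Dv; rewrite addrC -scaleN1r ip_sqP// (ipC v u); ring.
Qed.

Lemma ip_Cauchy_Schwarz u v : D u -> D v -> ip u v ^+ 2 <= ip u u * ip v v.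
Proof.
move=> Du Dv; apply: discriminant_le => // t.
apply: le_trans (ip_ge0 (t *: v + u)) _.
by rewrite ip_sqP// (ipC v u); lra.
Qed.

Section Riesz.
Variables (I : eqType) (k : I -> V).
Hypothesis Dk : forall i, D (k i).

Let DS s (c : I -> R) : D (\sum_(i <- s) c i *: k i).
Proof.
elim: s => [|i s IH]; first by rewrite big_nil.
by rewrite big_cons; apply: DP.
Qed.

Let ipS s (c : I -> R) w : D w ->
  ip (\sum_(i <- s) c i *: k i) w = \sum_(i <- s) c i * ip (k i) w.
Proof.
move=> Dw; elim: s => [|i s IH]; first by rewrite !big_nil ip0.
by rewrite !big_cons ipP// IH.
Qed.

Hypothesis interp : forall a : I -> R,
  (exists B, forall s, uniq s -> \sum_(i <- s) a i ^+ 2 <= B) ->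
  exists2 phi, D phi & forall i, ip phi (k i) = a i.

(** Otherwise some combinations v_n satisfy 81^n ||v_n||^2 < r_n^2, with r_n^2 the sum of squared
    coefficients. The gliding hump gives square-summable data whose solution phi has 3^-n / 2 <=
    |(v_n / r_n, phi)| <= 9^-n ||phi|| for all n, which is absurd. The base 81 makes 9^-n decay
    faster than 3^-n. *)
Lemma riesz_fischer : exists2 C : R, 0 < C & forall s (c : I -> R), uniq s ->
  \sum_(i <- s) c i ^+ 2 <=
  C * ip (\sum_(i <- s) c i *: k i) (\sum_(i <- s) c i *: k i).
Proof.
apply: contrapT => /forall2NP noC.
have pick (n : nat) : exists sc : seq I * (I -> R), uniq sc.1 /\
    81 ^+ n * ip (\sum_(i <- sc.1) sc.2 i *: k i) (\sum_(i <- sc.1) sc.2 i *: k i)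
    < \sum_(i <- sc.1) sc.2 i ^+ 2.
  have [/negP|] := noC (81 ^+ n); first by rewrite exprn_gt0.
  move=> /existsNP[s /existsNP[c /not_implyP[us /negP]]].
  by rewrite -ltNge => h; exists (s, c).
have [sc scP] := choice pick.
pose S n := (sc n).1; pose c n := (sc n).2.
pose N n := \sum_(i <- S n) c n i ^+ 2.
have N0 n : 0 < N n.
  by apply: le_lt_trans (scP n).2; rewrite mulr_ge0// exprn_ge0.
pose r n := Num.sqrt (N n).
have r0 n : 0 < r n by rewrite sqrtr_gt0.
have r2 n : r n ^+ 2 = N n by rewrite sqr_sqrtr// ltW.
(* [gliding_hump] asks for norm at most 1 over every duplicate-free sequence, hence the extension by
   0 off [S n]. *)
pose c' n i := if i \in S n then c n i / r n else 0.
have c'E n : \sum_(i <- S n) c' n i ^+ 2 = 1.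
  under eq_big_seq => i iS do rewrite /c' iS exprMn exprVn r2.
  by rewrite -mulr_suml divff// gt_eqF// N0.
have [|||a aB al] := @gliding_hump R I c' S.
- move=> n s us; rewrite -(c'E n).
  apply: ler_sum_support => //; last by case: (scP n).
    by move=> i; rewrite sqr_ge0.
  by move=> i /negbTE iS; rewrite /c' iS expr2 mul0r.
- by move=> n; case: (scP n).
- exact: c'E.
have [phi Dphi phia] : exists2 phi, D phi & forall i, ip phi (k i) = a i.
  by apply: interp; exists (9 / 4).
pose M := ip phi phi; have M0 : 0 <= M := ip_ge0 phi.
have hM n : 9 ^+ n <= 4 * M.
  have := al n.
  pose v := \sum_(i <- S n) c n i *: k i.
  have -> : \sum_(i <- S n) c' n i * a i = ip v phi / r n.
    rewrite /v ipS// mulr_suml; apply: eq_big_seq => i iS.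
    by rewrite /c' iS -phia ipC mulrAC.
  move=> h.
  have : (3^-1 ^+ n / 2) ^+ 2 <= (ip v phi / r n) ^+ 2.
    rewrite -[leRHS]real_normK ?num_real// ler_pXn2r// nnegrE.
    by rewrite mulr_ge0// exprn_ge0// invr_ge0.
  have -> : (ip v phi / r n) ^+ 2 = ip v phi ^+ 2 / N n by rewrite expr_div_n r2.
  rewrite exprMn => {}h.
  have h2 : ip v phi ^+ 2 <= ip v v * M by apply: ip_Cauchy_Schwarz => //; exact: DS.
  have h3 : 81 ^+ n * ip v v <= N n by case: (scP n) => _ /ltW.
  have h4 : (3^-1 ^+ n) ^+ 2 * 2^-1 ^+ 2 * N n <= ip v v * M.
    by rewrite -ler_pdivlMr//; apply: le_trans h _; rewrite ler_pM2r ?invr_gt0.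
  have e : (81 : R) ^+ n = 9 ^+ n * 9 ^+ n by rewrite -exprMn; congr (_ ^+ n); ring.
  have e' : (9 : R) ^+ n * (3^-1 ^+ n) ^+ 2 = 1.
    by rewrite -exprM mulnC exprM -exprMn -[RHS](expr1n _ n); congr (_ ^+ n); field.
  have p9 : 0 < (9 : R) ^+ n by rewrite exprn_gt0.
  have h5 : 9 ^+ n * (N n) <= 4 * M * N n.
    have : 4 * 81 ^+ n * ((3^-1 ^+ n) ^+ 2 * 2^-1 ^+ 2 * N n) <=
           4 * 81 ^+ n * (ip v v * M).
      by rewrite ler_wpM2l// mulr_ge0// exprn_ge0.
    have -> : 4 * 81 ^+ n * ((3^-1 ^+ n) ^+ 2 * 2^-1 ^+ 2 * N n) =
       9 ^+ n * (9 ^+ n * (3^-1 ^+ n) ^+ 2) * N n * (4 * 2^-1 ^+ 2) by rewrite e; ring.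
    have -> : (4 * 2^-1 ^+ 2 : R) = 1 by field.
    rewrite e' !mulr1 => h6; apply: le_trans h6 _.
    have -> : 4 * 81 ^+ n * (ip v v * M) = 4 * M * (81 ^+ n * ip v v) by ring.
    by rewrite ler_wpM2l// mulr_ge0.
  by rewrite -(ler_pM2r (N0 n)).
have : 1 <= (0 : R).
  apply: (@le0_geometric _ (4 * M)) => n.
  rewrite exprVn ler_pdivlMr ?exprn_gt0// mul1r; apply: le_trans (hM n).
  by rewrite lerXn2r// ?nnegrE// ler_nat.
by rewrite ler10.
Qed.

(** The coefficients vanish off [s] so that two combinations can be added over a common sequence. *)
Let span v := exists s (c : I -> R), [/\ uniq s, forall i, i \notin s -> c i = 0 &
  v = \sum_(i <- s) c i *: k i].

Let spanD v : span v -> D v.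
Proof. by move=> [s [c [_ _ ->]]]; exact: DS. Qed.

Let span_k i : span (k i).
Proof.
exists [:: i], (fun j => (j == i)%:R); split=> // [j|].
  by rewrite inE => /negbTE ->.
by rewrite big_seq1 eqxx scale1r.
Qed.

Let spanP a u v : span u -> span v -> span (a *: u + v).
Proof.
move=> [s [c [us c0 ->]]] [s' [c' [us' c0' ->]]].
exists (undup (s ++ s')), (fun i => a * c i + c' i); split.
- exact: undup_uniq.
- move=> i; rewrite mem_undup mem_cat negb_or => /andP[i1 i2].
  by rewrite c0// c0'// mulr0 addr0.
- have E t (d : I -> R) : uniq t -> (forall i, i \notin t -> d i = 0) ->
      {subset t <= s ++ s'} ->
      \sum_(i <- undup (s ++ s')) d i *: k i = \sum_(i <- t) d i *: k i.
    move=> ut dt tss; rewrite (@big_uniq_support _ _ _ t)//.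
    - rewrite big_seq_cond [RHS]big_seq; apply: eq_bigl => i.
      rewrite mem_undup; case: (boolP (i \in t)) => //= it.
      by rewrite tss.
    - by move=> i it; rewrite dt// scale0r.
    - exact: undup_uniq.
  rewrite -(E s c)//; last by move=> i ii; rewrite mem_cat ii.
  rewrite -(E s' c')//; last by move=> i ii; rewrite mem_cat ii orbT.
  rewrite scaler_sumr -big_split/=; apply: eq_bigr => i _.
  by rewrite scalerDl scalerA.
Qed.

(** Completeness with explicit rates avoids a topology on [V]. The constant 8 is 4 + 4:
    [square_integrable_complete] is applied to the real and to the imaginary part. *)
Hypothesis complete : forall u : nat -> V, (forall n, D (u n)) ->
  (forall n, ip (u n.+1 - u n) (u n.+1 - u n) <= 4^-1 ^+ n) ->
  exists2 v, D v & forall n, ip (v - u n) (v - u n) <= 8 * 2^-1 ^+ n.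

(** The limit of a sequence in the span minimising the distance to [phi]: the parallelogram law
    makes it Cauchy, and minimality makes [phi - u n] orthogonal to the span up to a vanishing
    error. *)
Lemma projection phi : D phi -> exists u : nat -> V, exists2 phi', D phi' &
  [/\ forall n, span (u n),
      forall n, ip (phi' - u n) (phi' - u n) <= 8 * 2^-1 ^+ n &
      forall w, span w -> ip phi' w = ip phi w].
Proof.
move=> Dphi; pose X := [set ip (phi - v) (phi - v) | v in span].
have span0 : span 0 by exists [::], (fun=> 0); split=> //; rewrite big_nil.
have Xi : has_inf X.
  split; first by exists (ip (phi - 0) (phi - 0)), 0.
  by exists 0 => _ [v _ <-].
pose d := inf X.
have dX v : span v -> d <= ip (phi - v) (phi - v).
  by move=> sv; apply: ge_inf; [exact: Xi.2|exists v].
have e0 n : 0 < 4^-1 * (4^-1 : R) ^+ n by rewrite mulr_gt0// ?exprn_gt0 ?invr_gt0.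
have [u uP] : {u : nat -> V & forall n, span (u n) /\
    ip (phi - u n) (phi - u n) < d + 4^-1 * 4^-1 ^+ n}.
  apply: (@choice _ _ (fun n v => span v /\
    ip (phi - v) (phi - v) < d + 4^-1 * 4^-1 ^+ n)) => n.
  by have [_ [v sv <-] vlt] := inf_adherent (e0 n) Xi; exists v.
have su n : span (u n) by case: (uP n).
have Du n : D (u n) by exact: spanD.
have un n : ip (phi - u n) (phi - u n) <= d + 4^-1 * 4^-1 ^+ n.
  by case: (uP n) => _ /ltW.
(* Parallelogram law with the midpoint, whose squared distance to [phi] is at least d: the two
   excesses over d contribute twice 4^-1 4^-n + 4^-1 4^-(n+1), which is 5/8 of 4^-n. *)
have uS n : ip (u n.+1 - u n) (u n.+1 - u n) <= 4^-1 ^+ n.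
  have sm : span (2^-1 *: (u n.+1 + u n)).
    rewrite -[_ *: _]addr0; apply: spanP => //.
    by rewrite -[u n.+1]scale1r; exact: spanP.
  have := dX _ sm; rewrite ip_sqB//; last by apply: DZ; exact: DD.
  rewrite ipC ipZ//; last exact: DD.
  rewrite ipZ//; [|exact: DD|by apply/DZ/DD].
  rewrite (ipC _ (2^-1 *: _)) ipZ//; [|exact: DD|exact: DD].
  rewrite ipD// (ipD (Du n.+1) (Du n))//; last exact: DD.
  rewrite (ipC _ (u n.+1 + u n)) ipD// (ipC (u n) (u n.+1 + u n)) ipD//.
  have := un n; have := un n.+1; rewrite !ip_sqB//.
  rewrite (ipC phi (u n)) (ipC phi (u n.+1)) (ipC (u n) (u n.+1)) exprS.
  have := e0 n; rewrite -(ipC (u n)).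
  lra.
have [phi' Dphi' phiu] := complete Du uS.
exists u, phi' => //; split=> // w sw.
have Dw := spanD sw.
(* Moving [u n] by t w cannot bring the squared distance below d, so a quadratic in t with constant
   term the excess of [u n] is nonnegative. *)
have ort n : ip (phi - u n) w ^+ 2 <= 4^-1 * 4^-1 ^+ n * ip w w.
  rewrite -sqrrN; apply: discriminant_le => // t.
  have := dX _ (spanP t sw (su n)).
  rewrite (_ : phi - _ = - t *: w + (phi - u n)); last first.
    by rewrite scaleNr opprD addrCA.
  rewrite ip_sqP//; last exact: DB.
  rewrite (ipC w) sqrrN; have := un n; lra.
apply/eqP; rewrite -subr_eq0 -ipB// -sqrf_eq0 eq_le sqr_ge0 andbT.
apply: (@le0_geometric _ (2 * (4^-1 + 8) * ip w w)) => n.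
have -> : phi' - phi = (phi' - u n) - (phi - u n) by rewrite opprB addrA subrK.
rewrite ipB//; [|exact: DB|exact: DB].
have := ort n; have := @ip_Cauchy_Schwarz (phi' - u n) w (DB Dphi' (Du n)) Dw.
have := phiu n.
have h : (4^-1 : R) ^+ n <= 2^-1 ^+ n.
  by rewrite lerXn2r ?nnegrE ?invr_ge0// lef_pV2 ?posrE// ler_nat.
have := ip_ge0 w; set W := ip w w; set x := ip _ w; set y := ip _ w.
set p := ip _ _; move: h; set q := _ ^+ n; set q' := _ ^+ n.
move=> h W0 hp hx hy.
have : p * W <= 8 * q' * W by rewrite ler_wpM2r.
have : q * W <= q' * W by rewrite ler_wpM2r.
have := sqr_ge0 (x + y).
nra.
Qed.

(** Projecting [phi] onto the closed span keeps its products with every [k i]. On the span the Riesz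
    lower bound gives (psi, u)^2 <= C A ||u||^2, and letting u tend to psi bounds ||psi||^2. *)
Lemma bounded_solution : exists2 C : R, 0 < C & forall phi A, D phi ->
  (forall s, uniq s -> \sum_(i <- s) ip phi (k i) ^+ 2 <= A) ->
  exists2 psi, D psi & (forall i, ip psi (k i) = ip phi (k i)) /\
    ip psi psi <= C * A.
Proof.
have [C C0 CP] := riesz_fischer.
exists (4 * C); first by rewrite mulr_gt0.
move=> phi A Dphi hA.
have [u [psi Dpsi [su psiu psiw]]] := projection Dphi.
exists psi => //; split; first by move=> i; exact: psiw.
have A0 : 0 <= A by have := hA [::] isT; rewrite big_nil.
have CA0 : 0 <= C * A by rewrite mulr_ge0// ltW.
have hu n : ip psi (u n) ^+ 2 <= C * A * ip (u n) (u n).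
  rewrite psiw//; have [s [c [us _ ->]]] := su n.
  rewrite ipC ipS//; apply: le_trans (Cauchy_Schwarz_sum _ _ _) _.
  under [X in _ * X]eq_bigr do rewrite ipC.
  rewrite mulrAC; apply: ler_pM => //.
  - by apply: sumr_ge0 => i _; exact: sqr_ge0.
  - by apply: sumr_ge0 => i _; exact: sqr_ge0.
  - exact: CP.
  - exact: hA.
set x := ip psi psi; have x0 : 0 <= x := ip_ge0 psi.
(* With q = (psi, psi - u_n) and p = ||psi - u_n||^2: x^2 <= 2 (x - q)^2 + 2 q^2 and q^2 <= x p.
   This crude splitting and - 2 q <= x + p produce the factor 4. *)
have : x ^+ 2 - 4 * (C * A) * x <= 0.
  apply: (@le0_geometric _ (8 * (4 * (C * A) + 2 * x))) => n.
  have Du := spanD (su n).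
  have := hu n; have := psiu n.
  have := @ip_Cauchy_Schwarz psi (psi - u n) Dpsi (DB Dpsi Du).
  have -> : ip psi (u n) = x - ip psi (psi - u n).
    by rewrite (ipC psi (psi - _)) ipB// -/x (ipC (u n)); ring.
  have -> : ip (u n) (u n) =
      x - 2 * ip psi (psi - u n) + ip (psi - u n) (psi - u n).
    by rewrite (ipC psi (psi - _)) ip_sqB// ipB// -/x (ipC (u n) psi); ring.
  rewrite -/x; have : 0 <= ip (psi - u n) (psi - u n) by exact: ip_ge0.
  set q := ip psi _; set p := ip (psi - _) _; set e := _ ^+ n => p0 h1 h2 h3.
  have h4 : - (2 * q) <= x + p.
    apply: le_trans (ler_norm _) _; rewrite normrN.
    rewrite -(ler_pXn2r (ltn0Sn 1)) ?nnegrE ?addr_ge0//.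
    by rewrite real_normK ?num_real//; have := sqr_ge0 (x - p); nra.
  have h5 : C * A * - (2 * q) <= C * A * (x + p) by rewrite ler_wpM2l.
  have h6 : p * (4 * (C * A) + 2 * x) <= 8 * e * (4 * (C * A) + 2 * x).
    by rewrite ler_wpM2r// addr_ge0// mulr_ge0.
  have := sqr_ge0 (x - 2 * q); lra.
rewrite expr2 -mulrBl; have [->|xn0] := eqVneq x 0.
  by rewrite !mulrA -mulrA mulr_ge0.
by rewrite pmulr_lle0 ?lt_neqAle 1?eq_sym ?xn0// subr_le0 mulrA.
Qed.

End Riesz.
End InnerProduct.
End HilbertSpace.

(** * Real square-integrable functions and their completeness *)

Section SquareIntegrable.
Context d (T : measurableType d) (R : realType) (mu : {measure set T -> \bar R}).
Variable S : set T.
Hypothesis mS : measurable S.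

(** A bound on the real-valued integral alone would not show integrability, so the hypothesis bounds
    the extended one. *)
Lemma Rintegral_le_fin (f : T -> R) (B : R) : measurable_fun S f ->
  (forall x, 0 <= f x) -> (\int[mu]_(x in S) (f x)%:E <= B%:E)%E ->
  mu.-integrable S (EFin \o f) /\ \int[mu]_(x in S) f x <= B.
Proof.
move=> mf f0 fB; have fi : mu.-integrable S (EFin \o f).
  apply/integrableP; split; first exact/measurable_EFinP.
  rewrite (eq_integral (EFin \o f)); last by move=> x _; rewrite /= ger0_norm.
  exact: le_lt_trans fB (ltry _).
by split=> //; rewrite -lee_fin /Rintegral fineK// integrable_fin_num.
Qed.

Lemma Rintegral_fin (f : T -> R) : mu.-integrable S (EFin \o f) ->
  (\int[mu]_(x in S) (f x)%:E)%E = (\int[mu]_(x in S) f x)%:E.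
Proof. by move=> fi; rewrite /Rintegral fineK// integrable_fin_num. Qed.

Lemma integrable_scale c (f : T -> R) : mu.-integrable S (EFin \o f) ->
  mu.-integrable S (EFin \o (fun x => c * f x)).
Proof. exact: integrableZl. Qed.

Definition square_integrable (f : T -> R) :=
  measurable_fun S f /\ mu.-integrable S (fun x => (f x ^+ 2)%:E).

Definition rdot (f g : T -> R) : R := \int[mu]_(x in S) (f x * g x).

Lemma integrable_mul (f g : T -> R) : square_integrable f ->
  square_integrable g -> mu.-integrable S (EFin \o (fun x => f x * g x)).
Proof.
move=> [mf f2] [mg g2].
apply: (@le_integrable _ _ _ mu S mS _ (fun x => (f x ^+ 2)%:E + (g x ^+ 2)%:E)%E).
- by apply/measurable_EFinP; exact: measurable_funM.
- move=> x Sx /=; rewrite lee_fin [leRHS]ger0_norm ?addr_ge0 ?sqr_ge0//.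
  have := sqr_ge0 (f x - g x); have := sqr_ge0 (f x + g x).
  by rewrite ler_norml; nra.
- exact: integrableD.
Qed.

Lemma square_integrableP c (f g : T -> R) : square_integrable f ->
  square_integrable g -> square_integrable (fun x => c * f x + g x).
Proof.
move=> sf sg; have := integrable_mul sf sg; case: sf sg => [mf f2] [mg g2] fg.
split; first by apply: measurable_funD => //; exact: measurable_funM.
have -> : (fun x => ((c * f x + g x) ^+ 2)%:E) = (fun x =>
    ((c ^+ 2)%:E * (f x ^+ 2)%:E + ((2 * c)%:E * (f x * g x)%:E + (g x ^+ 2)%:E)))%E.
  by apply/funext => x; rewrite -!EFinM -!EFinD; congr EFin; ring.
by apply: integrableD => //; [|apply: integrableD => //]; exact: integrableZl.
Qed.

Lemma square_integrable0 : square_integrable (fun=> 0).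
Proof.
split; first exact: measurable_cst.
by rewrite expr2 mul0r; exact: integrable0.
Qed.

Lemma square_integrableB (f g : T -> R) : square_integrable f ->
  square_integrable g -> square_integrable (fun x => f x - g x).
Proof.
move=> sf sg; have := square_integrableP (-1) sg sf.
by under eq_fun do rewrite mulN1r addrC.
Qed.

Lemma rdotC (f g : T -> R) : rdot f g = rdot g f.
Proof. by apply: eq_Rintegral => x _; rewrite mulrC. Qed.

Lemma rdotP c (f g h : T -> R) : square_integrable f -> square_integrable g ->
  square_integrable h ->
  rdot (fun x => c * f x + g x) h = c * rdot f h + rdot g h.
Proof.
move=> sf sg sh; rewrite /rdot.
under eq_Rintegral do rewrite mulrDl -mulrA.
rewrite RintegralD//; [|apply: integrable_scale|]; try exact: integrable_mul.
by rewrite RintegralZl//; exact: integrable_mul.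
Qed.

Lemma rdot_ge0 (f : T -> R) : 0 <= rdot f f.
Proof. by apply: Rintegral_ge0 => x _; rewrite -expr2 sqr_ge0. Qed.

Let square_integrable_bound (f : T -> R) (B : R) : measurable_fun S f ->
  (\int[mu]_(x in S) (f x ^+ 2)%:E <= B%:E)%E ->
  square_integrable f /\ rdot f f <= B.
Proof.
move=> mf fB; have [] := @Rintegral_le_fin (fun x => f x ^+ 2) B.
- exact: measurable_funX.
- by move=> x; rewrite sqr_ge0.
- exact: fB.
- by [].
Qed.

(* The series G of the weighted squares 2^k |u_(k+1) - u_k|^2 has a finite integral,
   and by Cauchy-Schwarz (u_m - u_n)^2 <= 2 * 2^-n * G for n <= m: this gives both
   the pointwise limit where G is finite and the rate of convergence. *)
Lemma square_integrable_complete (u : nat -> T -> R) :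
  (forall n, square_integrable (u n)) ->
  (forall n, let D x := u n.+1 x - u n x in rdot D D <= 4^-1 ^+ n) ->
  exists2 v, square_integrable v & forall n,
    let D x := v x - u n x in rdot D D <= 4 * 2^-1 ^+ n.
Proof.
move=> su uS.
have mu_ n : measurable_fun S (u n).
  by have [] := su n.
pose g k x : R := 2 ^+ k * (u k.+1 x - u k x) ^+ 2.
have g0 k x : 0 <= g k x.
  apply: mulr_ge0; last exact: sqr_ge0.
  exact: exprn_ge0.
have mg k : measurable_fun S (g k).
  apply: measurable_funM; first exact: measurable_cst.
  by apply: measurable_funX; exact: measurable_funB.
pose G x : \bar R := (\sum_(k <oo) (g k x)%:E)%E.
have mG : measurable_fun S G.
  apply: ge0_emeasurable_sum => [k x _ _|k _]; first by rewrite lee_fin.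
  exact/measurable_EFinP.
have iG : (\int[mu]_(x in S) G x <= 2%:E)%E.
  have mg' k : measurable_fun S (fun x => (g k x)%:E) by exact/measurable_EFinP.
  rewrite integral_nneseries//; last by move=> k x _; rewrite lee_fin.
  apply: lime_le.
    by apply: is_cvg_nneseries => k _ _; apply: integral_ge0 => x _; rewrite lee_fin.
  apply: nearW => n.
  apply: (@le_trans _ _ (\sum_(0 <= k < n) (2^-1 ^+ k)%:E)%E).
    apply: lee_sum => k _; rewrite /g.
    have sD := square_integrableB (su k.+1) (su k).
    rewrite (eq_integral (fun x => ((2 ^+ k)%:E * ((u k.+1 x - u k x) ^+ 2)%:E)%E)); last by [].
    have mD : measurable_fun S (fun x => ((u k.+1 x - u k x) ^+ 2)%:E).
      by apply/measurable_EFinP; apply: measurable_funX; exact: measurable_funB.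
    rewrite ge0_integralZl ?lee_fin ?exprn_ge0//; last first.
      by move=> x _; rewrite lee_fin sqr_ge0.
    apply: le_trans (_ : (2 ^+ k)%:E * (4^-1 ^+ k)%:E <= _)%E.
      rewrite lee_wpmul2l ?lee_fin ?exprn_ge0//.
      by rewrite Rintegral_fin ?lee_fin; [exact: uS|case: sD].
    by rewrite -EFinM lee_fin -exprMn; have -> : 2 / 4 = 2^-1 :> R by field.
  rewrite sumEFin lee_fin.
  have -> : \sum_(0 <= k < n) (2^-1 : R) ^+ k = 2 - 2 * 2^-1 ^+ n.
    elim: n => [|n IH]; first by rewrite big_geq// expr0 mulr1 subrr.
    by rewrite big_nat_recr//= IH exprS; field.
  by rewrite lerBlDr lerDl mulr_ge0 ?exprn_ge0 ?invr_ge0.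
have uE m n x : (n <= m)%N -> u m x - u n x = \sum_(n <= k < m) (u k.+1 x - u k x).
  by move=> nm; rewrite telescope_sumr.
have geo m n : \sum_(n <= k < m) (2^-1 : R) ^+ k <= 2 * 2^-1 ^+ n.
  have [mn|nm] := leqP m n; first by rewrite big_geq// mulr_ge0// exprn_ge0 ?invr_ge0.
  have -> : \sum_(n <= k < m) (2^-1 : R) ^+ k = 2 * 2^-1 ^+ n - 2 * 2^-1 ^+ m.
    elim: m nm => // m IH; rewrite ltnS => nm; rewrite big_nat_recr//=.
    move: nm; rewrite leq_eqVlt => /predU1P[->|/IH ->].
      by rewrite big_geq// exprS; field.
    by rewrite exprS; field.
  by rewrite lerBlDr lerDl mulr_ge0 ?exprn_ge0 ?invr_ge0.
have tail m n x : (n <= m)%N ->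
    (((u m x - u n x) ^+ 2)%:E <= (2 * 2^-1 ^+ n)%:E * G x)%E.
  move=> nm; rewrite uE//.
  have -> : \sum_(n <= k < m) (u k.+1 x - u k x) =
     \sum_(n <= k < m) Num.sqrt (2^-1 ^+ k) * (Num.sqrt (2 ^+ k) * (u k.+1 x - u k x)).
    apply: eq_bigr => k _; rewrite mulrA -sqrtrM ?exprn_ge0 ?invr_ge0//.
    by rewrite -exprMn mulVf// expr1n sqrtr1 mul1r.
  apply: (@le_trans _ _ ((2 * 2^-1 ^+ n)%:E * (\sum_(n <= k < m) g k x)%:E)%E).
    rewrite -EFinM lee_fin; apply: le_trans (Cauchy_Schwarz_sum _ _ _) _.
    apply: ler_pM.
    - by apply: sumr_ge0 => i _; exact: sqr_ge0.
    - by apply: sumr_ge0 => i _; exact: sqr_ge0.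
    - apply: le_trans (geo m n); apply: ler_sum => k _.
      by rewrite sqr_sqrtr// exprn_ge0 ?invr_ge0.
    - apply: ler_sum => k _.
      by rewrite exprMn sqr_sqrtr// exprn_ge0.
  rewrite lee_wpmul2l ?lee_fin ?mulr_ge0 ?exprn_ge0 ?invr_ge0//.
  apply: le_trans (_ : (\sum_(0 <= k < m) g k x)%:E <= _)%E.
    rewrite lee_fin (@big_cat_nat _ _ _ n 0 m)//= lerDr sumr_ge0// => k _.
  by rewrite -sumEFin; apply: nneseries_lim_ge => k _ _; rewrite lee_fin.
(* Off [ok] the bound by [G] is vacuous, so the limit may be set to 0 there and every estimate holds
   pointwise, with no exceptional null set. *)
pose ok x := (G x < +oo)%E.
have G0 x : (0 <= G x)%E by apply: nneseries_ge0 => k _ _; rewrite lee_fin.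
have ucvg x : ok x -> cvgn (u ^~ x).
  move=> Gx; have Gf : G x \is a fin_num by rewrite ge0_fin_numE.
  have gc : cvgn (series (g ^~ x)).
    apply: nondecreasing_is_cvgn.
      by apply/nondecreasing_seqP => n; rewrite /series/= big_nat_recr//= lerDl.
    exists (fine (G x)) => _ [n _ <-]; rewrite -lee_fin fineK// /series/= -sumEFin.
    by apply: nneseries_lim_ge => k _ _; rewrite lee_fin.
  have Dc : cvgn (series (telescope (u ^~ x))).
    apply: normed_cvg.
    apply: (@series_le_cvg _ _ (geometric (1 : R) 2^-1 \+ g ^~ x)) => [n|n|n|].
    - by rewrite /=.
    - by rewrite /= addr_ge0// mul1r exprn_ge0 ?invr_ge0.
    - rewrite /geometric/= mul1r /telescope/= /g.
      set D := u n.+1 x - u n x.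
      have t0 : 0 < (2^-1 : R) ^+ n by rewrite exprn_gt0 ?invr_gt0.
      have -> : (2 : R) ^+ n = (2^-1 ^+ n)^-1 by rewrite exprVn invrK.
      move: t0; set t := _ ^+ n => t0.
      rewrite -(ler_pM2r t0) mulrDl mulrAC mulVf ?gt_eqF// mul1r.
      rewrite -[D ^+ 2]real_normK ?num_real//.
      by have := sqr_ge0 (t - `|D|); have := normr_ge0 D; nra.
    - rewrite seriesD; apply: is_cvgD => //.
      by apply: is_cvg_geometric_series; rewrite ger0_norm ?invr_ge0// invf_lt1 ?ltr1n.
  have -> : u ^~ x = (fun n => series (telescope (u ^~ x)) n + u 0%N x).
    by apply/funext => n; rewrite telescopeK/= subrK.
  by apply: is_cvgD => //; exact: is_cvg_cst.
pose w n x : R := if ok x then u n x else 0.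
pose v x : R := if ok x then lim (u ^~ x @ \oo) else 0.
have wv x : S x -> w ^~ x @ \oo --> v x.
  move=> Sx; rewrite /w /v; case: ifPn => [Gx|_]; last exact: cvg_cst.
  exact: ucvg.
have mv : measurable_fun S v.
  apply: (@measurable_fun_cvg _ _ _ S w) => // m.
  apply: measurable_fun_if => //.
  + apply: measurable_fun_lte; [exact: mG|].
    exact: measurable_cst.
  + by apply: measurable_funS (mu_ m) => //; exact: subIsetl.
have vu n x : (((v x - u n x) ^+ 2)%:E <= (2 * 2^-1 ^+ n)%:E * G x)%E.
  have [Gx|] := boolP (ok x); last first.
    rewrite -leNgt leye_eq => /eqP ->.
    by rewrite gt0_muley ?leey// lte_fin mulr_gt0 ?exprn_gt0 ?invr_gt0.
  have Gf : G x \is a fin_num by rewrite ge0_fin_numE.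
  rewrite -(fineK Gf) -EFinM lee_fin.
  apply: (@cvgn_le _ (fun m => (u m x - u n x) ^+ 2)).
    rewrite expr2; under eq_fun do rewrite expr2.
    have h : (fun m => u m x - u n x) @ \oo --> v x - u n x.
      by apply: cvgB; [rewrite /v Gx; exact: ucvg|exact: cvg_cst].
    exact: cvgM.
  near=> m; have nm : (n <= m)%N by near: m; exact: nbhs_infty_ge.
  by have := tail m n x nm; rewrite -[G x]fineK// -EFinM lee_fin.
have mvu n : measurable_fun S (fun x => v x - u n x) by exact: measurable_funB.
have vuB n : (\int[mu]_(x in S) ((v x - u n x) ^+ 2)%:E <= (4 * 2^-1 ^+ n)%:E)%E.
  apply: (@le_trans _ _ (\int[mu]_(x in S) ((2 * 2^-1 ^+ n)%:E * G x))%E).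
    apply: ge0_le_integral => //.
    - by move=> x _; rewrite lee_fin sqr_ge0.
    - by apply/measurable_EFinP; exact: measurable_funX.
    - exact: measurable_funeM.
  have c0 : 0 <= 2 * 2^-1 ^+ n :> R by rewrite mulr_ge0 ?exprn_ge0 ?invr_ge0.
  rewrite ge0_integralZl//.
  apply: le_trans (_ : (2 * 2^-1 ^+ n)%:E * 2%:E <= _)%E.
    by apply: lee_wpmul2l; [rewrite lee_fin|exact: iG].
  by rewrite -EFinM lee_fin; lra.
exists v => [|n]; last by case: (square_integrable_bound (mvu n) (vuB n)).
have [s0 _] := square_integrable_bound (mvu 0) (vuB 0).
have := square_integrableP 1 s0 (su 0).
by under eq_fun do rewrite mul1r subrK.
Unshelve. all: by end_near. Qed.

End SquareIntegrable.

(** * Complex exponentials on the real line *)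

Section ComplexIntegrals.
Variable R : realType.
Notation mu := (@lebesgue_measure R).
Notation Re := complex.Re.
Notation Im := complex.Im.
Notation normc := Normc.normc.
Implicit Types (z w : R[i]) (S : set R).

Lemma complex_eqP z w : Re z = Re w -> Im z = Im w -> z = w.
Proof. by case: z w => [a b] [c d] /= -> ->. Qed.

Lemma ReD z w : Re (z + w) = Re z + Re w. Proof. by case: z w => [? ?] []. Qed.
Lemma ImD z w : Im (z + w) = Im z + Im w. Proof. by case: z w => [? ?] []. Qed.
Lemma ReN z : Re (- z) = - Re z. Proof. by case: z. Qed.
Lemma ImN z : Im (- z) = - Im z. Proof. by case: z. Qed.
Lemma ReM z w : Re (z * w) = Re z * Re w - Im z * Im w.
Proof. by case: z w => [? ?] []. Qed.
Lemma ImM z w : Im (z * w) = Re z * Im w + Im z * Re w.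
Proof. by case: z w => [? ?] []. Qed.
Definition ReImE := (ReD, ImD, ReN, ImN, ReM, ImM).

Lemma sqr_normc z : normc z ^+ 2 = Re z ^+ 2 + Im z ^+ 2.
Proof. by case: z => a b; rewrite sqr_sqrtr// addr_ge0 ?sqr_ge0. Qed.

Lemma normc_ge0 z : 0 <= normc z.
Proof. by case: z => a b; rewrite sqrtr_ge0. Qed.

Lemma normc_le (x y : R) z : `|Re z| <= x -> `|Im z| <= y -> normc z <= x + y.
Proof.
move=> hx hy; have x0 := le_trans (normr_ge0 _) hx.
have y0 := le_trans (normr_ge0 _) hy.
rewrite -(ler_pXn2r (ltn0Sn 1)) ?nnegrE ?normc_ge0 ?addr_ge0// sqr_normc.
rewrite -[Re z ^+ 2]real_normK ?num_real// -[Im z ^+ 2]real_normK ?num_real//.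
have := normr_ge0 (Re z); have := normr_ge0 (Im z); nra.
Qed.

Lemma Re_le_normc z : `|Re z| <= normc z.
Proof.
rewrite -(ler_pXn2r (ltn0Sn 1)) ?nnegrE ?normc_ge0// sqr_normc.
by rewrite real_normK ?num_real// lerDl sqr_ge0.
Qed.

Lemma Im_le_normc z : `|Im z| <= normc z.
Proof.
rewrite -(ler_pXn2r (ltn0Sn 1)) ?nnegrE ?normc_ge0// sqr_normc.
by rewrite real_normK ?num_real// lerDr sqr_ge0.
Qed.

(** Spelled so as to be convertible with the exponentials in [PW] and [kappa]. *)
Definition expi z (t : R) : R[i] := cexp ((0 +i* 1) * z * t%:C).

Lemma Re_expi z t : Re (expi z t) = expR (- Im z * t) * cos (Re z * t).
Proof. by case: z => x y; rewrite /expi/=; congr (expR _ * cos _); ring. Qed.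

Lemma Im_expi z t : Im (expi z t) = expR (- Im z * t) * sin (Re z * t).
Proof. by case: z => x y; rewrite /expi/=; congr (expR _ * sin _); ring. Qed.

Lemma expiD z w t : expi (z + w) t = expi z t * expi w t.
Proof.
apply: complex_eqP; rewrite !ReImE !Re_expi !Im_expi !ReImE opprD !mulrDl expRD.
  by rewrite cosD; ring.
by rewrite sinD; ring.
Qed.

Lemma expi0 z : expi z 0 = 1.
Proof.
by apply: complex_eqP; rewrite ?Re_expi ?Im_expi !mulr0 expR0 ?cos0 ?sin0 mul1r.
Qed.

Lemma expi0z t : expi 0 t = 1.
Proof.
apply: complex_eqP; rewrite ?Re_expi ?Im_expi oppr0 !mul0r expR0 ?cos0 ?sin0 mul1r//.
Qed.

Lemma sqr_normc_expi z t : normc (expi z t) ^+ 2 = expR (- 2 * Im z * t).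
Proof.
rewrite sqr_normc Re_expi Im_expi !exprMn -mulrDr cos2Dsin2 mulr1.
by rewrite -expRM_natl; congr expR; ring.
Qed.

Lemma normc_expi z t : normc (expi z t) = expR (- Im z * t).
Proof.
apply/eqP; rewrite -(eqrXn2 (ltn0Sn 1)) ?normc_ge0 ?expR_ge0//.
by rewrite sqr_normc_expi -expRM_natl; apply/eqP; congr expR; ring.
Qed.

Lemma continuous_Re_expi z : continuous (fun t => Re (expi z t)).
Proof.
move=> t; under eq_fun do rewrite Re_expi.
apply: cvgM.
  apply: (@continuous_comp _ _ _ (fun t => - Im z * t) expR).
    by apply: cvgM; [exact: cvg_cst|exact: cvg_id].
  exact: continuous_expR.
apply: (@continuous_comp _ _ _ (fun t => Re z * t) cos).
  by apply: cvgM; [exact: cvg_cst|exact: cvg_id].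
exact: continuous_cos.
Qed.

Lemma continuous_Im_expi z : continuous (fun t => Im (expi z t)).
Proof.
move=> t; under eq_fun do rewrite Im_expi.
apply: cvgM.
  apply: (@continuous_comp _ _ _ (fun t => - Im z * t) expR).
    by apply: cvgM; [exact: cvg_cst|exact: cvg_id].
  exact: continuous_expR.
apply: (@continuous_comp _ _ _ (fun t => Re z * t) sin).
  by apply: cvgM; [exact: cvg_cst|exact: cvg_id].
exact: continuous_sin.
Qed.

Lemma is_derive_lincomb (a b s df dg : R) (f g : R -> R) :
  is_derive s (1 : R) f df -> is_derive s (1 : R) g dg ->
  is_derive s (1 : R) (fun t => a * f t + b * g t) (a * df + b * dg).
Proof. by move=> hf hg; exact: (is_deriveD (is_deriveZ a hf) (is_deriveZ b hg)). Qed.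

(** The antiderivative e^(izt) / (iz), split into two real functions because the fundamental theorem
    of calculus is applied to real integrands. *)
Lemma expi_derive z s : z != 0 ->
  is_derive s (1 : R) (fun t => Re (expi z t / ((0 +i* 1) * z))) (Re (expi z s)) /\
  is_derive s (1 : R) (fun t => Im (expi z t / ((0 +i* 1) * z))) (Im (expi z s)).
Proof.
move=> z0; pose w := ((0 +i* 1) * z)^-1.
have dR : is_derive s (1 : R) (fun t => Re (expi z t))
    (- Im z * Re (expi z s) - Re z * Im (expi z s)).
  rewrite (_ : (fun t => _) = (expR \o (fun t => - Im z * t)) * (cos \o (fun t => Re z * t))); last first.
    by apply/funext => t; rewrite Re_expi.
  apply: is_derive_eq; rewrite Re_expi Im_expi/= /GRing.scale/=; ring.
have dI : is_derive s (1 : R) (fun t => Im (expi z t))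
    (- Im z * Im (expi z s) + Re z * Re (expi z s)).
  rewrite (_ : (fun t => _) = (expR \o (fun t => - Im z * t)) * (sin \o (fun t => Re z * t))); last first.
    by apply/funext => t; rewrite Im_expi.
  apply: is_derive_eq; rewrite Re_expi Im_expi/= /GRing.scale/=; ring.
have iz : (0 +i* 1) * z * w = 1.
  rewrite /w divff// mulf_eq0 negb_or z0 andbT.
  by apply/eqP => -[/eqP]; rewrite oner_eq0.
have hR : - Im z * Re w - Re z * Im w = 1.
  by rewrite -[RHS](congr1 (@complex.Re R) iz) !ReImE/=; ring.
have hI : - Im z * Im w + Re z * Re w = 0.
  by rewrite -[RHS](congr1 (@complex.Im R) iz) !ReImE/=; ring.
split.
  rewrite (_ : (fun t => _) = (fun t => Re w * Re (expi z t) + - Im w * Im (expi z t))).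
    have := is_derive_lincomb (Re w) (- Im w) dR dI; congr is_derive.
    transitivity ((- Im z * Re w - Re z * Im w) * Re (expi z s)
      - (- Im z * Im w + Re z * Re w) * Im (expi z s)); first by ring.
    by rewrite hR hI mul0r subr0 mul1r.
  by apply/funext => t; rewrite ReM; ring.
rewrite (_ : (fun t => _) = (fun t => Im w * Re (expi z t) + Re w * Im (expi z t))).
  have := is_derive_lincomb (Im w) (Re w) dR dI; congr is_derive.
  transitivity ((- Im z * Im w + Re z * Re w) * Re (expi z s)
    + (- Im z * Re w - Re z * Im w) * Im (expi z s)); first by ring.
  by rewrite hR hI mul0r add0r mul1r.
by apply/funext => t; rewrite ImM; ring.
Qed.

End ComplexIntegrals.

(** * Complex integrals and Paley-Wiener spaces *)

Section PaleyWiener.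
Variable R : realType.
Notation mu := (@lebesgue_measure R).
Notation Re := complex.Re.
Notation Im := complex.Im.
Notation normc := Normc.normc.
Implicit Types (z w : R[i]) (S : set R) (g h phi : R -> R[i]).

Definition cintegrable S g :=
  mu.-integrable S (EFin \o (fun t => Re (g t))) /\
  mu.-integrable S (EFin \o (fun t => Im (g t))).

Lemma eq_Cintegral S g h : (forall t, S t -> g t = h t) ->
  Cintegral S g = Cintegral S h.
Proof.
move=> gh; congr (_ +i* _); apply: eq_Rintegral => t /set_mem St; by rewrite gh.
Qed.

Lemma integrable_add S (f g : R -> R) : measurable S -> mu.-integrable S (EFin \o f) ->
  mu.-integrable S (EFin \o g) -> mu.-integrable S (EFin \o (fun t => f t + g t)).
Proof. by move=> mS; exact: integrableD. Qed.

Lemma CintegralD S g h : measurable S -> cintegrable S g -> cintegrable S h ->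
  Cintegral S (fun t => g t + h t) = Cintegral S g + Cintegral S h.
Proof.
move=> mS [g1 g2] [h1 h2]; apply: complex_eqP; rewrite !ReImE/=.
  by under eq_Rintegral do rewrite ReImE; rewrite RintegralD.
by under eq_Rintegral do rewrite ReImE; rewrite RintegralD.
Qed.

Lemma cintegrableZ S (c : R[i]) g : measurable S -> cintegrable S g ->
  cintegrable S (fun t => c * g t).
Proof.
move=> mS [g1 g2]; split; under [X in _ \o X]eq_fun do rewrite ReImE.
  under [X in _ \o X]eq_fun do rewrite -mulNr.
  by apply: integrable_add => //; exact: integrable_scale.
by apply: integrable_add => //; exact: integrable_scale.
Qed.

Lemma CintegralZ S (c : R[i]) g : measurable S -> cintegrable S g ->
  Cintegral S (fun t => c * g t) = c * Cintegral S g.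
Proof.
move=> mS [g1 g2]; apply: complex_eqP; rewrite !ReImE/=.
  under eq_Rintegral do rewrite ReImE -mulNr.
  rewrite RintegralD//; [|exact: integrable_scale..].
  by rewrite !RintegralZl// mulNr.
under eq_Rintegral do rewrite ReImE.
rewrite RintegralD//; [|exact: integrable_scale..].
by rewrite !RintegralZl.
Qed.

Lemma Cintegral_setU S S' g : measurable S -> measurable S' ->
  [disjoint S & S'] -> cintegrable (S `|` S') g ->
  Cintegral (S `|` S') g = Cintegral S g + Cintegral S' g.
Proof.
move=> mS mS' SS' [g1 g2]; apply: complex_eqP; rewrite !ReImE/=.
  by rewrite Rintegral_setU.
by rewrite Rintegral_setU.
Qed.

Lemma Cintegral_extend S E g : S `<=` E ->
  Cintegral E (fun t => if t \in S then g t else 0) = Cintegral S g.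
Proof.
move=> SE; have -> : S = E `&` S by rewrite setIC; apply/esym/setIidl.
congr (_ +i* _); rewrite Rintegral_mkcondr; apply: eq_Rintegral => t tE.
  by rewrite patchE in_setI tE/=; case: ifP.
by rewrite patchE in_setI tE/=; case: ifP.
Qed.

(** Kept in multiplied form so that z = 0 is included. The decay and growth estimates of the kernels
    and the division by z - t all rest on this formula. *)
Lemma Cintegral_expi z (p q : R) : p <= q ->
  (0 +i* 1) * z * Cintegral `[p, q] (expi z) = expi z q - expi z p.
Proof.
rewrite le_eqVlt => /predU1P[->|pq].
  by rewrite /Cintegral set_itv1 !Rintegral_set1 subrr mulr0.
have [->|z0] := eqVneq z 0; first by rewrite !expi0z mulr0 mul0r subrr.
have iz0 : (0 +i* 1) * z != 0.
  rewrite mulf_eq0 negb_or z0 andbT.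
  by apply/eqP => -[/eqP]; rewrite oner_eq0.
have dF := fun s => expi_derive s z0.
have FTC (f F : R -> R) : continuous f -> (forall s, is_derive s (1 : R) F (f s)) ->
    \int[mu]_(t in `[p, q]) f t = F q - F p.
  move=> cf dFf; rewrite /Rintegral (@continuous_FTC2 _ f F)//.
  - exact: continuous_subspaceT.
  - have cF : continuous F.
      by move=> s; apply/differentiable_continuous/derivable1_diffP; exact: ex_derive.
    split.
    + by move=> s _; exact: ex_derive.
    + by apply: cvg_at_right_filter; exact: cF.
    + by apply: cvg_at_left_filter; exact: cF.
  - by move=> s _; rewrite derive1E derive_val.
rewrite (_ : Cintegral _ _ = (expi z q - expi z p) / ((0 +i* 1) * z)); last first.
  rewrite mulrBl; apply: complex_eqP; rewrite ReD ReN || rewrite ImD ImN.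
  + exact: FTC (@continuous_Re_expi _ z) (fun s => (dF s).1).
  + exact: FTC (@continuous_Im_expi _ z) (fun s => (dF s).2).
by rewrite mulrC divfK.
Qed.

Lemma L2P S phi : measurable S -> L2 S phi <->
  square_integrable mu S (fun t => Re (phi t)) /\
  square_integrable mu S (fun t => Im (phi t)).
Proof.
move=> mS; split.
  move=> [m1 m2 fin].
  have mN : measurable_fun S (fun t => ((normc (phi t) ^+ 2)%R)%:E).
    apply/measurable_EFinP; under eq_fun do rewrite sqr_normc.
    by apply: measurable_funD; exact: measurable_funX.
  have iN : mu.-integrable S (fun t => ((normc (phi t) ^+ 2)%R)%:E).
    apply/integrableP; split=> //.
    by under eq_integral do rewrite gee0_abs ?lee_fin ?sqr_ge0//.
  split; split=> //.
    apply: le_integrable iN => //.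
      by apply/measurable_EFinP; exact: measurable_funX.
    move=> t _ /=; rewrite lee_fin !ger0_norm ?sqr_ge0// sqr_normc lerDl.
    exact: sqr_ge0.
  apply: le_integrable iN => //.
    by apply/measurable_EFinP; exact: measurable_funX.
  move=> t _ /=; rewrite lee_fin !ger0_norm ?sqr_ge0// sqr_normc lerDr.
  exact: sqr_ge0.
move=> [[m1 i1] [m2 i2]]; split=> //.
have : mu.-integrable S
    (fun t => (Re (phi t) ^+ 2)%:E + (Im (phi t) ^+ 2)%:E)%E.
  exact: integrableD.
move=> /integrableP[_].
apply: le_lt_trans; rewrite le_eqVlt; apply/orP; left; apply/eqP.
apply: eq_integral => t _ /=.
by rewrite sqr_normc ger0_norm// addr_ge0 ?sqr_ge0.
Qed.

Lemma L2D S c phi psi : measurable S -> L2 S phi -> L2 S psi ->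
  L2 S (fun t => c * phi t + psi t).
Proof.
move=> mS /(L2P _ mS)[p1 p2] /(L2P _ mS)[q1 q2]; apply/(L2P _ mS).
have s0 : square_integrable mu S (fun=> 0 : R) by exact: square_integrable0.
split; under eq_fun do rewrite !ReImE.
  under eq_fun do rewrite -addrA -mulNr.
  by apply: square_integrableP => //; apply: square_integrableP.
under eq_fun do rewrite -addrA.
by apply: square_integrableP => //; apply: square_integrableP.
Qed.

Lemma cintegrableM S phi psi : measurable S -> L2 S phi -> L2 S psi ->
  cintegrable S (fun t => phi t * psi t).
Proof.
move=> mS /(L2P _ mS)[p1 p2] /(L2P _ mS)[q1 q2].
split; under [X in _ \o X]eq_fun do rewrite !ReImE.
  under [X in _ \o X]eq_fun do rewrite -mulN1r.
  apply: integrable_add => //; last apply: integrable_scale => //;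
  exact: integrable_mul.
apply: integrable_add => //; exact: integrable_mul.
Qed.

Definition bounded_measurable S := measurable S /\ exists M : R, S `<=` `[- M, M].

Lemma continuous_square_integrable S (f : R -> R) : bounded_measurable S ->
  continuous f -> square_integrable mu S f.
Proof.
move=> [mS [M SM]] cf; split.
  by apply: measurable_funTS; exact: continuous_measurable_fun.
apply: (@integrableS _ _ _ mu `[- M, M]) => //.
apply: continuous_compact_integrable; first exact: segment_compact.
by apply: continuous_subspaceT => t; exact: (cvgM (cf t) (cf t)).
Qed.

Lemma L2_expi S z : bounded_measurable S -> L2 S (expi z).
Proof.
move=> bS; apply/L2P; first by case: bS.
by split; apply: continuous_square_integrable => //;
  [exact: continuous_Re_expi|exact: continuous_Im_expi].
Qed.

Lemma PW_lin S c (f g : R[i] -> R[i]) : bounded_measurable S -> PW S f -> PW S g ->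
  PW S (fun z => c * f z + g z).
Proof.
move=> bS; have [mS _] := bS => -[phi p fE] [psi q gE].
exists (fun t => c * phi t + psi t); first exact: L2D.
move=> z; rewrite fE gE -/(expi z).
rewrite -CintegralZ//; last by apply: cintegrableM => //; exact: L2_expi.
rewrite -CintegralD//.
- by apply: eq_Cintegral => t _; rewrite mulrDl mulrA.
- by apply: cintegrableZ => //; apply: cintegrableM => //; exact: L2_expi.
- by apply: cintegrableM => //; exact: L2_expi.
Qed.

Lemma PW_sub S E (f : R[i] -> R[i]) : measurable S -> measurable E ->
  S `<=` E -> PW S f -> PW E f.
Proof.
move=> mS mE SE [phi p fE]; exists (fun t => if t \in S then phi t else 0).
  have /(L2P _ mS)[[m1 i1] [m2 i2]] := p; apply/(L2P _ mE).
  have ES : E `&` S = S by rewrite setIC; apply/setIidl.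
  split; split.
  - rewrite (_ : (fun t => _) = (fun t => Re (phi t)) \_ S); last first.
      by apply/funext => t; rewrite patchE; case: ifP.
    by apply/measurable_restrict => //; rewrite ES.
  - rewrite (_ : (fun t => _) = (fun t => ((Re (phi t)) ^+ 2)%:E) \_ S); last first.
      by apply/funext => t; rewrite patchE; case: ifP => //= _; rewrite expr0n.
    by apply/integrable_restrict => //; rewrite ES.
  - rewrite (_ : (fun t => _) = (fun t => Im (phi t)) \_ S); last first.
      by apply/funext => t; rewrite patchE; case: ifP.
    by apply/measurable_restrict => //; rewrite ES.
  - rewrite (_ : (fun t => _) = (fun t => ((Im (phi t)) ^+ 2)%:E) \_ S); last first.
      by apply/funext => t; rewrite patchE; case: ifP => //= _; rewrite expr0n.
    by apply/integrable_restrict => //; rewrite ES.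
move=> z; rewrite fE -(Cintegral_extend _ SE); apply: eq_Cintegral => t _.
by case: ifP => // _; rewrite mul0r.
Qed.

End PaleyWiener.

(** * Consequences of complete interpolation, for abstract positive weights [N] *)

Section Interpolation.
Variables (R : realType) (S : set R) (L : set R[i]) (N : R[i] -> R).
Notation mu := (@lebesgue_measure R).
Notation Re := complex.Re.
Notation Im := complex.Im.
Notation normc := Normc.normc.
Implicit Types (z : R[i]).
Hypothesis bS : bounded_measurable S.
Hypothesis N_gt0 : forall l, L l -> 0 < N l.
Hypothesis CI : forall a : R[i] -> R[i],
  (\esum_(l in L) (normc (a l) ^+ 2)%R%:E < +oo)%E ->
  exists! f : R[i] -> R[i], PW S f /\ forall l, L l -> f l / (N l)%:C = a l.

Let mS : measurable S := bS.1.

Lemma esum_lt_pinfty (b : R[i] -> R) (B : R) : (forall l, 0 <= b l) ->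
  (forall s, uniq s -> (forall l, l \in s -> L l) -> \sum_(l <- s) b l <= B) ->
  (\esum_(l in L) (b l)%:E < +oo)%E.
Proof.
move=> b0 hB; apply: le_lt_trans (ltry B).
apply: ge_ereal_sup => _ [A [fA AL] <-].
rewrite fsbig_finite//= sumEFin lee_fin; apply: hB; first exact: finmap.fset_uniq.
by move=> l; rewrite in_fset_set// inE => /AL.
Qed.

(** The squared norm of evaluation at [z] as a functional of the density. Plancherel would identify
    it with the squared [PWnorm] of the kernel at [z]; here the two are only compared by
    estimates. *)
Definition energy z : R := \int[mu]_(t in S) (normc (expi z t) ^+ 2).

(* A density is the pair of its real and imaginary parts, and each point l of L
   carries two real functionals on densities: the real part (index (l, false)) and
   the imaginary part (index (l, true)) of f(l) / N l. *)
Let V : lmodType R := ((R -> R^o) * (R -> R^o))%type.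
Let D (p : V) := square_integrable mu S (p.1 : R -> R) /\
                 square_integrable mu S (p.2 : R -> R).
Let ip (p q : V) : R := rdot mu S (p.1 : R -> R) (q.1 : R -> R)
                      + rdot mu S (p.2 : R -> R) (q.2 : R -> R).
(** Representers of the real part ([false]) and the imaginary part ([true]) of evaluation at [z];
    see [ip_re] and [ip_im]. *)
Let kp (z : R[i]) (b : bool) : V :=
  if b then (fun t => Im (expi z t), fun t => Re (expi z t))
  else (fun t => Re (expi z t), fun t => - Im (expi z t)).
Let val (p : V) z := Cintegral S (fun t => (p.1 t +i* p.2 t) * expi z t).

Let sRe z : square_integrable mu S (fun t => Re (expi z t)).
Proof. by apply: continuous_square_integrable => //; exact: continuous_Re_expi. Qed.

Let sIm z : square_integrable mu S (fun t => Im (expi z t)).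
Proof. by apply: continuous_square_integrable => //; exact: continuous_Im_expi. Qed.

Let s0 : square_integrable mu S (fun=> 0 : R).
Proof. exact: square_integrable0. Qed.

Let D0 : D 0. Proof. by split; exact: s0. Qed.

Let DP c u v : D u -> D v -> D (c *: u + v).
Proof.
move=> [u1 u2] [v1 v2]; split.
  exact: (@square_integrableP _ _ R mu S mS c _ _ u1 v1).
exact: (@square_integrableP _ _ R mu S mS c _ _ u2 v2).
Qed.

Let Dkp z b : D (kp z b).
Proof.
rewrite /kp; case: b; split; [exact: sIm|exact: sRe|exact: sRe|].
have := @square_integrableB _ _ R mu S mS _ _ s0 (sIm z).
by under eq_fun do rewrite sub0r.
Qed.

Let ipC u v : ip u v = ip v u.
Proof. by rewrite /ip rdotC [X in _ + X]rdotC. Qed.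

Let ipP c u v w : D u -> D v -> D w -> ip (c *: u + v) w = c * ip u w + ip v w.
Proof.
move=> [u1 u2] [v1 v2] [w1 w2]; rewrite /ip.
apply: etrans (congr2 +%R (@rdotP _ _ R mu S mS c _ _ _ u1 v1 w1)
  (@rdotP _ _ R mu S mS c _ _ _ u2 v2 w2)) _.
by ring.
Qed.

Let ip_ge0 u : 0 <= ip u u.
Proof. by rewrite /ip addr_ge0 ?rdot_ge0. Qed.

Let complete (u : nat -> V) : (forall n, D (u n)) ->
  (forall n, ip (u n.+1 - u n) (u n.+1 - u n) <= 4^-1 ^+ n) ->
  exists2 v, D v & forall n, ip (v - u n) (v - u n) <= 8 * 2^-1 ^+ n.
Proof.
move=> Du uS.
have [||v1 sv1 hv1] := @square_integrable_complete _ _ R mu S mS (fun n => (u n).1).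
- by move=> n; case: (Du n).
- move=> n /=; apply: le_trans (uS n); rewrite /ip lerDl; exact: rdot_ge0.
have [||v2 sv2 hv2] := @square_integrable_complete _ _ R mu S mS (fun n => (u n).2).
- by move=> n; case: (Du n).
- move=> n /=; apply: le_trans (uS n); rewrite /ip lerDr; exact: rdot_ge0.
exists (v1, v2) => [//|n]; have := hv1 n; have := hv2 n => /= h2 h1.
have -> : 8 * 2^-1 ^+ n = 4 * 2^-1 ^+ n + 4 * 2^-1 ^+ n :> R by ring.
exact: lerD h1 h2.
Qed.

Let ip_re p z : D p -> ip p (kp z false) = Re (val p z).
Proof.
move=> [p1 p2]; rewrite /ip /val /rdot/=.
rewrite -RintegralD//; last 2 first.
- by apply: integrable_mul => //; exact: (Dkp z false).1.
- by apply: integrable_mul => //; exact: (Dkp z false).2.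
by apply: eq_Rintegral => t _; rewrite ReM/=; ring.
Qed.

Let ip_im p z : D p -> ip p (kp z true) = Im (val p z).
Proof.
move=> [p1 p2]; rewrite /ip /val /rdot/=.
rewrite -RintegralD//.
- by apply: integrable_mul => //; exact: (Dkp z true).1.
- by apply: integrable_mul => //; exact: (Dkp z true).2.
Qed.

Let ip_kp z b : ip (kp z b) (kp z b) = energy z.
Proof.
rewrite /ip /energy /rdot -RintegralD//; last 2 first.
- by apply: integrable_mul => //; exact: (Dkp z b).1.
- by apply: integrable_mul => //; exact: (Dkp z b).2.
by apply: eq_Rintegral => t _; rewrite sqr_normc /kp; case: b => /=; ring.
Qed.

Let I : eqType := (L * bool)%type.
Let k (i : I) : V := (N (\val i.1))^-1 *: kp (\val i.1) i.2.

Let NL (l : L) : 0 < N (\val l). Proof. exact/N_gt0/set_valP. Qed.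

Let Dk i : D (k i).
Proof. by rewrite -[k i]addr0; apply: DP => //; exact: Dkp. Qed.

Let ipk p i : D p -> ip p (k i) = ip p (kp (\val i.1) i.2) / N (\val i.1).
Proof.
move=> Dp; rewrite ipC -[k i]addr0 ipP; [|exact: Dkp|exact: D0|exact: Dp].
have -> : ip 0 p = 0.
  have r0 (f : R -> R) : rdot mu S (fun=> 0) f = 0.
    rewrite /rdot; under eq_Rintegral do rewrite mul0r.
    by rewrite Rintegral_cst ?mul0r.
  by apply: etrans (congr2 +%R (r0 p.1) (r0 p.2)) _; rewrite addr0.
by rewrite addr0 mulrC ipC.
Qed.

Let interp (a : I -> R) :
  (exists B, forall s, uniq s -> \sum_(i <- s) a i ^+ 2 <= B) ->
  exists2 phi, D phi & forall i, ip phi (k i) = a i.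
Proof.
move=> [B aB].
pose b z : R[i] := if insub z is Some l then a (l, false) +i* a (l, true) else 0.
have bE (l : L) : b (\val l) = a (l, false) +i* a (l, true) by rewrite /b valK.
have [|f [[[phi Lphi fE] fb] _]] := @CI b.
  apply: (@esum_lt_pinfty _ B) => [l|s us sL]; first exact: sqr_ge0.
  pose t : seq L := pmap insub s.
  have tE : [seq \val l | l <- t] = s.
    rewrite (pmap_filter (insubK _)); apply/all_filterP/allP => l ls.
    by rewrite isSome_insub; apply/mem_set/sL.
  have ut : uniq t by rewrite -(map_inj_uniq val_inj) tE.
  rewrite -tE big_map.
  apply: le_trans (aB [seq (l, c) | l <- t, c <- [:: false; true]] _).
    rewrite big_allpairs_dep /=; apply: ler_sum => l _.
    by rewrite bE sqr_normc/= !big_cons big_nil addr0.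
  by apply: allpairs_uniq => // -[x1 x2] [y1 y2] _ _ /= [-> ->].
have /(L2P _ mS)[q1 q2] := Lphi.
pose p : V := (fun t => Re (phi t), fun t => Im (phi t)).
have Dp : D p by split.
have pf z : val p z = f z.
  by rewrite fE; apply: eq_Cintegral => t _; rewrite /=; case: (phi t).
exists p => // -[l c]; rewrite ipk//=.
have := fb _ (set_valP l); rewrite bE => /(congr1 (fun x => x * (N (\val l))%:C)).
have Nl0 : N (\val l) != 0 by rewrite gt_eqF// NL.
rewrite divfK; last by apply/eqP => -[] /eqP; rewrite (negbTE Nl0).
move=> h; case: c.
  by rewrite ip_im// pf h ImM/= mulr0 add0r mulfK.
by rewrite ip_re// pf h ReM/= mulr0 subr0 mulfK.
Qed.

(** The Riesz lower bound for two real-part functionals, with coefficients [N l] and [- N l'] that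
    undo their normalisation: the combination is then the difference of two exponentials. *)
Lemma interpolation_separated : exists2 C : R, 0 < C & forall l l', L l -> L l' ->
  l != l' -> N l ^+ 2 <=
    C * \int[mu]_(t in S) (normc (expi l t - expi l' t) ^+ 2).
Proof.
have [C C0 CP] := riesz_fischer D0 DP ipC ipP ip_ge0 Dk interp.
exists C => // l l' Ll Ll' ll'.
pose m : L := exist _ l (mem_set Ll); pose m' : L := exist _ l' (mem_set Ll').
have mm' : m != m' by [].
have kE z c (Lz : L z) : N z *: k (exist _ z (mem_set Lz), c) = kp z c.
  by rewrite /k scalerA divff ?scale1r// gt_eqF// N_gt0.
have := CP [:: (m, false); (m', false)]
  (fun i => if i.1 == m then N l else - N l').
set rhs := C * \int[mu]_(t in S) _.
rewrite !big_cons !big_nil !addr0 /= eqxx eq_sym (negbTE mm') sqrrN.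
rewrite inE xpair_eqE (negbTE mm')/= => /(_ isT).
rewrite scaleNr (kE l false Ll) (kE l' false Ll') /rhs => {rhs}.
move=> h; apply: le_trans (_ : N l ^+ 2 + N l' ^+ 2 <= _).
  by rewrite lerDl sqr_ge0.
apply: le_trans h _; rewrite ler_pM2l//.
rewrite le_eqVlt; apply/orP; left; apply/eqP.
have [d1 d2] : D (kp l false - kp l' false).
  rewrite addrC -scaleN1r; exact: DP.
rewrite /ip /rdot -RintegralD; [|exact: mS|exact: integrable_mul..].
apply: eq_Rintegral => t _; rewrite sqr_normc !ReImE.
rewrite (_ : (_ - _).1 t = Re (expi l t) - Re (expi l' t))//.
rewrite (_ : (_ - _).2 t = - Im (expi l t) - - Im (expi l' t))//.
ring.
Qed.

(** A density of controlled norm has the same values as f on [L]; uniqueness of interpolation makes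
    its transform equal to f, and Cauchy-Schwarz bounds evaluation at z. The factor 2 adds the real
    and imaginary parts. *)
Lemma interpolation_bounded : exists2 C : R, 0 < C & forall (f : R[i] -> R[i]) A,
  PW S f ->
  (forall s, uniq s -> (forall l, l \in s -> L l) ->
    \sum_(l <- s) (normc (f l) / N l) ^+ 2 <= A) ->
  forall z, normc (f z) ^+ 2 <= C * A * energy z.
Proof.
have [C C0 CP] := bounded_solution D0 DP ipC ipP ip_ge0 Dk interp complete.
exists (2 * C); first by rewrite mulr_gt0.
move=> f A [phi Lphi fE] fA z.
have /(L2P _ mS)[q1 q2] := Lphi.
pose p : V := (fun t => Re (phi t), fun t => Im (phi t)).
have Dp : D p by split.
have pf w : val p w = f w.
  by rewrite fE; apply: eq_Cintegral => t _; rewrite /=; case: (phi t).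
have [s us|psi Dpsi [psik psiA]] := CP p A Dp.
  pose t := undup [seq i.1 | i <- s].
  apply: le_trans (_ : \sum_(i <- [seq (l, c) | l <- t, c <- [:: false; true]])
      ip p (k i) ^+ 2 <= _).
    set s' := [seq _ | _ <- _, _ <- _].
    have us' : uniq s'.
      apply: allpairs_uniq => //; first exact: undup_uniq.
      by move=> -[x1 x2] [y1 y2] _ _ /= [-> ->].
    have ss' : {subset s <= s'}.
      move=> [l c] ls; apply/allpairsP; exists (l, c) => /=; split=> //.
        by rewrite mem_undup; apply/mapP; exists (l, c).
      by case: c {ls}.
    by apply: ler_sum_subset => // i; exact: sqr_ge0.
  rewrite big_allpairs_dep/=.
  apply: le_trans (fA [seq \val l | l <- t] _ _); last 2 first.
  - by rewrite map_inj_uniq ?undup_uniq//; exact: val_inj.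
  - by move=> _ /mapP[l _ ->]; exact: set_valP.
  rewrite big_map; apply: ler_sum => l _.
  rewrite !big_cons big_nil addr0 !ipk//= ip_im// ip_re// pf.
  by rewrite !exprMn sqr_normc mulrDl.
pose g w := val psi w.
have gPW : PW S g.
  exists (fun t => psi.1 t +i* psi.2 t) => [|//].
  by apply/(L2P _ mS); case: Dpsi.
have gf l : L l -> g l = f l.
  move=> Ll; pose m : L := exist _ l (mem_set Ll).
  have h c := psik (m, c).
  have nz : N l != 0 by rewrite gt_eqF// N_gt0.
  apply: complex_eqP.
    have := h false; rewrite !ipk//= !ip_re// pf.
    by move=> /(congr1 (fun x => x * N l)); rewrite !divfK.
  have := h true; rewrite !ipk//= !ip_im// pf.
  by move=> /(congr1 (fun x => x * N l)); rewrite !divfK.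
have fPW : PW S f by exists phi.
(* Only uniqueness is used here: f and g both solve this problem. *)
have [|h [_ hu]] := @CI (fun l => f l / (N l)%:C).
  apply: (@esum_lt_pinfty _ A) => [l|s us sL]; first exact: sqr_ge0.
  apply: le_trans (fA s us sL); rewrite big_seq [leRHS]big_seq.
  apply: ler_sum => l ls; rewrite Normc.normcM Normc.normcV /=.
  by rewrite expr0n/= addr0 sqrtr_sqr gtr0_norm// N_gt0//; exact: sL.
have fg : f = g.
  rewrite -(hu f) //; apply: hu; split=> // l Ll; by rewrite gf.
rewrite fg /g sqr_normc -ip_re// -ip_im//.
have h0 : 0 <= energy z by rewrite -(ip_kp z false); exact: ip_ge0.
have h1 c : ip psi (kp z c) ^+ 2 <= C * A * energy z.
  have cs : ip psi (kp z c) ^+ 2 <= ip psi psi * ip (kp z c) (kp z c).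
    exact: (ip_Cauchy_Schwarz DP ipC ipP ip_ge0 Dpsi (Dkp z c)).
  apply: le_trans cs _.
  by rewrite ip_kp; apply: ler_wpM2r.
have := h1 true; have := h1 false; lra.
Qed.

End Interpolation.

(** * Elementary estimates for exponential integrals and norms on the line *)

Section KernelBounds.
Variable R : realType.
Notation mu := (@lebesgue_measure R).
Notation Re := complex.Re.
Notation Im := complex.Im.
Notation normc := Normc.normc.
Implicit Types (z w : R[i]) (S : set R) (g : R -> R[i]).

Lemma cintegrable_expi S z : bounded_measurable S -> cintegrable S (expi z).
Proof.
move=> bS; have [mS _] := bS.
have one : L2 S (fun=> 1 : R[i]).
  have e : (fun=> 1 : R[i]) = @expi R 0 by apply/funext => t; rewrite expi0z.
  by rewrite e; exact: L2_expi.
have := cintegrableM mS one (L2_expi z bS).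
by under eq_fun do rewrite mul1r.
Qed.

Lemma bounded_measurable_itv (p q : R) : bounded_measurable `[p, q].
Proof.
split=> //; exists (`|p| + `|q|) => t /=; rewrite !in_itv/= => /andP[pt tq].
have := ler_norm q; have := ler_norm (- p); rewrite normrN.
have := normr_ge0 p; have := normr_ge0 q => h1 h2 h3 h4.
by apply/andP; split; lra.
Qed.

Lemma Rintegral_itv_cst (p q c : R) : p <= q ->
  \int[mu]_(t in `[p, q]) c = c * (q - p).
Proof.
move=> pq; rewrite Rintegral_cst//; congr (_ * _).
apply: etrans (congr1 fine (@lebesgue_measure_itv R `[p, q])) _.
rewrite /= lte_fin; move: pq; rewrite le_eqVlt => /predU1P[->|->]//.
by rewrite ltxx subrr.
Qed.

Lemma Rintegral_itv_norm_le (p q B : R) (f : R -> R) : p <= q -> continuous f ->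
  (forall t, p <= t <= q -> `|f t| <= B) ->
  `|\int[mu]_(t in `[p, q]) f t| <= B * (q - p).
Proof.
move=> pq cf fB.
have fi : mu.-integrable `[p, q] (EFin \o f).
  apply: continuous_compact_integrable; first exact: segment_compact.
  exact: continuous_subspaceT.
apply: le_trans (le_normr_Rintegral _ fi) _ => //.
rewrite -(Rintegral_itv_cst B pq); apply: le_Rintegral => //.
- apply: continuous_compact_integrable; first exact: segment_compact.
  by apply: continuous_subspaceT => t; apply: cvg_norm; exact: cf.
- apply: continuous_compact_integrable; first exact: segment_compact.
  by apply: continuous_subspaceT => t; exact: cvg_cst.
Qed.

(** The factor 2 comes from bounding the real and imaginary parts separately. *)
Lemma normc_Cintegral_expi (p q B : R) z : p <= q ->
  (forall t, p <= t <= q -> expR (- Im z * t) <= B) ->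
  normc (Cintegral `[p, q] (expi z)) <= 2 * B * (q - p).
Proof.
move=> pq zB; have -> : 2 * B * (q - p) = B * (q - p) + B * (q - p) by ring.
apply: normc_le; apply: Rintegral_itv_norm_le => //.
- exact: continuous_Re_expi.
- move=> t pt; apply: le_trans (Re_le_normc _) _; rewrite normc_expi; exact: zB.
- exact: continuous_Im_expi.
- move=> t pt; apply: le_trans (Im_le_normc _) _; rewrite normc_expi; exact: zB.
Qed.

Lemma normc_i z : normc ((0 +i* 1) * z) = normc z.
Proof. by rewrite Normc.normcM /= expr0n/= add0r expr1n sqrtr1 mul1r. Qed.

Lemma normcB z w : normc (z - w) = normc (w - z).
Proof. by rewrite -[LHS]normcN opprB. Qed.

(** The difference is iz times the integral of e^(izs) from 0 to t. *)
Lemma normc_expi_sub1 z (t B : R) :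
  (forall s, `|s| <= `|t| -> expR (- Im z * s) <= B) ->
  normc (expi z t - 1) <= normc z * (2 * B * `|t|).
Proof.
move=> zB; have [t0|/ltW t0] := leP 0 t.
  rewrite -(expi0 z) -(Cintegral_expi z t0) Normc.normcM normc_i.
  apply: ler_wpM2l; first exact: normc_ge0.
  have := @normc_Cintegral_expi 0 t B z t0; rewrite subr0 ger0_norm//; apply.
  by move=> s /andP[s0 st]; apply: zB; rewrite !ger0_norm.
rewrite normcB -(expi0 z) -(Cintegral_expi z t0) Normc.normcM normc_i.
apply: ler_wpM2l; first exact: normc_ge0.
have := @normc_Cintegral_expi t 0 B z t0; rewrite sub0r ler0_norm//; apply.
by move=> s /andP[s0 st]; apply: zB; rewrite !ler0_norm// lerN2.
Qed.

Lemma normc_expi_sub z w (t : R) : normc (expi z t - expi w t) <=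
  normc (z - w) * (2 * expR (normc (z - w) * `|t|) * `|t|) * normc (expi w t).
Proof.
have -> : expi z t - expi w t = (expi (z - w) t - 1) * expi w t.
  by rewrite mulrBl -expiD subrK mul1r.
rewrite Normc.normcM; apply: ler_wpM2r; first exact: normc_ge0.
apply: normc_expi_sub1 => s st; rewrite ler_expR.
apply: le_trans (ler_norm _) _; rewrite normrM normrN.
by apply: ler_pM => //; exact: Im_le_normc.
Qed.

Lemma PWnormE (f : R[i] -> R[i]) :
  PWnorm f ^+ 2 = (2 * pi)^-1 * \int[mu]_x (normc (f x%:C) ^+ 2).
Proof.
rewrite /PWnorm /PWdot ReM/= mul0r subr0.
have -> : \int[mu]_x Re (f x%:C * (f x%:C)^*%C) = \int[mu]_x (normc (f x%:C) ^+ 2).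
  apply: eq_Rintegral => x _; rewrite sqr_normc ReM; case: (f _) => p q /=; ring.
rewrite sqr_sqrtr// mulr_ge0 ?invr_ge0 ?mulr_ge0 ?pi_ge0//.
by apply: Rintegral_ge0 => x _; exact: sqr_ge0.
Qed.

(** The norm integral is cut down to a segment. Integrability on the whole line is a genuine
    hypothesis: a divergent integral would count as 0. *)
Lemma PWnorm_lower (f : R[i] -> R[i]) (m p q : R) : p <= q -> 0 <= m ->
  mu.-integrable setT (EFin \o (fun x : R => normc (f x%:C) ^+ 2)) ->
  (forall x, p <= x <= q -> m <= normc (f x%:C) ^+ 2) ->
  m * (q - p) / (2 * pi) <= PWnorm f ^+ 2.
Proof.
move=> pq m0 fi fm; rewrite PWnormE mulrC ler_pM2l; last first.
  by rewrite invr_gt0 mulr_gt0// pi_gt0.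
rewrite -(Rintegral_itv_cst m pq).
apply: le_trans (_ : \int[mu]_(x in `[p, q]) (normc (f x%:C) ^+ 2) <= _).
  apply: le_Rintegral => //.
  - apply: continuous_compact_integrable; first exact: segment_compact.
    by apply: continuous_subspaceT => t; exact: cvg_cst.
  - exact: integrableS fi.
rewrite Rintegral_mkcond; apply: le_Rintegral => //.
  rewrite (_ : _ \o _ = (fun x : R => (normc (f x%:C) ^+ 2)%:E) \_ `[p, q]); last first.
    by apply/funext => x; rewrite /= !patchE; case: ifP.
  by apply/integrable_restrict => //; rewrite setTI; exact: integrableS fi.
by move=> x _; rewrite patchE; case: ifP => // _; exact: sqr_ge0.
Qed.

Lemma integrable_invr_oneDsqr :
  mu.-integrable setT (EFin \o (fun x : R => (1 + x ^+ 2)^-1)).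
Proof.
have c : continuous (fun x : R => (1 + x ^+ 2)^-1) by exact: continuous_oneDsqrV.
apply/integrableP; split.
  by apply/measurable_EFinP; exact: continuous_measurable_fun.
under eq_integral do rewrite /= ger0_norm ?invr_ge0 ?addr_ge0 ?sqr_ge0//.
rewrite (@ge0_symfun_integralT _ (fun x : R => (1 + x ^+ 2)^-1))//.
- rewrite (_ : [set x | _] = `[0, +oo[%classic); last first.
    by apply/seteqP; split => x/=; rewrite in_itv/= andbT.
  by have -> := @integral0y_oneDsqr R; rewrite -EFinM ltry.
- by move=> x; rewrite invr_ge0 addr_ge0 ?sqr_ge0.
- by move=> x; rewrite /= sqrrN.
Qed.

End KernelBounds.

(** * Lower bounds for kernel norms on an interval with a possible gap *)

Section GappedKernel.
Variable R : realType.
Notation mu := (@lebesgue_measure R).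
Notation Re := complex.Re.
Notation Im := complex.Im.
Notation normc := Normc.normc.
Implicit Types (z w : R[i]).

(* S is [p, q] without a gap between a and b; a = b is allowed, so that intervals
   are covered too. *)
Variables (S : set R) (p a b q : R).
Hypothesis bS : bounded_measurable S.
Hypotheses (pa : p < a) (ab : a <= b) (bq : b < q).
Let K z := Cintegral S (expi z).
Hypothesis KE : forall z,
  (0 +i* 1) * z * K z = (expi z q - expi z p) - (expi z b - expi z a).
Hypothesis S_gt0 : 0 < \int[mu]_(t in S) 1.

Let mS : measurable S := bS.1.

Let cexpR y : continuous (fun t : R => expR (y * t)).
Proof.
move=> t; apply: (@continuous_comp _ _ _ (fun t => y * t) expR).
  by apply: cvgM; [exact: cvg_cst|exact: cvg_id].
exact: continuous_expR.
Qed.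

Lemma continuous_integrable (f : R -> R) : continuous f ->
  mu.-integrable S (EFin \o f).
Proof.
move=> cf; have [_ [M SM]] := bS.
apply: (@integrableS _ _ _ mu `[- M, M]) => //.
apply: continuous_compact_integrable; first exact: segment_compact.
exact: continuous_subspaceT.
Qed.

Let B1 y : R := \int[mu]_(t in S) expR (- y * t).

Let K_bounded z : normc (K z) <= B1 (Im z) + B1 (Im z).
Proof.
apply: normc_le.
  apply: le_trans (le_normr_Rintegral _ _) _ => //.
    by apply: continuous_integrable; exact: continuous_Re_expi.
  apply: le_Rintegral => //.
  - apply: continuous_integrable => t; apply: cvg_norm; exact: continuous_Re_expi.
  - by apply: continuous_integrable; exact: cexpR.
  - by move=> t _; apply: le_trans (Re_le_normc _) _; rewrite normc_expi.
apply: le_trans (le_normr_Rintegral _ _) _ => //.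
  by apply: continuous_integrable; exact: continuous_Im_expi.
apply: le_Rintegral => //.
- apply: continuous_integrable => t; apply: cvg_norm; exact: continuous_Im_expi.
- by apply: continuous_integrable; exact: cexpR.
- by move=> t _; apply: le_trans (Im_le_normc _) _; rewrite normc_expi.
Qed.

Let B2 y : R := expR (- y * q) + expR (- y * p) + (expR (- y * b) + expR (- y * a)).

Let K_decay z : normc z * normc (K z) <= B2 (Im z).
Proof.
rewrite -(normc_i z) -Normc.normcM KE.
apply: le_trans (le_normcD _ _) _; rewrite normcN; apply: lerD.
  by apply: le_trans (le_normcD _ _) _; rewrite normcN !normc_expi.
by apply: le_trans (le_normcD _ _) _; rewrite normcN !normc_expi.
Qed.

(** The trivial bound and the 1/|z| decay combine into a constant depending on Im z alone, hence
    uniform along a horizontal line. *)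
Let K_sqr z : normc (K z) ^+ 2 * (1 + Re z ^+ 2) <=
  (B1 (Im z) + B1 (Im z)) ^+ 2 + B2 (Im z) ^+ 2.
Proof.
rewrite mulrDr mulr1; apply: lerD.
  rewrite ler_pXn2r ?nnegrE ?normc_ge0//.
  exact: le_trans (normc_ge0 _) (K_bounded z).
apply: le_trans (_ : (normc z * normc (K z)) ^+ 2 <= _).
  rewrite exprMn mulrC; apply: ler_wpM2r; first exact: sqr_ge0.
  by rewrite sqr_normc lerDl sqr_ge0.
rewrite ler_pXn2r ?nnegrE ?mulr_ge0 ?normc_ge0//.
by apply: le_trans (K_decay z); rewrite mulr_ge0 ?normc_ge0.
Qed.

Let continuous_K (c : R[i]) :
  continuous (fun x : R => Re (K (x%:C - c))) /\
  continuous (fun x : R => Im (K (x%:C - c))).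
Proof.
have ImE x : - Im (x%:C - c) = Im c by rewrite !ReImE /= sub0r opprK.
have ReE x : Re (x%:C - c) = x - Re c by rewrite !ReImE.
split=> x.
  apply: (@continuity_under_integral R _ _ mu (fun x t => Re (expi (x%:C - c) t))
     S mS (x - 1) (x + 1) _ _ (fun t => expR (Im c * t))) => //.
  - by move=> y _; apply: continuous_integrable; exact: continuous_Re_expi.
  - apply: aeW => t _ y _; under eq_fun do rewrite Re_expi ImE ReE.
    apply: cvgM; first exact: cvg_cst.
    apply: (@continuous_comp _ _ _ (fun x => (x - Re c) * t) cos); last exact: continuous_cos.
    by apply: cvgM; [apply: cvgB; [exact: cvg_id|exact: cvg_cst]|exact: cvg_cst].
  - by apply: continuous_integrable; exact: cexpR.
  - move=> y _; apply: aeW => t _; apply: le_trans (Re_le_normc _) _.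
    by rewrite normc_expi ImE.
  - by rewrite inE/= in_itv/= ltrDl ltr01 gtrDl oppr_lt0 ltr01.
apply: (@continuity_under_integral R _ _ mu (fun x t => Im (expi (x%:C - c) t))
   S mS (x - 1) (x + 1) _ _ (fun t => expR (Im c * t))) => //.
- by move=> y _; apply: continuous_integrable; exact: continuous_Im_expi.
- apply: aeW => t _ y _; under eq_fun do rewrite Im_expi ImE ReE.
  apply: cvgM; first exact: cvg_cst.
  apply: (@continuous_comp _ _ _ (fun x => (x - Re c) * t) sin); last exact: continuous_sin.
  by apply: cvgM; [apply: cvgB; [exact: cvg_id|exact: cvg_cst]|exact: cvg_cst].
- by apply: continuous_integrable; exact: cexpR.
- move=> y _; apply: aeW => t _; apply: le_trans (Im_le_normc _) _.
  by rewrite normc_expi ImE.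
- by rewrite inE/= in_itv/= ltrDl ltr01 gtrDl oppr_lt0 ltr01.
Qed.

Lemma integrable_kappa l :
  mu.-integrable setT (EFin \o (fun x : R => normc (kappa S l x%:C) ^+ 2)).
Proof.
pose c := l^*%C; have [c1 c2] := continuous_K c.
pose y := Im (- c).
pose C := ((B1 y + B1 y) ^+ 2 + B2 y ^+ 2) * (2 * (1 + Re c ^+ 2)).
apply: (@le_integrable _ _ _ mu setT _ _
    (EFin \o (fun x : R => C * (1 + x ^+ 2)^-1))) => //.
- apply/measurable_EFinP; apply: continuous_measurable_fun.
  rewrite (_ : (fun x : R => _) = (fun x : R =>
    Re (K (x%:C - c)) * Re (K (x%:C - c)) + Im (K (x%:C - c)) * Im (K (x%:C - c)))).
    by move=> x; exact: (cvgD (cvgM (c1 x) (c1 x)) (cvgM (c2 x) (c2 x))).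
  by apply/funext => x; rewrite sqr_normc !expr2.
- move=> x _ /=; rewrite lee_fin ger0_norm ?sqr_ge0//.
  apply: le_trans (ler_norm _); rewrite ler_pdivlMr ?ltr_pwDl ?sqr_ge0//.
  have := K_sqr (x%:C - c); rewrite -/(kappa S l x%:C).
  have -> : Im (x%:C - c) = y by rewrite /y !ReImE /= sub0r.
  have -> : Re (x%:C - c) = x - Re c by rewrite !ReImE.
  rewrite /C; set D := _ + _; set k := normc _ ^+ 2; set u := Re c => h.
  have k0 : 0 <= k by exact: sqr_ge0.
  (* Peetre's inequality recentres the dominating function from u to 0. *)
  have h1 : 1 + x ^+ 2 <= (1 + (x - u) ^+ 2) * (2 * (1 + u ^+ 2)).
    by have := sqr_ge0 (x - 2 * u); have := sqr_ge0 ((x - u) * u); nra.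
  apply: le_trans (ler_wpM2l k0 h1) _; rewrite mulrA.
  by apply: ler_wpM2r => //; rewrite mulr_ge0// addr_ge0 ?sqr_ge0.
- apply: integrable_scale => //; exact: integrable_invr_oneDsqr.
Qed.

(** One exponential dominates: each of the others is at most a sixth of it, because e^5 >= 1 + 5, so
    the three together take away at most half. *)
Let numerator_lower z (r r1 r2 r3 : R) (z1 z2 z3 : R[i]) (y : R) :
  normc z = expR (- y * r) ->
  normc z1 = expR (- y * r1) -> normc z2 = expR (- y * r2) ->
  normc z3 = expR (- y * r3) ->
  5 <= y * (r1 - r) -> 5 <= y * (r2 - r) -> 5 <= y * (r3 - r) ->
  expR (- y * r) / 2 <= normc (z + z1 + z2 + z3).
Proof.
move=> e e1 e2 e3 h1 h2 h3.
have E s : 5 <= y * (s - r) -> expR (- y * s) <= expR (- y * r) / 6.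
  move=> h; have -> : - y * s = - y * r - y * (s - r) by ring.
  rewrite expRD; apply: ler_wpM2l; first exact: expR_ge0.
  rewrite expRN lef_pV2 ?posrE ?expR_gt0//.
  by have := expR_ge1Dx (y * (s - r)); lra.
have := le_normcD (z + z1 + z2 + z3) (- (z1 + z2 + z3)).
have -> : z + z1 + z2 + z3 - (z1 + z2 + z3) = z by ring.
rewrite normcN e.
have := le_normcD (z1 + z2) z3; have := le_normcD z1 z2.
rewrite e1 e2 e3; have := E _ h1; have := E _ h2; have := E _ h3; lra.
Qed.

Let d : R := Num.min (a - p) (q - b).
Let d0 : 0 < d. Proof. by rewrite lt_min !subr_gt0 pa bq. Qed.
(** Where |Im z| >= [Y0], the exponential at one outer endpoint exceeds those at the three other
    endpoints by a factor of at least e^5. *)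
Let Y0 : R := 5 / d.
Let Y00 : 0 < Y0. Proof. by rewrite divr_gt0. Qed.
Let da : d <= a - p. Proof. by rewrite ge_min lexx. Qed.
Let db : d <= q - b. Proof. by rewrite ge_min lexx orbT. Qed.

Let K_lower_far z (r : R) : (Y0 <= Im z /\ r = p \/ Im z <= - Y0 /\ r = q) ->
  expR (- Im z * r) / 2 <= normc z * normc (K z).
Proof.
set y := Im z; rewrite -(normc_i z) -Normc.normcM KE.
have yd s : Y0 <= `|y| -> d <= s -> 5 <= `|y| * s.
  move=> hy hs; have -> : 5 = Y0 * d by rewrite /Y0 divfK// gt_eqF.
  by apply: ler_pM => //; exact: ltW.
case=> -[hy ->].
  have ya : `|y| = y by rewrite ger0_norm// (le_trans _ hy)// ltW.
  rewrite ya in yd.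
  rewrite (_ : _ - _ = - expi z p + expi z q + - expi z b + expi z a); last first.
    by ring.
  apply: (@numerator_lower _ p q b a); rewrite ?normcN ?normc_expi//;
    apply: yd => //; move: da db pa ab bq; lra.
have ya : `|y| = - y by rewrite ler0_norm// (le_trans hy)// oppr_le0 ltW.
rewrite ya in yd.
rewrite (_ : _ - _ = expi z q + - expi z p + - expi z b + expi z a); last first.
  by ring.
have yN s : y * (s - q) = - y * (q - s) by ring.
apply: (@numerator_lower _ q p b a); rewrite ?normcN ?normc_expi// yN;
  apply: yd => //; move: da db pa ab bq; lra.
Qed.

(** For |Im l| >= [Y0] the dominant endpoint bounds the kernel below on a segment of length |Im l|
    starting at Re l, and the other endpoint has a smaller exponential. For |Im l| < [Y0] the
    integrand hardly rotates on a short segment of fixed length. *)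
Lemma PWnorm_kappa_lower : exists2 c : R, 0 < c & forall l r, (r = p \/ r = q) ->
  c * expR (- 2 * Im l * r) <= PWnorm (kappa S l) ^+ 2 * (1 + `|Im l|).
Proof.
have [_ [M0 SM0]] := bS.
pose M := `|M0| + `|p| + `|q| + 1.
have M1 : 1 <= M by rewrite lerDr !addr_ge0.
have SM t : S t -> `|t| <= M.
  move=> /SM0 /=; rewrite in_itv/= -ler_norml => h; apply: le_trans h _.
  rewrite /M; have := ler_norm M0; have := normr_ge0 p; have := normr_ge0 q; lra.
have M0' : 0 < M := lt_le_trans ltr01 M1.
have pM : `|p| <= M by rewrite /M; have := normr_ge0 M0; have := normr_ge0 q; lra.
have qM : `|q| <= M by rewrite /M; have := normr_ge0 M0; have := normr_ge0 p; lra.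
pose s := \int[mu]_(t in S) (1 : R).
pose m := expR (- Y0 * M) / 2 * s.
have m0 : 0 < m by rewrite mulr_gt0// divr_gt0// expR_gt0.
have pi0 : 0 < 2 * pi :> R by rewrite mulr_gt0// pi_gt0.
pose c1 : R := (16 * pi)^-1.
have c10 : 0 < c1 by rewrite invr_gt0 mulr_gt0// pi_gt0.
(* The last factor compensates [expR (- 2 * y * r)], as |y| <= [Y0] and |r| <= [M] in this
   regime. *)
pose c2 := m ^+ 2 * (4 * M)^-1 / (2 * pi) * expR (- (2 * Y0 * M)).
have c20 : 0 < c2.
  by rewrite mulr_gt0 ?expR_gt0// divr_gt0// mulr_gt0 ?exprn_gt0// invr_gt0; lra.
exists (Num.min c1 c2); first by rewrite lt_min c10.
move=> l r hr; set y := Im l; set u := Re l.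
have kE (x : R) : kappa S l x%:C = K (x%:C - l^*%C) by [].
have zI (x : R) : Im (x%:C - l^*%C) = y.
  by rewrite /y; case: (l) => l1 l2; rewrite !ReImE /= opprK add0r.
have zR (x : R) : Re (x%:C - l^*%C) = x - u.
  by rewrite /u; case: (l) => l1 l2; rewrite !ReImE /=.
have far r' : (Y0 <= y /\ r' = p \/ y <= - Y0 /\ r' = q) ->
    c1 * expR (- 2 * y * r') <= PWnorm (kappa S l) ^+ 2 * (1 + `|y|).
  move=> h; have y0 : 0 < `|y|.
    rewrite normr_gt0; case: h => -[hy _].
      by rewrite gt_eqF// (lt_le_trans Y00 hy).
    by rewrite lt_eqF// (le_lt_trans hy)// oppr_lt0 Y00.
  (* On the segment |z|^2 <= 2 y^2, and the numerator of the kernel is at least half the dominant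
     exponential, whence 8 y^2. The length |y| and the factor 1/(2 pi) then give the 16 pi of
     [c1]. *)
  pose m' := expR (- 2 * y * r') / (8 * y ^+ 2).
  have y2 : y ^+ 2 = `|y| ^+ 2 by rewrite real_normK ?num_real.
  have m'0 : 0 <= m' by rewrite divr_ge0 ?expR_ge0// mulr_ge0// sqr_ge0.
  have yy : u <= u + `|y| by rewrite lerDl.
  have := @PWnorm_lower R (kappa S l) m' u (u + `|y|) yy m'0 (integrable_kappa l).
  have -> : m' * (u + `|y| - u) / (2 * pi) = c1 * expR (- 2 * y * r') / `|y|.
    rewrite /m' /c1 y2; have := pi_gt0 R; move: (pi : R) => P P0; field.
    by rewrite !gt_eqF.
  move=> hP; have {}hP := hP _; rewrite -ler_pdivrMr; last by lra.
  apply: le_trans (hP _); last first.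
    move=> x /andP[ux xu]; rewrite kE /m' ler_pdivrMr; last first.
      by rewrite y2 mulr_gt0// exprn_gt0.
    have := @K_lower_far (x%:C - l^*%C) r'; rewrite zI => /(_ h).
    set z := x%:C - l^*%C => hz.
    have hz2 : (expR (- y * r') / 2) ^+ 2 <= (normc z * normc (K z)) ^+ 2.
      rewrite ler_pXn2r ?nnegrE ?divr_ge0 ?expR_ge0 ?mulr_ge0 ?normc_ge0//.
    have zIz : Im z = y := zI x. have zRz : Re z = x - u := zR x.
    move: hz2; rewrite !exprMn (sqr_normc z) zIz zRz.
    have -> : expR (- y * r') ^+ 2 = expR (- 2 * y * r').
      by rewrite -expRM_natl; congr expR; ring.
    set k := normc (K z) ^+ 2; have k0 : 0 <= k by exact: sqr_ge0.
    have xy : (x - u) ^+ 2 <= y ^+ 2.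
      by rewrite y2 ler_pXn2r ?nnegrE//; lra.
    have := ler_wpM2r k0 xy; rewrite mulrDl exprVn; lra.
  apply: ler_wpM2l; first by rewrite mulr_ge0 ?expR_ge0// ltW.
  by rewrite lef_pV2 ?posrE//; lra.
have pq : p <= q by move: pa ab bq; lra.
have [hy|hy] := leP Y0 y.
  apply: le_trans (far p (or_introl (conj hy erefl))).
  apply: ler_pM; rewrite ?expR_ge0//; first by rewrite ltW// lt_min c10.
    by rewrite ge_min lexx.
  rewrite ler_expR; case: hr => -> //; rewrite !mulNr lerN2.
  by apply: ler_wpM2l => //; move: Y00; lra.
have [hy'|hy'] := leP y (- Y0).
  apply: le_trans (far q (or_intror (conj hy' erefl))).
  apply: ler_pM; rewrite ?expR_ge0//; first by rewrite ltW// lt_min c10.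
    by rewrite ge_min lexx.
  rewrite ler_expR; case: hr => -> //.
  by apply: ler_wpM2l => //; move: Y00; lra.
have ay : `|y| <= Y0 by rewrite ler_norml; apply/andP; split; exact: ltW.
(* Length 1/(4M) keeps (x - u) |t| <= 1/4, so e^(i(x-u)t) is within 1/2 of 1 and its real part is at
   least 1/2. *)
have uu : u <= u + (4 * M)^-1 by rewrite lerDl invr_ge0 mulr_ge0// ltW.
have := @PWnorm_lower R (kappa S l) (m ^+ 2) u _ uu (sqr_ge0 m) (integrable_kappa l).
rewrite (addrC u) addrK => hP.
have {}hP : m ^+ 2 * (4 * M)^-1 / (2 * pi) <= PWnorm (kappa S l) ^+ 2.
  apply: hP => x /andP[ux xu]; rewrite kE; set z := x%:C - _.
  rewrite ler_pXn2r ?nnegrE ?normc_ge0 ?(ltW m0)//.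
  apply: le_trans (Re_le_normc _); apply: le_trans (ler_norm _).
  rewrite /m /s -RintegralZl//; last first.
    by apply: continuous_integrable => t; exact: cvg_cst.
  apply: le_Rintegral => //.
  - by apply: continuous_integrable => t; exact: cvg_cst.
  - by apply: continuous_integrable; exact: continuous_Re_expi.
  move=> t St; rewrite mulr1 Re_expi zI zR.
  have w0 : 0 <= x - u by rewrite subr_ge0.
  apply: ler_pM; rewrite ?expR_ge0 ?invr_ge0//.
    rewrite ler_expR !mulNr lerN2; apply: le_trans (ler_norm _) _.
    by rewrite normrM; apply: ler_pM => //; exact: SM.
  have := @normc_expi_sub1 R (x - u)%:C t 1.
  have -> : normc (x - u)%:C = x - u by rewrite /= expr0n/= addr0 sqrtr_sqr ger0_norm.
  move=> h.
  have {}h : normc (expi (x - u)%:C t - 1) <= 2^-1.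
    apply: le_trans (h _) _; first by move=> v _; rewrite /= oppr0 mul0r expR0.
    rewrite mulr1 mulrCA.
    have : (x - u) * `|t| <= (4 * M)^-1 * M.
      by apply: ler_pM => //; [lra|exact: SM].
    by rewrite invfM mulfVK ?gt_eqF//; lra.
  have := le_trans (Re_le_normc _) h.
  rewrite !ReImE Re_expi/= oppr0 mul0r expR0 mul1r.
  rewrite ler_norml => /andP[]; lra.
apply: le_trans (_ : c2 * expR (- 2 * y * r) <= _).
  by apply: ler_wpM2r; rewrite ?expR_ge0// ge_min lexx orbT.
rewrite /c2 -mulrA -expRD; apply: ler_pM; rewrite ?expR_ge0//.
  by rewrite divr_ge0 ?mulr_ge0 ?sqr_ge0 ?invr_ge0// ltW//; lra.
apply: le_trans (_ : expR 0 <= _); last by rewrite expR0 lerDl.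
rewrite ler_expR.
have rM : `|r| <= M by case: hr => ->.
have : `|y| * `|r| <= Y0 * M by apply: ler_pM.
by rewrite -normrM; have := ler_norm (- (y * r)); rewrite normrN; lra.
Qed.

End GappedKernel.

(** * Kernel and energy bounds for concrete sets, and separation of the nodes *)

Section Intervals.
Variable R : realType.
Notation mu := (@lebesgue_measure R).
Notation Re := complex.Re.
Notation Im := complex.Im.
Notation normc := Normc.normc.
Implicit Types (z w l : R[i]).

(** The gap is shrunk to the midpoint, where its two exponentials cancel. *)
Lemma kappa_itv_lower (p q : R) : p < q -> exists2 c : R, 0 < c &
  forall l r, (r = p \/ r = q) ->
    c * expR (- 2 * Im l * r) <= PWnorm (kappa `[p, q] l) ^+ 2 * (1 + `|Im l|).
Proof.
move=> pq; pose m := (p + q) / 2.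
apply: (@PWnorm_kappa_lower R `[p, q] p m m q).
- exact: bounded_measurable_itv.
- by rewrite /m; lra.
- by [].
- by rewrite /m; lra.
- by move=> z; rewrite Cintegral_expi ?ltW// subrr subr0.
- by rewrite Rintegral_itv_cst ?ltW// mul1r subr_gt0.
Qed.

Lemma disjoint_itv (p a b q : R) : a < b -> [disjoint `[p, a] & `[b, q]].
Proof.
move=> ab; apply/eqP; rewrite -subset0 => t [] /=; rewrite !in_itv/=.
by move=> /andP[_ ta] /andP[bt _]; have := le_trans bt ta; rewrite leNgt ab.
Qed.

Lemma bounded_measurableU (S S' : set R) :
  bounded_measurable S -> bounded_measurable S' -> bounded_measurable (S `|` S').
Proof.
move=> [mS [M SM]] [mS' [M' SM']]; split; first exact: measurableU.
exists (Num.max M M') => t /= [/SM|/SM'] /=; rewrite !in_itv/= -!ler_norml => h.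
  by apply: le_trans h _; rewrite le_max lexx.
by apply: le_trans h _; rewrite le_max lexx orbT.
Qed.

Lemma kappa_gap_lower (p a b q : R) : p < a -> a < b -> b < q ->
  exists2 c : R, 0 < c & forall l r, (r = p \/ r = q) ->
    c * expR (- 2 * Im l * r) <=
    PWnorm (kappa (`[p, a] `|` `[b, q]) l) ^+ 2 * (1 + `|Im l|).
Proof.
move=> pa ab bq.
have bS : bounded_measurable (`[p, a] `|` `[b, q]).
  by apply: bounded_measurableU; exact: bounded_measurable_itv.
apply: (@PWnorm_kappa_lower R _ p a b q) => //; first exact: ltW.
  move=> z; rewrite Cintegral_setU//; last 2 first.
  - exact: disjoint_itv.
  - exact: cintegrable_expi.
  by rewrite mulrDr !Cintegral_expi ?ltW//; ring.
rewrite Rintegral_setU//; last 2 first.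
- by apply: continuous_integrable => // t; exact: cvg_cst.
- exact: disjoint_itv.
by rewrite !Rintegral_itv_cst ?ltW// !mul1r addr_gt0// subr_gt0.
Qed.

Lemma energy_ge0 S z : 0 <= energy S z.
Proof. by apply: Rintegral_ge0 => t _; exact: sqr_ge0. Qed.

(** The integral over [-c, c] is at most the length 2c times the maximum; its closed form gains the
    factor 1/|Im z|. *)
Lemma energy_upper (S : set R) (c : R) : 0 < c -> measurable S -> S `<=` `[- c, c] ->
  exists2 C : R, 0 < C & forall z,
    energy S z * (1 + `|Im z|) <= C * expR (2 * c * `|Im z|).
Proof.
move=> c0 mS Sc; exists (2 * c + 1); first by lra.
move=> z; set y := Im z; have cc : - c <= c by lra.
have ce : continuous (fun t => expR (- 2 * y * t)).
  move=> t; apply: (@continuous_comp _ _ _ (fun t => - 2 * y * t) expR).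
    by apply: cvgM; [exact: cvg_cst|exact: cvg_id].
  exact: continuous_expR.
pose e := \int[mu]_(t in `[- c, c]) expR (- 2 * y * t).
have bc := bounded_measurable_itv (- c) c.
have ie : mu.-integrable `[- c, c] (EFin \o (fun t => expR (- 2 * y * t))).
  exact: continuous_integrable.
have e1 : energy S z <= e.
  have bS : bounded_measurable S by split => //; exists c.
  rewrite /energy /e; under eq_Rintegral do rewrite sqr_normc_expi.
  rewrite Rintegral_mkcond [leRHS]Rintegral_mkcond; apply: le_Rintegral => //.
  - rewrite (_ : _ \o _ = (fun t => (expR (- 2 * y * t))%:E) \_ S); last first.
      by apply/funext => x; rewrite /= !patchE; case: ifP.
    by apply/integrable_restrict => //; rewrite setTI; exact: continuous_integrable.
  - rewrite (_ : _ \o _ = (fun t => (expR (- 2 * y * t))%:E) \_ `[- c, c]); last first.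
      by apply/funext => x; rewrite /= !patchE; case: ifP.
    by apply/integrable_restrict => //; rewrite setTI.
  - move=> t _; rewrite !patchE; case: ifPn => [/set_mem /Sc tc|_].
      by rewrite ifT// inE.
    by case: ifP => // _; exact: expR_ge0.
set E := expR _.
have yt t : `|t| <= c -> - 2 * y * t <= 2 * c * `|y|.
  move=> tc; apply: le_trans (ler_norm _) _.
  rewrite !normrM normrN (ger0_norm (ler0n _ 2)) mulrAC.
  by apply: ler_wpM2r => //; apply: ler_wpM2l.
have e2 : e <= 2 * c * E.
  have := @Rintegral_itv_norm_le R (- c) c E (fun t => expR (- 2 * y * t)) cc ce.
  rewrite opprK => h; apply: le_trans (ler_norm _) _.
  rewrite mulrC; have -> : 2 * c = c + c by ring.
  apply: h => t; rewrite -ler_norml => tc.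
  by rewrite gtr0_norm ?expR_gt0// ler_expR yt.
have e3 : e * (2 * `|y|) <= E.
  (* At the purely imaginary point 2iy the formula evaluates the integral of the real exponential
     e^(-2yt). *)
  have h := Cintegral_expi (0 +i* (2 * y)) cc.
  have zi : (0 +i* 1) * (0 +i* (2 * y)) = (- (2 * y))%:C :> R[i].
    by apply: complex_eqP; rewrite !ReImE/=; ring.
  have er : Re (Cintegral `[- c, c] (expi (0 +i* (2 * y)))) = e.
    by apply: eq_Rintegral => t _; rewrite Re_expi /= mul0r cos0 mulr1 mulNr.
  rewrite zi in h; have := etrans (esym (ReM _ _)) (congr1 (@complex.Re R) h).
  rewrite er ReD ReN !Re_expi /= !mul0r !cos0 !mulr1 subr0 -!mulNr.
  have h1 : expR (- 2 * y * c) <= E by rewrite ler_expR yt// ger0_norm// ltW.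
  have h2 : expR (- 2 * y * - c) <= E by rewrite ler_expR yt// normrN ger0_norm// ltW.
  have := expR_ge0 (- 2 * y * c); have := expR_ge0 (- 2 * y * - c).
  have [y0|y0] := leP 0 y; [rewrite ger0_norm//|rewrite ltr0_norm//]; lra.
have e0 : 0 <= e by apply: Rintegral_ge0 => t _; exact: expR_ge0.
have y0 := normr_ge0 y; have s0 := energy_ge0 S z.
have E0 : 0 <= E := expR_ge0 _.
apply: le_trans (_ : e * (1 + `|y|) <= _); last by nra.
by apply: ler_wpM2r => //; rewrite addr_ge0.
Qed.

(** With A and B the moduli at the endpoints, the trivial bound 2 (A + B)(b - a) and the decay (A +
    B)/|z| are squared and added; (A + B)^2 <= 2 (A^2 + B^2) gives the constant. *)
Lemma Cintegral_expi_upper (a b : R) : a <= b -> exists2 C : R, 0 < C & forall z,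
  normc (Cintegral `[a, b] (expi z)) ^+ 2 * (1 + normc z ^+ 2) <=
  C * (expR (- 2 * Im z * a) + expR (- 2 * Im z * b)).
Proof.
move=> ab; exists (8 * (b - a) ^+ 2 + 2).
  by have := sqr_ge0 (b - a); lra.
move=> z; set y := Im z; pose A := expR (- y * a); pose B := expR (- y * b).
have A2 : expR (- 2 * y * a) = A ^+ 2 by rewrite -expRM_natl; congr expR; ring.
have B2 : expR (- 2 * y * b) = B ^+ 2 by rewrite -expRM_natl; congr expR; ring.
rewrite A2 B2; set k := normc (Cintegral _ _).
have A0 : 0 <= A := expR_ge0 _; have B0 : 0 <= B := expR_ge0 _.
have k0 : 0 <= k := normc_ge0 _.
have h1 : k <= 2 * (A + B) * (b - a).
  apply: normc_Cintegral_expi => // t /andP[a_t tb].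
  have [y0|y0] := leP 0 y.
    apply: le_trans (_ : A <= _); last by rewrite lerDl.
    by rewrite ler_expR !mulNr lerN2 ler_wpM2l.
  apply: le_trans (_ : B <= _); last by rewrite lerDr.
  by rewrite ler_expR ler_wpM2l// oppr_ge0 ltW.
have h2 : normc z * k <= A + B.
  rewrite -(normc_i z) -Normc.normcM Cintegral_expi//.
  by apply: le_trans (le_normcD _ _) _; rewrite normcN !normc_expi addrC.
have ba : 0 <= b - a by rewrite subr_ge0.
have h1' : k ^+ 2 <= (2 * (A + B) * (b - a)) ^+ 2.
  have AB0 : 0 <= A + B by exact: addr_ge0.
  by rewrite ler_pXn2r// nnegrE !mulr_ge0.
have h2' : (normc z * k) ^+ 2 <= (A + B) ^+ 2.
  by rewrite ler_pXn2r ?nnegrE ?mulr_ge0 ?addr_ge0 ?normc_ge0.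
have AB : (A + B) ^+ 2 <= 2 * (A ^+ 2 + B ^+ 2).
  by have := sqr_ge0 (A - B); rewrite sqrrB sqrrD; lra.
have := ler_wpM2l (sqr_ge0 (b - a)) AB.
move: h1' h2'; rewrite !exprMn; lra.
Qed.

(** If |l - l'| = d <= 1, then on E the two exponentials differ by at most 2 q e^q d times the
    modulus of the one at l. For small d this contradicts the lower bound of
    [interpolation_separated]. *)
Lemma separated_of_interpolating (p a b q : R) (L : set R[i]) :
  let E := `[p, a] `|` `[b, q] in
  p = - q -> p < a -> a < b -> b < q ->
  complete_interpolating E L ->
  exists2 d : R, 0 < d & forall l l', L l -> L l' -> l != l' -> d <= normc (l - l').
Proof.
move=> E pq pa ab bq CI.
have q0 : 0 < q by lra.
have bE : bounded_measurable E.
  by apply: bounded_measurableU; exact: bounded_measurable_itv.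
have Eq : E `<=` `[- q, q].
  by move=> t [] /=; rewrite !in_itv/= => /andP[h1 h2]; apply/andP; split; lra.
have [c c0 cP] := kappa_gap_lower pa ab bq.
have N0 l : 0 < PWnorm (kappa E l).
  have := cP l p (or_introl erefl); rewrite le_eqVlt => h.
  have : 0 < PWnorm (kappa E l) ^+ 2 * (1 + `|Im l|).
    apply: lt_le_trans (cP l p (or_introl erefl)).
    by rewrite mulr_gt0// expR_gt0.
  rewrite pmulr_lgt0 ?ltr_pwDl// exprn_even_gt0//= => hn.
  by rewrite lt_neqAle eq_sym hn sqrtr_ge0.
have [C1 C10 C1P] := energy_upper q0 bE.1 Eq.
have [C C0 CP] := interpolation_separated bE (fun l _ => N0 l) CI.
pose Q := C * (C1 / c) * (2 * expR q * q) ^+ 2.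
have Q0 : 0 < Q.
  apply: mulr_gt0; first by apply: mulr_gt0 => //; exact: divr_gt0.
  by rewrite exprn_gt0// !mulr_gt0// expR_gt0.
(* The one direction of Plancherel that is needed, up to a constant: both sides are compared with
   e^(2q|y|) / (1 + |y|), the endpoint being chosen by the sign of y. *)
have enN l : energy E l <= C1 / c * PWnorm (kappa E l) ^+ 2.
  have h1 := C1P l; set y := Im l in h1.
  have y1 : 0 < 1 + `|y| by rewrite ltr_pwDl.
  have h2 : c * expR (2 * q * `|y|) <= PWnorm (kappa E l) ^+ 2 * (1 + `|y|).
    have [y0|y0] := leP 0 y.
      have := cP l p (or_introl erefl); congr (c * expR _ <= _ * _); rewrite pq -/y.
      by rewrite ger0_norm//; ring.
    have := cP l q (or_intror erefl); congr (c * expR _ <= _ * _); rewrite -/y.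
    by rewrite ltr0_norm//; ring.
  rewrite -(ler_pM2r y1); apply: le_trans h1 _.
  have -> : C1 / c * PWnorm (kappa E l) ^+ 2 * (1 + `|y|) =
      C1 * (c^-1 * (PWnorm (kappa E l) ^+ 2 * (1 + `|y|))) by ring.
  by apply: ler_wpM2l; [exact: ltW|rewrite ler_pdivlMl].
(* The bound 1 keeps the exponential factor below e^q; the bound 1/(Q+1) forces Q d^2 < 1. *)
exists (Num.min 1 (Q + 1)^-1).
  by rewrite lt_min ltr01 invr_gt0; lra.
move=> l l' Ll Ll' ll'; rewrite leNgt; apply/negP; rewrite lt_min => /andP[d1 d2].
set d := normc (l - l') in d1 d2.
have d0 : 0 <= d := normc_ge0 _.
have := CP l l' Ll Ll' ll'; apply/negP; rewrite -ltNge.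
set N := PWnorm _.
apply: le_lt_trans (_ : C * ((d * (2 * expR q * q)) ^+ 2 * energy E l) < _).
  apply: ler_wpM2l; first exact: ltW.
  have cE : continuous (fun t => normc (expi l t) ^+ 2).
    rewrite (_ : (fun t => _) = (fun t => Re (expi l t) * Re (expi l t)
        + Im (expi l t) * Im (expi l t))).
      have cR := @continuous_Re_expi R l; have cI := @continuous_Im_expi R l.
      by move=> t; exact: (cvgD (cvgM (cR t) (cR t)) (cvgM (cI t) (cI t))).
    by apply/funext => t; rewrite sqr_normc !expr2.
  rewrite /energy -RintegralZl//; [|exact: bE.1|exact: continuous_integrable].
  apply: le_Rintegral => //; first exact: bE.1.
  - apply: continuous_integrable => //.
    rewrite (_ : (fun t => _) = (fun t =>
        (Re (expi l t) - Re (expi l' t)) * (Re (expi l t) - Re (expi l' t))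
        + (Im (expi l t) - Im (expi l' t)) * (Im (expi l t) - Im (expi l' t)))).
      have cR : continuous (fun t => Re (expi l t) - Re (expi l' t)).
        by move=> t; apply: cvgB; exact: continuous_Re_expi.
      have cI : continuous (fun t => Im (expi l t) - Im (expi l' t)).
        by move=> t; apply: cvgB; exact: continuous_Im_expi.
      by move=> t; exact: (cvgD (cvgM (cR t) (cR t)) (cvgM (cI t) (cI t))).
    by apply/funext => t; rewrite sqr_normc !ReImE !expr2.
  - apply: continuous_integrable => // t.
    by apply: cvgM; [exact: cvg_cst|exact: cE].
  move=> t /Eq tE; have tq : `|t| <= q by move: tE; rewrite /= in_itv/= -ler_norml.
  have q0' := ltW q0; have n0 := @normc_ge0 R.
  rewrite -exprMn ler_pXn2r ?nnegrE//; last by rewrite !mulr_ge0 ?expR_ge0.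
  rewrite normcB; apply: le_trans (normc_expi_sub _ _ _) _.
  apply: ler_wpM2r; first exact: normc_ge0.
  rewrite normcB -/d; apply: ler_wpM2l => //.
  apply: ler_pM => //; try by rewrite mulr_ge0 ?expR_ge0.
  apply: ler_wpM2l => //; rewrite ler_expR -[leRHS]mul1r.
  by apply: ler_pM => //; exact: ltW.
have dQ : Q * d ^+ 2 < 1.
  have : Q * d < 1.
    have : Q * d <= Q * (Q + 1)^-1 by rewrite ler_pM2l// ltW.
    move=> h; apply: le_lt_trans h _; rewrite ltr_pdivrMr; lra.
  have : Q * d ^+ 2 <= Q * d.
    by rewrite ler_pM2l// expr2 ler_piMr// ltW.
  lra.
have NN : 0 < N ^+ 2 by rewrite exprn_gt0// N0.
apply: le_lt_trans (_ : C * ((d * (2 * expR q * q)) ^+ 2 * (C1 / c * N ^+ 2)) < _).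
  apply: ler_wpM2l; first exact: ltW.
  by apply: ler_wpM2l; [exact: sqr_ge0|exact: enN].
have -> : C * ((d * (2 * expR q * q)) ^+ 2 * (C1 / c * N ^+ 2)) = Q * d ^+ 2 * N ^+ 2.
  by rewrite /Q; ring.
by rewrite gtr_pMl.
Qed.

End Intervals.

(** * A Bessel-type inequality for the kernels of the gap *)

Section Bessel.
Variable R : realType.
Notation Re := complex.Re.
Notation Im := complex.Im.
Notation normc := Normc.normc.
Implicit Types (z w l : R[i]).

(** Each term after the first is dominated by a telescoping difference of e^-1 / (V + e k). *)
Lemma sum_inv_sqr_le (V e : R) n : 1 <= V -> 0 < e ->
  \sum_(k <- iota 0 n) ((V + e * k%:R) ^+ 2)^-1 <= (1 + e^-1) / V.
Proof.
move=> V1 e0; have V0 : 0 < V by exact: lt_le_trans ltr01 V1.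
have den k : 0 < V + e * k%:R by rewrite ltr_wpDr// mulr_ge0// ltW.
case: n => [|n]; first by rewrite big_nil mulr_ge0 ?addr_ge0 ?invr_ge0 ?ltW.
apply: le_trans (_ : V^-1 + (e^-1 / V - e^-1 / (V + e * n%:R)) <= _); last first.
  rewrite mulrDl mul1r addrA lerBlDr lerDl divr_ge0 ?invr_ge0 ?ltW//.
have step k : ((V + e * k.+1%:R) ^+ 2)^-1 <=
    e^-1 / (V + e * k%:R) - e^-1 / (V + e * k.+1%:R).
  have d1 := den k; have d2 := den k.+1.
  have -> : e^-1 / (V + e * k%:R) - e^-1 / (V + e * k.+1%:R) =
      ((V + e * k%:R) * (V + e * k.+1%:R))^-1.
    by move: d1 d2; rewrite -natr1 => d1 d2; field; rewrite !gt_eqF.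
  rewrite lef_pV2 ?posrE ?exprn_gt0 ?mulr_gt0// expr2 ler_pM2r//.
  by rewrite lerD2l ler_pM2l// ler_nat.
elim: n => [|n IH].
  rewrite /= big_seq1 mulr0 addr0 subrr addr0.
  by rewrite lef_pV2 ?posrE ?exprn_gt0// expr2 ler_peMr// ltW.
rewrite -[n.+2]addn1 iotaD big_cat/= big_seq1 add0n.
have := step n; lra.
Qed.

(** A grid of mesh d/2 has at most one point per cell, so the sum is dominated by a product of two
    one-dimensional sums; the constant 4 counts the quadrants. *)
Lemma separated_sum (d : R) : 0 < d -> exists2 C : R, 0 < C &
  forall (s : seq R[i]) (u V : R), 1 <= V -> uniq s ->
    (forall l l', l \in s -> l' \in s -> l != l' -> d <= normc (l - l')) ->
    \sum_(l <- s) ((1 + `|Im l|) ^+ 2 * (V + `|Re l - u|) ^+ 2)^-1 <= C / V.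
Proof.
move=> d0; pose e := d / 2; have e0 : 0 < e by rewrite divr_gt0.
have e1 : 0 < 1 + e^-1 by rewrite ltr_pwDl// ltW// invr_gt0.
exists (4 * (1 + e^-1) ^+ 2); first by rewrite mulr_gt0// exprn_gt0.
move=> s u V V1 us sep.
have V0 : 0 < V by exact: lt_le_trans ltr01 V1.
pose tr (x : R) := Num.truncn (`|x| / e).
have trP x : (tr x)%:R * e <= `|x| < (tr x).+1%:R * e.
  have := truncn_itv (x := `|x| / e); rewrite divr_ge0// ?(ltW e0)// => /(_ isT).
  move=> /andP[h1 h2]; apply/andP.
  by split; [rewrite -ler_pdivlMr|rewrite -ltr_pdivrMr].
(* [tr] sees absolute values only, so the signs complete the label of the cell. *)
pose key l := ((tr (Re l - u), tr (Im l)), (0 <= Re l - u, 0 <= Im l)).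
have close x y : tr x = tr y -> (0 <= x) = (0 <= y) -> `|x - y| < e.
  move=> xy sg; have := trP x; have := trP y; rewrite xy -natr1 mulrDl mul1r.
  move: sg; have [x0|x0] := leP 0 x; have [y0|y0] := leP 0 y => // _.
    rewrite (ger0_norm x0) (ger0_norm y0) => /andP[h1 h2] /andP[h3 h4].
    by rewrite ltr_norml; apply/andP; split; lra.
  rewrite (ltr0_norm x0) (ltr0_norm y0) => /andP[h1 h2] /andP[h3 h4].
  by rewrite ltr_norml; apply/andP; split; lra.
have keyI : {in s &, injective key}.
  move=> l l' ls ls' [k1 k2 k3 k4]; apply/eqP/negPn/negP => ll'.
  have := sep _ _ ls ls' ll'; apply/negP; rewrite -ltNge.
  have h1 := close _ _ k1 k3; have h2 := close _ _ k2 k4.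
  have h3 : normc (l - l') <= `|Re l - u - (Re l' - u)| + `|Im l - Im l'|.
    apply: normc_le; rewrite !ReImE //.
    by rewrite opprD opprK addrACA addNr addr0.
  apply: le_lt_trans h3 _; rewrite /e in h1 h2; lra.
pose T (k : (nat * nat) * (bool * bool)) : R :=
  ((1 + e * k.1.2%:R) ^+ 2)^-1 * ((V + e * k.1.1%:R) ^+ 2)^-1.
have T0 k : 0 <= T k by rewrite mulr_ge0 ?invr_ge0 ?sqr_ge0.
have den W k : 0 < W -> 0 < W + e * k%:R.
  by move=> W0; rewrite ltr_wpDr// mulr_ge0// ltW.
apply: le_trans (_ : \sum_(k <- [seq key l | l <- s]) T k <= _).
  rewrite big_map; apply: ler_sum => l _; rewrite /T/= invfM.
  have inc W x : 0 < W -> ((W + `|x|) ^+ 2)^-1 <= ((W + e * (tr x)%:R) ^+ 2)^-1.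
    move=> W0; have Wx : 0 < W + `|x| by rewrite ltr_wpDr.
    have hd := den W (tr x) W0.
    rewrite lef_pV2 ?posrE ?exprn_gt0// ler_pXn2r ?nnegrE ?(ltW hd) ?(ltW Wx)//.
    by rewrite lerD2l mulrC; have /andP[] := trP x.
  by apply: ler_pM; rewrite ?invr_ge0 ?sqr_ge0 ?inc.
pose n := (\max_(k <- [seq key l | l <- s]) (k.1.1 + k.1.2)).+1.
pose bb := [:: (true, true); (true, false); (false, true); (false, false)].
pose pq := [seq (i, j) | i <- iota 0 n, j <- iota 0 n].
apply: le_trans (_ : \sum_(k <- [seq (x, y) | x <- pq, y <- bb]) T k <= _).
  apply: ler_sum_subset => //.
  - by rewrite map_inj_in_uniq.
  - apply: allpairs_uniq => //; last by move=> -[x1 x2] [y1 y2] _ _ /= [-> ->].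
    apply: allpairs_uniq; rewrite ?iota_uniq//.
    by move=> -[x1 x2] [y1 y2] _ _ /= [-> ->].
  - move=> k ks; have kn : (k.1.1 + k.1.2 < n)%N.
      by rewrite ltnS; apply: (@leq_bigmax_seq _ _ xpredT (fun k => k.1.1 + k.1.2)%N).
    case: k kn {ks} => -[i j] [b1 b2] kn; have {}kn : (i + j < n)%N by [].
    apply/allpairsP; exists ((i, j), (b1, b2)); split=> //; last by case: b1; case: b2.
    apply/allpairsP; exists (i, j); rewrite !mem_iota !add0n; split=> //.
      exact: leq_ltn_trans (leq_addr _ _) kn.
    exact: leq_ltn_trans (leq_addl _ _) kn.
have e4 x : \sum_(y <- bb) T (x, y) =
    4 * (((1 + e * x.2%:R) ^+ 2)^-1 * ((V + e * x.1%:R) ^+ 2)^-1).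
  by rewrite /bb !big_cons big_nil /T/=; ring.
rewrite big_allpairs_dep; under eq_bigr do rewrite e4.
rewrite big_allpairs_dep.
apply: le_trans (_ : 4 * ((\sum_(j <- iota 0 n) ((1 + e * j%:R) ^+ 2)^-1) *
    (\sum_(i <- iota 0 n) ((V + e * i%:R) ^+ 2)^-1)) <= _).
  rewrite le_eqVlt; apply/orP; left; apply/eqP.
  rewrite mulr_suml [RHS]mulr_sumr exchange_big; apply: eq_bigr => j _.
  by rewrite mulrA mulr_sumr; apply: eq_bigr => i _; rewrite mulrA.
have := sum_inv_sqr_le n V1 e0; have := sum_inv_sqr_le n (lexx 1) e0.
set A := \sum_(j <- _) _; set B := \sum_(i <- _) _; rewrite divr1 => hA hB.
have A0 : 0 <= A by apply: sumr_ge0 => i _; rewrite invr_ge0 sqr_ge0.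
have B0 : 0 <= B by apply: sumr_ge0 => i _; rewrite invr_ge0 sqr_ge0.
rewrite expr2 -!mulrA; apply: ler_wpM2l => //.
by apply: ler_pM.
Qed.

(** Fifth power of k (1 + y) <= 1 + (e / 5) y <= e^(e y / 5). *)
Lemma poly_expR_bound (e : R) : 0 < e -> exists2 C : R, 0 < C &
  forall y, 0 <= y -> (1 + y) ^+ 5 <= C * expR (e * y).
Proof.
move=> e0; pose k := Num.min 1 (e / 5).
have k0 : 0 < k by rewrite lt_min ltr01 divr_gt0.
exists (k^-1 ^+ 5); first by rewrite exprn_gt0// invr_gt0.
move=> y y0; rewrite exprVn ler_pdivlMl ?exprn_gt0// -exprMn.
have -> : e * y = 5 * (e / 5 * y) by field.
rewrite expRM_natl; apply: lerXn2r; rewrite ?nnegrE ?expR_ge0//.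
  by rewrite mulr_ge0 ?addr_ge0// ltW.
apply: le_trans (expR_ge1Dx _); rewrite mulrDr mulr1; apply: lerD.
  by rewrite ge_min lexx.
by apply: ler_wpM2r => //; rewrite ge_min lexx orbT.
Qed.

(** Since [a, b] lies strictly inside [-c, c], each term carries a spare e^(-2(c-m)|Im l|), which
    pays for replacing the decay in |l - t| by the weights of [separated_sum]. Taking V = 1 + |Im t|
    there yields the denominator, which must match that of the squared kernel norm of the gap. *)
Lemma kernel_Bessel (a b c d c1 : R) : a <= b -> - c < a -> b < c -> 0 < d ->
  0 < c1 -> exists2 C : R, 0 < C &
  forall (N : R[i] -> R) (s : seq R[i]) (t : R[i]),
    (forall l, l \in s -> 0 < N l) ->
    (forall l, l \in s -> c1 * expR (2 * c * `|Im l|) <= N l ^+ 2 * (1 + `|Im l|)) ->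
    uniq s ->
    (forall l l', l \in s -> l' \in s -> l != l' -> d <= normc (l - l')) ->
    \sum_(l <- s) (normc (Cintegral `[a, b] (expi (l - t))) / N l) ^+ 2 <=
    C * (expR (2 * Im t * a) + expR (2 * Im t * b)) / (1 + `|Im t|).
Proof.
move=> ab ca bc d0 c10.
have [C1 C10 C1P] := Cintegral_expi_upper ab.
pose m := Num.max `|a| `|b|.
have mc : m < c by rewrite gt_max !ltr_norml; apply/andP; split; apply/andP; split; lra.
have [C2 C20 C2P] := @poly_expR_bound (2 * (c - m)) ltac:(lra).
have [C3 C30 C3P] := separated_sum d0.
exists (C1 * 3 * C2 / c1 * C3).
  by rewrite !mulr_gt0// invr_gt0.
move=> N s t N0 Nl us sep; set v := Im t; set u := Re t.
pose V := 1 + `|v|; have V1 : 1 <= V by rewrite lerDl.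
pose Mv := expR (2 * v * a) + expR (2 * v * b).
have Mv0 : 0 <= Mv by rewrite addr_ge0 ?expR_ge0.
apply: le_trans (_ : \sum_(l <- s) C1 * 3 * C2 / c1 * Mv *
    ((1 + `|Im l|) ^+ 2 * (V + `|Re l - u|) ^+ 2)^-1 <= _); last first.
  rewrite -mulr_sumr -[1 + `|v|]/V -[expR _ + _]/Mv.
  have -> : C1 * 3 * C2 / c1 * C3 * Mv / V = C1 * 3 * C2 / c1 * Mv * (C3 / V) by ring.
  apply: ler_wpM2l; last exact: C3P.
  by rewrite mulr_ge0// mulr_ge0 ?invr_ge0 ?mulr_ge0 ?ltW.
rewrite big_seq [leRHS]big_seq; apply: ler_sum => l ls.
have Nl0 := N0 l ls; have {}Nl := Nl l ls.
set y := Im l in Nl *; set x := Re l.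
have := C1P (l - t); set k := normc (Cintegral _ _).
have -> : Im (l - t) = y - v by rewrite !ReImE.
have -> : normc (l - t) ^+ 2 = (x - u) ^+ 2 + (y - v) ^+ 2.
  by rewrite sqr_normc !ReImE.
move=> hk.
have y0 := normr_ge0 y.
have e1 r : `|r| <= m -> expR (- 2 * (y - v) * r) <= expR (2 * m * `|y|) * expR (2 * v * r).
  move=> rm; rewrite -expRD ler_expR.
  have h : `|y| * `|r| <= `|y| * m by apply: ler_wpM2l.
  have := ler_norm (- (y * r)); rewrite normrN normrM; lra.
have hk2 : k ^+ 2 * (1 + ((x - u) ^+ 2 + (y - v) ^+ 2)) <=
    C1 * (expR (2 * m * `|y|) * Mv).
  apply: le_trans hk _; apply: ler_wpM2l; first exact: ltW.
  rewrite /Mv [leRHS]mulrDr; apply: lerD; apply: e1.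
    by rewrite le_max lexx.
  by rewrite le_max lexx orbT.
pose D := V + `|x - u|; have D0 : 0 < D by rewrite ltr_wpDr// (lt_le_trans ltr01).
(* As |v| <= |y| + |y - v|, the height of t is traded for the height of l. *)
have hD : D ^+ 2 <= 3 * (1 + `|y|) ^+ 2 * (1 + ((x - u) ^+ 2 + (y - v) ^+ 2)).
  pose A := `|x - u|; pose B := `|y - v|.
  have A0 : 0 <= A := normr_ge0 _; have B0 : 0 <= B := normr_ge0 _.
  have -> : (x - u) ^+ 2 = A ^+ 2 by rewrite real_normK ?num_real.
  have -> : (y - v) ^+ 2 = B ^+ 2 by rewrite real_normK ?num_real.
  have hv : `|v| <= `|y| + B.
    by have := ler_normB y (y - v); rewrite opprB addrC subrK.
  have h1 : D <= (1 + `|y|) * (1 + A + B).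
    by rewrite /D /V -/A; have := mulr_ge0 y0 A0; have := mulr_ge0 y0 B0; lra.
  have h2 : (1 + A + B) ^+ 2 <= 3 * (1 + (A ^+ 2 + B ^+ 2)).
    have := sqr_ge0 (1 - A); have := sqr_ge0 (1 - B); have := sqr_ge0 (A - B).
    rewrite !expr2; lra.
  apply: le_trans (_ : ((1 + `|y|) * (1 + A + B)) ^+ 2 <= _).
    by rewrite ler_pXn2r ?nnegrE ?(ltW D0)// mulr_ge0// !addr_ge0.
  have := ler_wpM2l (sqr_ge0 (1 + `|y|)) h2; lra.
have hC2 := C2P `|y| y0.
set Y := 1 + `|y| in Nl hD hC2 *; have Y1 : 0 < Y by rewrite ltr_pwDl.
have Q0 : 0 < 1 + ((x - u) ^+ 2 + (y - v) ^+ 2).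
  by rewrite ltr_pwDl// addr_ge0 ?sqr_ge0.
rewrite expr_div_n ler_pdivrMr ?exprn_gt0//.
rewrite -(ler_pM2r (Q0)); apply: le_trans hk2 _.
have eE : expR (2 * c * `|y|) = expR (2 * m * `|y|) * expR (2 * (c - m) * `|y|).
  by rewrite -expRD; congr expR; ring.
rewrite eE in Nl; set Em := expR (2 * m * `|y|) in Nl *.
set Ec := expR (2 * (c - m) * `|y|) in Nl hC2 *.
have Em0 : 0 < Em := expR_gt0 _; have Ec0 : 0 < Ec := expR_gt0 _.
set Q := 1 + (_ + _) in Q0 hD *.
(* Five powers of Y are spent: two in [hD], two in the weight of [separated_sum], one in the lower
   bound for [N l]. *)
have key : D ^+ 2 * Y ^+ 2 * Em * c1 <= 3 * C2 * (N l ^+ 2) * Q.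
  have s1 : D ^+ 2 * (Y ^+ 2 * Em * c1) <= 3 * Y ^+ 2 * Q * (Y ^+ 2 * Em * c1).
    by apply: ler_wpM2r => //; rewrite !mulr_ge0 ?sqr_ge0// ltW.
  have s2 : Y ^+ 5 * (Em * c1) <= C2 * Ec * (Em * c1).
    by apply: ler_wpM2r => //; rewrite mulr_ge0 ?ltW.
  have s3 : C2 * (c1 * (Em * Ec)) <= C2 * (N l ^+ 2 * Y).
    by apply: ler_wpM2l => //; exact: ltW.
  have s4 : Y ^+ 4 * Em * c1 <= C2 * N l ^+ 2.
    rewrite -(ler_pM2r Y1); have -> : Y ^+ 4 * Em * c1 * Y = Y ^+ 5 * (Em * c1) by ring.
    by apply: le_trans s2 _; lra.
  have s5 : 3 * Q * (Y ^+ 4 * Em * c1) <= 3 * Q * (C2 * N l ^+ 2).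
    by apply: ler_wpM2l => //; rewrite mulr_ge0// ltW.
  lra.
have -> : C1 * 3 * C2 / c1 * Mv * (Y ^+ 2 * (V + `|x - u|) ^+ 2)^-1 * N l ^+ 2 * Q =
    C1 * Mv * (3 * C2 * N l ^+ 2 * Q / (D ^+ 2 * Y ^+ 2 * c1)).
  by rewrite -/D; field; rewrite !gt_eqF.
have -> : C1 * (Em * Mv) = C1 * Mv * Em by ring.
apply: ler_wpM2l; first by rewrite mulr_ge0// ltW.
rewrite ler_pdivlMr; last by rewrite !mulr_gt0 ?exprn_gt0.
by rewrite mulrA mulrC mulrA in key *; lra.
Qed.

End Bessel.

(** * Fubini's theorem on a triangle *)

Section Division.
Variable R : realType.
Notation mu := (@lebesgue_measure R).
Notation Re := complex.Re.
Notation Im := complex.Im.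
Notation normc := Normc.normc.

(** Integrability of the iterated integrands is part of the conclusion because linearity of
    [Rintegral] requires it; with B = 1 it also yields the measurability of tail integrals. *)
Lemma Fubini_triangle (p q : R) (A B : R -> R) :
  mu.-integrable `[p, q] (EFin \o A) -> continuous B ->
  [/\ mu.-integrable `[p, q]
        (EFin \o (fun s => A s * \int[mu]_(o in `[p, s]) B o)),
      mu.-integrable `[p, q]
        (EFin \o (fun o => B o * \int[mu]_(s in `[o, q]) A s)) &
      \int[mu]_(s in `[p, q]) (A s * \int[mu]_(o in `[p, s]) B o) =
      \int[mu]_(o in `[p, q]) (B o * \int[mu]_(s in `[o, q]) A s)].
Proof.
move=> iA cB.
have [M BM] : exists M, forall o, p <= o <= q -> `|B o| <= M.
  have [pq|qp] := leP p q; last first.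
    by exists 0 => o /andP[po oq]; have := le_lt_trans (le_trans po oq) qp; rewrite ltxx.
  have cB' : {within `[p, q], continuous (fun t => `|B t|)}.
    by apply: continuous_subspaceT => t; apply: cvg_norm; exact: cB.
  have [c _ cM] := EVT_max pq cB'.
  by exists `|B c| => o po; apply: cM; rewrite in_itv.
pose f (z : R * R) : \bar R :=
  (if (p <= z.2) && (z.2 <= z.1) && (z.1 <= q) then A z.1 * B z.2 else 0)%:E.
(* [A] is measurable on the segment only; its extension by 0 is measurable on the line and agrees
   with it on the triangle. *)
pose A' := A \_ `[p, q].
have iA' : mu.-integrable setT (EFin \o A').
  rewrite (_ : _ \o _ = (EFin \o A) \_ `[p, q]); last first.
    by apply/funext => x; rewrite /A' /= !patchE; case: ifP.
  by apply/integrable_restrict => //; rewrite setTI.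
have mA' : measurable_fun setT A' by apply/measurable_EFinP; case/integrableP: iA'.
have fE z : f z = (if (p <= z.2) && (z.2 <= z.1) && (z.1 <= q) then A' z.1 * B z.2 else 0)%:E.
  rewrite /f; case: ifP => // /andP[/andP[h1 h2] h3]; congr (_ * _)%:E.
  by rewrite /A' patchE ifT// inE/= in_itv/= h3 (le_trans h1 h2).
have mf : measurable_fun setT f.
  rewrite (_ : f = EFin \o (fun z : R * R =>
    if (p <= z.2) && (z.2 <= z.1) && (z.1 <= q) then A' z.1 * B z.2 else 0)); last first.
    by apply/funext => z; rewrite fE.
  apply/measurable_EFinP; apply: measurable_fun_ifT.
  - apply: measurable_and; first apply: measurable_and.
    + by apply: measurable_fun_ler => //; exact: measurable_snd.
    + by apply: measurable_fun_ler; [exact: measurable_snd|exact: measurable_fst].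
    + by apply: measurable_fun_ler => //; exact: measurable_fst.
  - apply: measurable_funM.
      by apply: (measurableT_comp mA'); exact: measurable_fst.
    by apply: (measurableT_comp (continuous_measurable_fun cB)); exact: measurable_snd.
  - exact: measurable_cst.
have M0 : 0 <= Num.max M 0 by rewrite le_max lexx orbT.
have iF : (mu \x mu)%E.-integrable setT f.
  apply: (@integrable12ltyP _ _ _ _ R mu mu f mf).2.
  pose c := Num.max M 0 * fine (mu `[p, q]).
  have fin : mu `[p, q] \is a fin_num.
    have := @lebesgue_measure_itv R `[p, q]; rewrite /= => ->.
    by case: ifP.
  apply: (@le_lt_trans _ _ (\int[mu]_x (`|A' x| * c)%:E)%E); last first.
    have /integrableP[_] := integrable_scale measurableT c iA'.
    apply: le_lt_trans; rewrite le_eqVlt; apply/orP; left; apply/eqP.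
    apply: eq_integral => x _ /=; rewrite normrM mulrC (@ger0_norm _ c)//.
    by rewrite mulr_ge0// fine_ge0.
  apply: ge0_le_integral => //.
  - by move=> x _; apply: integral_ge0.
  - exact: (@measurable_fun_fubini_tonelli_F _ _ _ _ R mu (abse \o f)
      (measurableT_comp (@abse_measurable R setT) mf) (fun z => abse_ge0 (f z))).
  - apply/measurable_EFinP; apply: measurable_funM => //.
    exact: measurableT_comp.
  move=> x _; apply: (@le_trans _ _ (\int[mu]_(o in `[p, q]) (`|A' x| * Num.max M 0)%:E)%E).
    rewrite [leRHS]integral_mkcond; apply: ge0_le_integral => //.
    + apply: measurableT_comp => //; apply: (measurableT_comp mf).
      exact: measurable_pair1.
    + apply/measurable_restrict => //; exact: measurable_cst.
    move=> o _; rewrite fE patchE /=; case: ifPn => [/andP[/andP[h1 h2] h3]|_]; last first.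
      by rewrite normr0; case: ifP => // _; rewrite lee_fin mulr_ge0.
    have oq : o <= q := le_trans h2 h3.
    rewrite ifT; last by rewrite inE/= in_itv/= h1.
    rewrite lee_fin normrM; apply: ler_wpM2l => //.
    by rewrite le_max BM// h1.
  by rewrite integral_cst// /c -[X in (_ * X <= _)%E]fineK// -EFinM lee_fin mulrA.
pose g1 := (fun s => A s * \int[mu]_(o in `[p, s]) B o).
pose g2 := (fun o => B o * \int[mu]_(s in `[o, q]) A s).
have iAS u v : p <= u -> v <= q -> mu.-integrable `[u, v] (EFin \o A).
  move=> pu vq; apply: integrableS iA => // t /=; rewrite !in_itv/= => /andP[ut tv].
  by rewrite (le_trans pu ut) (le_trans tv vq).
have FE s : (\int[mu]_o f (s, o))%E = ((EFin \o g1) \_ `[p, q]) s.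
  rewrite patchE; case: ifPn => [/set_mem/=|/negP nD].
    rewrite in_itv/= => /andP[ps sq].
    have iB : mu.-integrable `[p, s] (EFin \o B).
      apply: continuous_compact_integrable; first exact: segment_compact.
      exact: continuous_subspaceT.
    rewrite /g1 -RintegralZl// -Rintegral_fin; last by apply: integrable_scale.
    rewrite [RHS]integral_mkcond; apply: eq_integral => o _.
    rewrite patchE /f/= sq andbT.
    by rewrite (_ : (o \in _) = (p <= o) && (o <= s)); [case: ifP|rewrite mem_setE in_itv].
    exact: measurable_itv.
  transitivity (0%E : \bar R); last by [].
  apply: integral0_eq => o _; rewrite /f/=; case: ifPn => // /andP[/andP[h1 h2] h3].
  by exfalso; apply: nD; rewrite mem_setE in_itv/= h3 (le_trans h1 h2).
have GE o : (\int[mu]_s f (s, o))%E = ((EFin \o g2) \_ `[p, q]) o.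
  rewrite patchE; case: ifPn => [/set_mem/=|/negP nD].
    rewrite in_itv/= => /andP[po oq].
    rewrite /g2 -RintegralZl//; last exact: iAS.
    rewrite -Rintegral_fin; last by apply: integrable_scale => //; exact: iAS.
    rewrite [RHS]integral_mkcond; apply: eq_integral => s _.
    rewrite patchE /f/= po/= mulrC.
    by rewrite (_ : (s \in _) = (o <= s) && (s <= q)); [case: ifP|rewrite mem_setE in_itv].
    exact: measurable_itv.
  transitivity (0%E : \bar R); last by [].
  apply: integral0_eq => s _; rewrite /f/=; case: ifPn => // /andP[/andP[h1 h2] h3].
  by exfalso; apply: nD; rewrite mem_setE in_itv/= h1 (le_trans h2 h3).
have back (g : R -> R) : mu.-integrable setT ((EFin \o g) \_ `[p, q]) ->
    mu.-integrable `[p, q] (EFin \o g).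
  move=> h; have /(_ (EFin \o g))[_] := @integrable_restrict _ _ R mu `[p, q]
    (measurable_itv `[p, q]) setT measurableT.
  by rewrite setTI; apply.
have FE' : fubini_F mu f = (EFin \o g1) \_ `[p, q] by apply/funext => s; exact: FE.
have GE' : fubini_G mu f = (EFin \o g2) \_ `[p, q] by apply/funext => o; exact: GE.
split.
- by apply: back; rewrite -FE'; exact: integrable_fubini_F iF.
- apply: back; rewrite -GE'; apply/integrableP; split; first exact: measurable_fubini_G iF.
  apply: le_lt_trans ((@integrable21ltyP _ _ _ _ R mu mu f mf).1 iF).
  apply: ge0_le_integral => //.
  + exact: (measurableT_comp (@abse_measurable R setT) (measurable_fubini_G iF)).
  + exact: (@measurable_fun_fubini_tonelli_G _ _ _ _ R mu (abse \o f)
      (measurableT_comp (@abse_measurable R setT) mf) (fun z => abse_ge0 (f z))).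
  + move=> o _; apply: le_abse_integral => //.
    by apply: (measurableT_comp mf); exact: measurable_pair2.
- rewrite /Rintegral; congr fine; rewrite [LHS]integral_mkcond [RHS]integral_mkcond.
  rewrite -[LHS]/(\int[mu]_s ((EFin \o g1) \_ `[p, q]) s)%E.
  rewrite -[RHS]/(\int[mu]_s ((EFin \o g2) \_ `[p, q]) s)%E -FE' -GE'.
  exact: Fubini iF.
Qed.

End Division.

(** * Division by z - t in Paley-Wiener spaces *)

Section PaleyWienerDivision.
Variable R : realType.
Notation mu := (@lebesgue_measure R).
Notation Re := complex.Re.
Notation Im := complex.Im.
Notation normc := Normc.normc.
Implicit Types (z w : R[i]).

Lemma Cintegral_triangle (p q : R) (g : R -> R[i]) w : cintegrable `[p, q] g ->
  Cintegral `[p, q] (fun s => g s * Cintegral `[p, s] (expi w)) =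
  Cintegral `[p, q] (fun o => expi w o * Cintegral `[o, q] g).
Proof.
move=> [g1 g2].
have [i1 j1 e1] := Fubini_triangle g1 (@continuous_Re_expi R w).
have [i2 j2 e2] := Fubini_triangle g2 (@continuous_Im_expi R w).
have [i3 j3 e3] := Fubini_triangle g1 (@continuous_Im_expi R w).
have [i4 j4 e4] := Fubini_triangle g2 (@continuous_Re_expi R w).
apply: complex_eqP.
  transitivity (\int[mu]_(s in `[p, q]) (Re (g s) * \int[mu]_(o in `[p, s]) Re (expi w o))
    - \int[mu]_(s in `[p, q]) (Im (g s) * \int[mu]_(o in `[p, s]) Im (expi w o))).
    rewrite -(@RintegralB _ _ R mu _ _ _ (measurable_itv `[p, q]) i1 i2); apply: eq_Rintegral => s _; exact: ReM.
  rewrite e1 e2 -(@RintegralB _ _ R mu _ _ _ (measurable_itv `[p, q]) j1 j2); apply: eq_Rintegral => o _.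
  by rewrite [RHS]ReM.
transitivity (\int[mu]_(s in `[p, q]) (Re (g s) * \int[mu]_(o in `[p, s]) Im (expi w o))
  + \int[mu]_(s in `[p, q]) (Im (g s) * \int[mu]_(o in `[p, s]) Re (expi w o))).
  rewrite -(@RintegralD _ _ R mu _ _ _ (measurable_itv `[p, q]) i3 i4); apply: eq_Rintegral => s _; exact: ImM.
rewrite e3 e4 addrC -(@RintegralD _ _ R mu _ _ _ (measurable_itv `[p, q]) j4 j3); apply: eq_Rintegral => o _.
by rewrite [RHS]ImM.
Qed.

Lemma L2_bounded (S : set R) (phi : R -> R[i]) (B : R) : bounded_measurable S ->
  measurable_fun S (fun t => Re (phi t)) -> measurable_fun S (fun t => Im (phi t)) ->
  (forall t, S t -> normc (phi t) <= B) -> L2 S phi.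
Proof.
move=> bS m1 m2 hB; split=> //.
have iB : mu.-integrable S (EFin \o (fun=> B ^+ 2)).
  by apply: continuous_integrable => // t; exact: cvg_cst.
have /integrableP[_] := iB; apply: le_lt_trans.
apply: ge0_le_integral => //.
- exact: bS.1.
- by move=> t _; rewrite lee_fin sqr_ge0.
- apply/measurable_EFinP; under eq_fun do rewrite sqr_normc.
  by apply: measurable_funD; exact: measurable_funX.
move=> t St /=; rewrite lee_fin (@ger0_norm _ (B ^+ 2)) ?sqr_ge0//.
by apply: lerXn2r; rewrite ?nnegrE ?normc_ge0 ?hB// (le_trans (normc_ge0 _) (hB t St)).
Qed.

(** With w = z - t and g(s) = phi(s) e^(its), the left side is the integral of g(s) (e^(iws) -
    e^(iwp)). Writing the bracket as iw times the integral of e^(iwo) over [p, s] and exchanging the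
    order gives the bounded density [psi] of the quotient: i e^(-ito) times the tail integral of g
    from o to q. *)
Lemma PW_divide (p q : R) (f : R[i] -> R[i]) (t : R[i]) : PW `[p, q] f ->
  exists2 k, PW `[p, q] k & forall z, f z - f t * expi (z - t) p = (z - t) * k z.
Proof.
move=> [phi Lphi fE]; have bI := bounded_measurable_itv p q.
pose g s := phi s * expi t s; pose G o := Cintegral `[o, q] g.
have ig : cintegrable `[p, q] g.
  by apply: cintegrableM => //; exact: L2_expi.
have [g1 g2] := ig.
have c1 : continuous (fun _ : R => 1 : R) by move=> x; exact: cvg_cst.
have [_ j1 _] := Fubini_triangle g1 c1; have [_ j2 _] := Fubini_triangle g2 c1.
have mG1 : measurable_fun `[p, q] (fun o => Re (G o)).
  have /integrableP[/measurable_EFinP h _] := j1.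
  by apply: eq_measurable_fun h => o _; rewrite /= mul1r.
have mG2 : measurable_fun `[p, q] (fun o => Im (G o)).
  have /integrableP[/measurable_EFinP h _] := j2.
  by apply: eq_measurable_fun h => o _; rewrite /= mul1r.
have inte (A : R -> R) o : mu.-integrable `[p, q] (EFin \o A) -> p <= o ->
    `|\int[mu]_(s in `[o, q]) A s| <= \int[mu]_(s in `[p, q]) `|A s|.
  move=> iA po; have sub : `[o, q] `<=` `[p, q].
    by move=> s /=; rewrite !in_itv/= => /andP[os sq]; rewrite (le_trans po os).
  have iAo : mu.-integrable `[o, q] (EFin \o A) by exact: integrableS iA.
  apply: le_trans (le_normr_Rintegral _ iAo) _ => //.
  rewrite -lee_fin -!Rintegral_fin//; last 2 first.
  - by rewrite (_ : _ \o _ = abse \o (EFin \o A))//; exact: integrable_abse.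
  - by rewrite (_ : _ \o _ = abse \o (EFin \o A))//; exact: integrable_abse.
  apply: ge0_subset_integral => //.
  by apply/measurable_EFinP; apply: measurableT_comp => //;
     have /integrableP[/measurable_EFinP] := iA.
pose B := \int[mu]_(s in `[p, q]) `|Re (g s)| + \int[mu]_(s in `[p, q]) `|Im (g s)|.
have GB o : p <= o -> normc (G o) <= B.
  by move=> po; apply: normc_le; exact: inte.
pose psi o := (0 +i* 1) * expi (- t) o * G o.
have normc_i1 : normc (0 +i* 1) = 1 :> R by rewrite -[0 +i* 1]mulr1 normc_i Normc.normc1.
have me : measurable_fun `[p, q] (fun o => Re ((0 +i* 1) * expi (- t) o)) /\
    measurable_fun `[p, q] (fun o => Im ((0 +i* 1) * expi (- t) o)).
  have cR := @continuous_Re_expi R (- t); have cI := @continuous_Im_expi R (- t).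
  split; apply: measurable_funTS; apply: continuous_measurable_fun.
    rewrite (_ : (fun o => _) = (fun o => - Im (expi (- t) o))); last first.
      by apply/funext => o; rewrite ReM/=; ring.
    by move=> o; apply: cvgN; exact: cI.
  rewrite (_ : (fun o => _) = (fun o => Re (expi (- t) o))) //.
  by apply/funext => o; rewrite ImM/=; ring.
have Lpsi : L2 `[p, q] psi.
  apply: (@L2_bounded _ _ (expR (`|Im t| * (`|p| + `|q|)) * B)) => //.
  - have [m1 m2] := me.
    apply: eq_measurable_fun (measurable_funB (measurable_funM m1 mG1)
      (measurable_funM m2 mG2)) => o _; by rewrite /psi ReM.
  - have [m1 m2] := me.
    apply: eq_measurable_fun (measurable_funD (measurable_funM m1 mG2)
      (measurable_funM m2 mG1)) => o _; by rewrite /psi ImM.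
  - move=> o oI; have /andP[po oq] : p <= o <= q by move: oI; rewrite /= in_itv.
    rewrite !Normc.normcM normc_i1 mul1r normc_expi; apply: ler_pM => //.
    + exact: normc_ge0.
    + rewrite ler_expR ImN opprK; apply: le_trans (ler_norm _) _.
      rewrite normrM; apply: ler_wpM2l => //.
      have := ler_norm q; have := ler_norm (- p); rewrite normrN ler_norml => h1 h2.
      by have := normr_ge0 p; have := normr_ge0 q => h3 h4; apply/andP; split; lra.
    + exact: GB.
exists (fun z => Cintegral `[p, q] (fun o => psi o * expi z o)); first by exists psi.
move=> z; pose w := z - t.
have etw s : expi t s * expi w s = expi z s by rewrite -expiD /w addrC subrK.
have fzE : f z = Cintegral `[p, q] (fun s => g s * expi w s).
  by rewrite fE; apply: eq_Cintegral => s _; rewrite /g -[RHS]mulrA etw.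
have iw : cintegrable `[p, q] (fun s => g s * expi w s).
  have -> : (fun s => g s * expi w s) = (fun s => phi s * expi z s).
    by apply/funext => s; rewrite /g -[LHS]mulrA etw.
  by apply: cintegrableM => //; exact: L2_expi.
have ftE : f t * expi w p = Cintegral `[p, q] (fun s => expi w p * g s).
  by rewrite CintegralZ// mulrC fE.
have ig' : cintegrable `[p, q] (fun s => expi w p * g s) by exact: cintegrableZ.
have iN := cintegrableZ (-1) (measurable_itv `[p, q]) ig'.
rewrite fzE ftE; transitivity (Cintegral `[p, q] (fun s => g s * expi w s
    + -1 * (expi w p * g s))).
  by rewrite (CintegralD _ iw iN)//; congr (_ + _); apply/esym;
     exact: etrans (CintegralZ (-1) (measurable_itv `[p, q]) ig') (mulN1r _).
transitivity (Cintegral `[p, q] (fun s => (0 +i* 1) * w *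
    (g s * Cintegral `[p, s] (expi w)))).
  apply: eq_Cintegral => s /=; rewrite in_itv/= => /andP[ps _].
  by rewrite [RHS]mulrCA (Cintegral_expi w ps); ring.
rewrite CintegralZ//; last first.
  have [i1 _ _] := Fubini_triangle g1 (@continuous_Re_expi R w).
  have [i2 _ _] := Fubini_triangle g2 (@continuous_Im_expi R w).
  have [i3 _ _] := Fubini_triangle g1 (@continuous_Im_expi R w).
  have [i4 _ _] := Fubini_triangle g2 (@continuous_Re_expi R w).
  split; under [X in _ \o X]eq_fun do rewrite ReImE.
    under [X in _ \o X]eq_fun do rewrite -mulN1r.
    by apply: integrable_add => //; exact: integrable_scale.
  by apply: integrable_add.
rewrite (Cintegral_triangle w ig) mulrAC mulrC; congr (_ * _).
rewrite -CintegralZ//; last first.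
  have [_ k1 _] := Fubini_triangle g1 (@continuous_Re_expi R w).
  have [_ k2 _] := Fubini_triangle g2 (@continuous_Im_expi R w).
  have [_ k3 _] := Fubini_triangle g1 (@continuous_Im_expi R w).
  have [_ k4 _] := Fubini_triangle g2 (@continuous_Re_expi R w).
  split; under [X in _ \o X]eq_fun do rewrite ReImE.
    under [X in _ \o X]eq_fun do rewrite -mulN1r.
    by apply: integrable_add => //; exact: integrable_scale.
  by apply: integrable_add.
apply: eq_Cintegral => o _; rewrite -/(G o) -/(expi z o).
have -> : expi w o = expi (- t) o * expi z o by rewrite -expiD addrC.
by rewrite /psi; ring.
Qed.

(** Because z g = t g + (z - t) g, the factor z only adds g to the quotient. *)
Lemma PW_zPW_divide (p q : R) (F : R[i] -> R[i]) (t : R[i]) : PW_zPW `[p, q] F ->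
  exists2 k, PW `[p, q] k & forall z, F z - F t * expi (z - t) p = (z - t) * k z.
Proof.
have bI := bounded_measurable_itv p q.
move=> [f [g [Pf Pg FE]]].
have [kf Pkf fk] := PW_divide t Pf; have [kg Pkg gk] := PW_divide t Pg.
exists (fun z => t * kg z + (1 * kf z + g z)).
  by apply: PW_lin => //; exact: PW_lin.
move=> z; have := fk z; have := gk z; rewrite !FE mul1r => hg hf.
transitivity ((f z - f t * expi (z - t) p) + t * (g z - g t * expi (z - t) p)
  + (z - t) * g z); first by ring.
by rewrite hg hf; ring.
Qed.

End PaleyWienerDivision.

(** * Bounding a complex derivative *)

Section Derivative.
Variable R : realType.
Notation normc := Normc.normc.

(* F being complex differentiable, real increments suffice to bound the derivative. *)
Lemma normc_cderive_le (F : R[i] -> R[i]) (t : R[i]) (B : R) : entire F ->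
  F t = 0 ->
  (forall h : R, h != 0 -> normc (F (t + h%:C)) <= `|h| * B) ->
  normc (cderive F t) <= B.
Proof.
move=> eF Ft0 FB; have dF := eF t.
pose f : R[i]^o -> R[i]^o := F.
have cD : (fun h : R[i]^o => h^-1 *: (f (h + t) - f t)) @ 0^' --> (cderive F t : R[i]^o).
  have e : (fun h : R[i]^o => h^-1 *: (f (h + t) - f t)) =
      (fun h => h^-1 *: ((f \o shift t) (h *: 1) - f t)).
    by apply/funext => h; rewrite /= /shift /= [h *: 1]mulr1.
  by rewrite /cderive /derive1 -/f e; exact: dF.
apply/ler_addgt0Pr => e e0.
have e0' : (0 : R[i]) < e%:C by rewrite ltcR.
have := (@cvgrPdist_lt _ _ _ _ _ _ _).1 cD _ e0'.
move=> near0; have /nbhs_ballP[d /= d0 dP] : nbhs (0 : R[i]^o) (fun h : R[i]^o => h != 0 ->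
    `|(cderive F t : R[i]^o) - h^-1 *: (f (h + t) - f t)| < e%:C) by exact: near0.
have [d' dE] : exists d' : R, d = d'%:C.
  by apply/complex_realP; rewrite gtr0_real.
have d'0 : 0 < d' by rewrite -ltcR -dE.
pose h := d' / 2; have h0 : 0 < h by rewrite divr_gt0.
have hC0 : h%:C != 0 :> R[i] by apply/eqP => -[/eqP]; rewrite gt_eqF.
have bh : ball (0 : R[i]^o) d (h%:C : R[i]^o).
  rewrite -ball_normE /ball_/= sub0r normrN normc_def /= expr0n/= addr0 sqrtr_sqr.
  by rewrite gtr0_norm// dE ltcR /h; lra.
pose q : R[i] := (h%:C)^-1 * F (h%:C + t).
have hlt : normc (cderive F t - q) < e.
  have := dP _ bh hC0; rewrite -[f t]/(F t) Ft0 subr0.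
  rewrite -[h%:C^-1 *: _]/q -[`|_ - _|]/((normc (cderive F t - q))%:C).
  by rewrite ltcR.
have qB : normc q <= B.
  rewrite /q Normc.normcM Normc.normcV addrC.
  have -> : normc h%:C = h by rewrite /= expr0n/= addr0 sqrtr_sqr gtr0_norm.
  rewrite ler_pdivrMl//; have := FB h; rewrite (gtr0_norm h0); apply.
  by rewrite gt_eqF.
have -> : cderive F t = (cderive F t - q) + q by rewrite subrK.
by apply: le_trans (le_normcD _ _) _; rewrite addrC; apply: lerD => //; exact: ltW.
Qed.

End Derivative.

(** * Elimination of exponentials in favour of kernel norms *)

Section Arithmetic.
Variable R : realType.

(** Here X = |h(z)|, P = |F^+(t)|, W = 1 + |Im t|, e is an energy, N and N' are the kernel norms of
    [-pi, pi] and of the gap, A and M their exponentials. All occurrences of W cancel. *)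
Lemma bound_of_energy (C1 C2 C3 c4 c5 W P N N' e M A X : R) :
  0 < C1 -> 0 < C2 -> 0 < C3 -> 0 < c4 -> 0 < c5 -> 0 < W -> 0 <= P -> 0 <= N ->
  0 <= N' -> 0 <= e -> 0 <= M -> 0 <= X ->
  X ^+ 2 <= C1 * (P ^+ 2 * (C2 * M / W)) * e -> e * W <= C3 * A ->
  c4 * A <= N ^+ 2 * W -> c5 * M <= 2 * (N' ^+ 2 * W) ->
  X <= Num.sqrt (2 * C1 * C2 * C3 / (c4 * c5)) * (P * N * N').
Proof.
move=> C10 C20 C30 c40 c50 W0 P0 N0 N'0 e0 M0 X0 hX he hA hM.
have D0 : 0 < 2 * C1 * C2 * C3 / (c4 * c5) by rewrite divr_gt0 ?mulr_gt0.
have s0 := ltW D0; have r0 := sqrtr_ge0 (2 * C1 * C2 * C3 / (c4 * c5)).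
rewrite -(ler_pXn2r (ltn0Sn 1)) ?nnegrE// ?mulr_ge0// exprMn sqr_sqrtr//.
have h1 : e * c4 <= C3 * N ^+ 2.
  rewrite -(ler_pM2r W0); have := ler_wpM2l (ltW C30) hA.
  have := ler_wpM2l (ltW c40) he; lra.
have h2 : c5 * (M / W) <= 2 * N' ^+ 2 by rewrite mulrA ler_pdivrMr//; lra.
have h3 : (c5 * (M / W)) * (e * c4) <= (2 * N' ^+ 2) * (C3 * N ^+ 2).
  by apply: ler_pM => //; rewrite mulr_ge0 ?divr_ge0// ltW.
have k0 : 0 <= C1 * C2 * P ^+ 2 by rewrite !mulr_ge0 ?sqr_ge0 ?(ltW C10) ?(ltW C20).
have := ler_wpM2l k0 h3; move=> h4; apply: le_trans hX _.
rewrite [leRHS]mulrAC ler_pdivlMr ?mulr_gt0// !exprMn; lra.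
Qed.

(** A lower bound for the product of the two kernel norms, available once the product of their
    exponentials outgrows W^2. *)
Lemma one_le_of_lower (C c4 c5 W N N' A B : R) : 0 < c4 -> 0 < c5 -> 0 < W ->
  0 <= N -> 0 <= N' -> 0 <= A -> 0 <= B ->
  c4 * A <= N ^+ 2 * W -> c5 * B <= N' ^+ 2 * W -> W ^+ 2 <= C * (A * B) -> 
  1 <= Num.sqrt (C / (c4 * c5)) * (N * N').
Proof.
move=> c40 c50 W0 N0 N'0 A0 B0 hA hB hW.
have W20 : 0 < W ^+ 2 by rewrite exprn_gt0.
have AB0 : 0 <= A * B by exact: mulr_ge0.
have C0 : 0 < C.
  rewrite ltNge; apply/negP => C0; have := lt_le_trans W20 hW.
  by rewrite ltNge mulr_le0_ge0.
have r0 := sqrtr_ge0 (C / (c4 * c5)).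
rewrite -(ler_pXn2r (ltn0Sn 1)) ?nnegrE ?mulr_ge0// expr1n exprMn sqr_sqrtr; last first.
  by rewrite divr_ge0 ?mulr_ge0// ltW.
rewrite [leRHS]mulrAC ler_pdivlMr ?mulr_gt0// mul1r -(ler_pM2r W20).
have h1 : (c4 * A) * (c5 * B) <= (N ^+ 2 * W) * (N' ^+ 2 * W).
  by apply: ler_pM => //; rewrite mulr_ge0// ltW.
have h2 := ler_wpM2l (ltW C0) h1.
have h3 : c4 * c5 * W ^+ 2 <= c4 * c5 * (C * (A * B)).
  by apply: ler_wpM2l => //; rewrite mulr_ge0// ltW.
rewrite !exprMn; lra.
Qed.

End Arithmetic.

(** * The derivative of the generating function at its remaining zeros *)

Section GeneratingFunction.
Variable R : realType.
Notation Re := complex.Re.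
Notation Im := complex.Im.
Notation normc := Normc.normc.
Variables (a b : R).
Hypotheses (pa : - pi < a) (ab : a < b) (bp : b < pi).
Let E := `[- pi, a] `|` `[b, pi].

Lemma PW_kernel (S : set R) (t : R[i]) : bounded_measurable S ->
  PW S (fun z => Cintegral S (expi (z - t))).
Proof.
move=> bS; exists (expi (- t)); first exact: L2_expi.
by move=> z; apply: eq_Cintegral => s _; rewrite -/(expi z s) -expiD addrC.
Qed.

(* Dividing F^- and F^+ separately by z - t, after subtracting multiples of
   exponentials at the left endpoints -pi and b, leaves F^+(t) times a difference
   of exponentials, which is a kernel of [-pi, a] plus a kernel of the gap. *)
Lemma divide_by_zero (F Fm Fp : R[i] -> R[i]) (t : R[i]) :
  PW_zPW `[- pi, a] Fm -> PW_zPW `[b, pi] Fp -> (forall z, F z = Fm z + Fp z) ->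
  F t = 0 -> exists2 h, PW E h & forall z,
    F z = (z - t) * (h z + (0 +i* 1) * Fp t * Cintegral `[a, b] (expi (z - t))).
Proof.
move=> hFm hFp hdec Ft0.
have [km Pkm kmE] := PW_zPW_divide t hFm.
have [kp Pkp kpE] := PW_zPW_divide t hFp.
have bI := @bounded_measurable_itv R.
have mE : measurable E by apply: measurableU.
have bE : bounded_measurable E by exact: bounded_measurableU.
have subm : `[- pi, a] `<=` E by move=> s; left.
have subp : `[b, pi] `<=` E by move=> s; right.
have Pm S f : bounded_measurable S -> S `<=` E -> PW S f -> PW E f.
  by move=> bS SE; apply: PW_sub => //; exact: bS.1.
exists (fun z => (0 +i* 1) * Fp t * Cintegral `[- pi, a] (expi (z - t)) +
    (1 * km z + kp z)).
  have P1 : PW E (fun z => 1 * km z + kp z).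
    exact: (PW_lin 1 bE (Pm _ _ (bI _ _) subm Pkm) (Pm _ _ (bI _ _) subp Pkp)).
  exact: (PW_lin _ bE (Pm _ _ (bI _ _) subm (PW_kernel t (bI _ _))) P1).
move=> z; have Fmt : Fm t = - Fp t by apply/eqP; rewrite -addr_eq0 -hdec Ft0.
have e1 := Cintegral_expi (z - t) (ltW pa).
have e2 := Cintegral_expi (z - t) (ltW ab).
have := kmE z; have := kpE z; rewrite Fmt => hp hm.
have -> : F z = (Fm z - - Fp t * expi (z - t) (- pi)) + (Fp z - Fp t * expi (z - t) b)
    + Fp t * ((expi (z - t) b - expi (z - t) a) + (expi (z - t) a - expi (z - t) (- pi))).
  by rewrite hdec; ring.
by rewrite hp hm -e1 -e2; ring.
Qed.

Lemma derivative_upper (L : set R[i]) (F Fm Fp : R[i] -> R[i]) :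
  entire F -> (forall l, L l -> F l = 0) ->
  PW_zPW `[- pi, a] Fm -> PW_zPW `[b, pi] Fp -> (forall z, F z = Fm z + Fp z) ->
  complete_interpolating E L ->
  exists2 K : R, 0 < K & forall t, F t = 0 -> ~ L t ->
    normc (cderive F t) <= K * (normc (Fp t) * PWnorm (kappa `[- pi, pi] t)
      * PWnorm (kappa `[a, b] (t^*)%C)).
Proof.
move=> eF FL hFm hFp hdec CI.
have pi0 := pi_gt0 R; have pipi : - pi < pi :> R by lra.
have bI := @bounded_measurable_itv R.
have bE : bounded_measurable E by exact: bounded_measurableU.
have Epi : E `<=` `[- pi, pi].
  by move=> s [] /=; rewrite !in_itv/= => /andP[s1 s2]; apply/andP;
    split; move: pa ab bp; lra.
have [c c0 cP] := kappa_gap_lower pa ab bp.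
have [c4 c40 c4P] := kappa_itv_lower pipi.
have [c5 c50 c5P] := kappa_itv_lower ab.
have [d d0 sep] := separated_of_interpolating (erefl _) pa ab bp CI.
have [C3 C30 C3P] := energy_upper pi0 bE.1 Epi.
have [C2 C20 C2P] := kernel_Bessel (ltW ab) pa bp d0 c0.
have ca : 0 < 2 * (pi - `|a|).
  by rewrite mulr_gt0// subr_gt0 ltr_norml; apply/andP;
    split; move: pa ab bp; lra.
have [C6 C60 C6P] := poly_expR_bound ca.
pose W (y : R) : R := 1 + `|y|.
have W0 y : 0 < W y by rewrite ltr_pwDl.
have twosided (S : set R) c' l : (forall r, (r = - pi \/ r = pi) ->
    c' * expR (- 2 * Im l * r) <= PWnorm (kappa S l) ^+ 2 * W (Im l)) ->
    c' * expR (2 * pi * `|Im l|) <= PWnorm (kappa S l) ^+ 2 * W (Im l).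
  have [y0|y0] := leP 0 (Im l) => h.
    have := h (- pi) (or_introl erefl); congr (_ * expR _ <= _).
    by rewrite ger0_norm//; ring.
  have := h pi (or_intror erefl); congr (_ * expR _ <= _).
  by rewrite ltr0_norm//; ring.
have Nlow l : c * expR (2 * pi * `|Im l|) <= PWnorm (kappa E l) ^+ 2 * W (Im l).
  by apply: twosided => r hr; exact: cP.
have N0 l : 0 < PWnorm (kappa E l).
  have : 0 < PWnorm (kappa E l) ^+ 2 * W (Im l).
    by apply: lt_le_trans (Nlow l); rewrite mulr_gt0// expR_gt0.
  rewrite pmulr_lgt0 ?W0// exprn_even_gt0//= => hn.
  by rewrite lt_neqAle eq_sym hn sqrtr_ge0.
have [C1 C10 C1P] := interpolation_bounded bE (fun l _ => N0 l) CI.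
pose K1 := Num.sqrt (2 * C1 * C2 * C3 / (c4 * c5)).
pose K2 := Num.sqrt (C6 / (c4 * c5)).
have K20 : 0 < K2 by rewrite sqrtr_gt0 divr_gt0// mulr_gt0.
have K10 : 0 <= K1 by exact: sqrtr_ge0.
exists (K1 + 2 * (b - a) * K2).
  by rewrite ltr_wpDl// !mulr_gt0// subr_gt0.
move=> t Ft0 nLt.
have [h Ph hE] := divide_by_zero hFm hFp hdec Ft0.
set v := Im t; set P := normc (Fp t); set Np := PWnorm _; set NI := PWnorm _.
have P0 : 0 <= P := normc_ge0 _.
have Np0 : 0 <= Np := sqrtr_ge0 _; have NI0 : 0 <= NI := sqrtr_ge0 _.
have Nplow : c4 * expR (2 * pi * `|v|) <= Np ^+ 2 * W v.
  by apply: twosided => r hr; exact: c4P.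
have NIlow r : (r = a \/ r = b) -> c5 * expR (2 * v * r) <= NI ^+ 2 * W v.
  move=> /(c5P t^*%C); rewrite (_ : Im t^*%C = - v); last by rewrite /v; case: (t).
  by rewrite normrN mulrNN.
pose Mv := expR (2 * v * a) + expR (2 * v * b).
have Mv0 : 0 < Mv by rewrite addr_gt0// expR_gt0.
have NIMv : c5 * Mv <= 2 * (NI ^+ 2 * W v).
  rewrite /Mv mulrDr; have := NIlow a (or_introl erefl).
  by have := NIlow b (or_intror erefl); lra.
(* Since t is not in [L], the factor l - t is nonzero and the bracket in [hE] must vanish. *)
have kI l : L l -> normc (h l) = P * normc (Cintegral `[a, b] (expi (l - t))).
  move=> Ll; have := hE l; rewrite FL// => /esym/eqP; rewrite mulf_eq0 subr_eq0.
  case/orP => [/eqP lt|]; first by case: nLt; rewrite -lt.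
  rewrite addr_eq0 => /eqP ->.
  by rewrite normcN Normc.normcM normc_i.
have hz z : normc (h z) ^+ 2 <= C1 * (P ^+ 2 * (C2 * Mv / W v)) * energy E z.
  apply: C1P => // s us sL.
  have -> : \sum_(l <- s) (normc (h l) / PWnorm (kappa E l)) ^+ 2 = P ^+ 2 *
      \sum_(l <- s) (normc (Cintegral `[a, b] (expi (l - t))) / PWnorm (kappa E l)) ^+ 2.
    rewrite mulr_sumr; apply: eq_big_seq => l ls.
    by rewrite (kI l (sL l ls)) -exprMn mulrA.
  apply: ler_wpM2l; first exact: sqr_ge0.
  exact: (C2P (fun l => PWnorm (kappa E l)) s t (fun l _ => N0 l)
    (fun l _ => Nlow l) us (fun l l' ls ls' => sep l l' (sL l ls) (sL l' ls'))).
(* Points at the height of t suffice, because only real increments are used below; there the energy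
   estimate has the same W as the kernel norms at t. *)
have hbound z : Im z = v -> normc (h z) <= K1 * (P * Np * NI).
  move=> zv; have := C3P z; rewrite zv => en.
  exact: (bound_of_energy C10 C20 C30 c40 c50 (W0 v) P0 Np0 NI0 (energy_ge0 E z)
    (ltW Mv0) (normc_ge0 _) (hz z) en Nplow NIMv).
(* The gap kernel contributes P times a constant near t; this inequality absorbs it. The
   exponentials leave at least e^(2(pi - |a|)|v|), which beats W^2. *)
have one : 1 <= K2 * (Np * NI).
  have w1 : 1 <= W v by rewrite lerDl.
  apply: (one_le_of_lower c40 c50 (W0 v) Np0 NI0 (expR_ge0 _) (expR_ge0 _)
    Nplow (NIlow a (or_introl erefl))).
  apply: le_trans (_ : W v ^+ 5 <= _); first by rewrite ler_weXn2l.
  apply: le_trans (C6P `|v| (normr_ge0 v)) _; apply: ler_wpM2l; first exact: ltW.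
  rewrite -expRD ler_expR; have := ler_norm (- (v * a)); rewrite normrN normrM; lra.
apply: normc_cderive_le => // x x0.
rewrite hE addrAC subrr add0r Normc.normcM.
have -> : normc x%:C = `|x| by rewrite /= expr0n/= addr0 sqrtr_sqr.
apply: ler_wpM2l => //; apply: le_trans (le_normcD _ _) _.
rewrite mulrDl; apply: lerD.
  by apply: hbound; rewrite ImD /= addr0.
rewrite -mulrA normc_i Normc.normcM -/P.
have k2 : normc (Cintegral `[a, b] (expi x%:C)) <= 2 * 1 * (b - a).
  by apply: normc_Cintegral_expi; [exact: ltW|move=> s _; rewrite /= oppr0 mul0r expR0].
have ba : 0 <= 2 * (b - a) by rewrite mulr_ge0// subr_ge0 ltW.
have h5 : P * normc (Cintegral `[a, b] (expi x%:C)) <= P * (2 * 1 * (b - a)).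
  exact: ler_wpM2l.
have h6 := ler_wpM2l (mulr_ge0 P0 ba) one.
move: h5 h6; lra.
Qed.

End GeneratingFunction.

Theorem theorem5 (R : realType) (a b : R)
    (h1 : - pi < a) (h2 : a < b) (h3 : b < pi)
    (L : set R[i]) (F Fm Fp : R[i] -> R[i])
    (hF : generating_function (`[- pi, a] `|` `[b, pi]) L F)
    (hFm : PW_zPW `[- pi, a] Fm) (hFp : PW_zPW `[b, pi] Fp)
    (hdec : forall z, F z = Fm z + Fp z)
    (hsimple : simple_zeros F)
    (hL : complete_interpolating (`[- pi, a] `|` `[b, pi]) L) :
  (0 < ereal_inf
        [set (Normc.normc (Fp t / cderive F t)
              * PWnorm (kappa `[- pi, pi] t)
              * PWnorm (kappa `[a, b] (t^*)%C))%R%:E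
        | t in [set t : R[i] | F t = 0%R /\ ~ L t]])%E.
Proof.
have [eF _ _ FL] := hF.
have [K K0 KP] := derivative_upper h1 h2 h3 eF FL hFm hFp hdec hL.
apply: (@lt_le_trans _ _ (K^-1)%:E); first by rewrite lte_fin invr_gt0.
apply/ereal_infP => _ [t [Ft0 nLt] <-]; rewrite lee_fin.
(* Simplicity of the zeros enters here: at a multiple zero the quotient would be 0 by the convention
   on division. *)
have F'0 : 0 < Normc.normc (cderive F t).
  rewrite lt_neqAle normc_ge0 andbT; apply/eqP => /esym/Normc.eq0_normc F'0.
  by have := hsimple t Ft0; rewrite F'0 eqxx.
have := KP t Ft0 nLt; rewrite Normc.normcM Normc.normcV.
set D := Normc.normc (cderive F t) in F'0 *.
move: D F'0 (Normc.normc (Fp t)) (PWnorm (kappa `[- pi, pi] t))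
  (PWnorm (kappa `[a, b] (t^*)%C)) => D D0 p x y h.
have -> : p / D * x * y = p * x * y / D by ring.
by rewrite ler_pdivlMr// -[leRHS](mulKf (lt0r_neq0 K0)) ler_pM2l ?invr_gt0.
Qed.
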